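(* Let $p$ be a prime, $m\in\mathbb{N}_0$ and $k\in\mathbb{N}$ even. Then no element of $\mathcal{P}_k(p^m)$ is an eta quotient, unless $(k,p^m)$ is one of $(2,4)$, $(2,8)$, $(2,9)$, $(2,16)$, $(4,2)$, $(4,4)$.
   Context: Let $z$ be in the upper half-plane and $q=e^{2\pi i z}$. For even $k\geq2$, $E_k(z)=-\frac{B_k}{2k}+\sum_{n\geq1}\sigma_{k-1}(n)q^n$ with $B_k$ the $k$-th Bernoulli number and $\sigma_{k-1}(n)=\sum_{0<d\mid n}d^{k-1}$. For a positive integer $N$: $\mathcal{E}_2(N)=\langle E_2(z)-dE_2(dz): 1<d\mid N\rangle_{\mathbb{Q}}$, and for $k\geq4$ even $\mathcal{E}_k(N)=\langle E_k(dz):1\leq d\mid N\rangle_{\mathbb{Q}}$. Let $\mathcal{O}_k(N)=\bigcup_{1<d\mid N}\big(\mathcal{E}_k(N/d)\cup\{f(dz): f\in\mathcal{E}_k(N/d)\}\big)$ and $\mathcal{P}_k(N)=\mathcal{E}_k(N)\setminus\mathcal{O}_k(N)$. The Dedekind eta function is $\eta(z)=q^{1/24}\prod_{n\geq1}(1-q^n)$, and an eta quotient of level $N$ is a function $\prod_{t\mid N}\eta(tz)^{r_t}$ with integers $r_t$; its weight is $\sum_{t\mid N} r_t/2$. Here ''eta quotient in $\mathcal{P}_k(p^m)$'' means an eta quotient of level $p^m$ that belongs to $\mathcal{P}_k(p^m)$. *)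

(* Defs.v *)
From HB Require Import structures.
From mathcomp Require Import all_boot all_order all_algebra.
From mathcomp Require Import all_classical all_reals all_analysis.
From mathcomp Require Import complex.
From mathcomp Require Import Rstruct Rstruct_topology.

Set Implicit Arguments.
Unset Strict Implicit.
Unset Printing Implicit Defensive.

Import Order.TTheory GRing.Theory Num.Theory.
Import numFieldNormedType.Exports.

Local Open Scope classical_set_scope.
Local Open Scope ring_scope.
Local Open Scope complex_scope.

(* [:: B_0; ...; B_(n-1)], from the recurrence
   \sum_(j <= n) 'C(n+1, j) B_j = (n == 0) *)
Fixpoint bernoulli_seq (n : nat) : seq rat :=
  if n is n'.+1 then
    let s := bernoulli_seq n' in
    rcons s (((n' == 0)%N%:R - \sum_(j < n') 'C(n'.+1, j)%:R * s`_j) / n'.+1%:R)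
  else [::].

Definition bernoulli (n : nat) : rat := (bernoulli_seq n.+1)`_n.

Lemma size_bernoulli_seq n : size (bernoulli_seq n) = n.
Proof. by elim: n => //= n IHn; rewrite size_rcons IHn. Qed.

Lemma nth_bernoulli_seq n j : (j < n)%N -> (bernoulli_seq n)`_j = bernoulli j.
Proof.
elim: n => // n IHn; rewrite ltnS leq_eqVlt => /predU1P[-> //|ltjn].
by rewrite /= nth_rcons size_bernoulli_seq ltjn IHn.
Qed.

Lemma bernoulli_rec n :
  \sum_(j < n.+1) 'C(n.+1, j)%:R * bernoulli j = (n == 0)%N%:R.
Proof.
rewrite big_ord_recr /= binSn {2}/bernoulli /= nth_rcons size_bernoulli_seq.
rewrite ltnn eqxx mulrC divfK ?pnatr_eq0//.
under [X in _ - X]eq_bigr => j _ do rewrite nth_bernoulli_seq ?ltn_ord//.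
by rewrite addrC subrK.
Qed.

Definition sigma (k n : nat) : nat := (\sum_(d <- divisors n) d ^ k)%N.

Section ModularFunctions.
Variable R : realType.
Local Notation C := R[i].
Implicit Types (z : C) (f g : C -> C) (k N d : nat).

(* R[i] carries its topology only through the regular-algebra alias R[i]^o *)
Definition clim (u : nat -> C) : C := lim ((u : nat -> C^o) @ \oo).

Definition cexp z : C :=
  (expR (complex.Re z) * cos (complex.Im z))
    +i* (expR (complex.Re z) * sin (complex.Im z)).

Definition upper_half_plane : set C := [set z | 0 < complex.Im z].

(* e^(2 pi i z) *)
Definition qparam z : C := cexp (2 * (pi : R)%:C * (0 +i* 1) * z).

Definition dedekind_eta z : C :=
  cexp (2 * (pi : R)%:C * (0 +i* 1) * z / 24)
    * clim (fun n => \prod_(1 <= j < n.+1) (1 - qparam z ^+ j)).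

Definition eisenstein k z : C :=
  - ratr (bernoulli k / (2 * k)%N%:R)
    + clim (fun n => \sum_(1 <= j < n.+1) (sigma k.-1 j)%:R * qparam z ^+ j).

(* Functions on the upper half-plane are total functions compared only there. *)
Definition eqH f g : Prop := forall z, upper_half_plane z -> f z = g z.

Definition dilate d f : C -> C := fun z => f (d%:R * z).

Definition Qspan (s : seq nat) (g : nat -> C -> C) : set (C -> C) :=
  [set f | exists c : nat -> rat,
    eqH f (fun z => \sum_(d <- s) ratr (c d) * g d z)].

(* meant for even k >= 2 *)
Definition eis_space k N : set (C -> C) :=
  if k == 2%N then
    Qspan [seq d <- divisors N | (1 < d)%N]
      (fun d z => eisenstein 2 z - d%:R * dilate d (eisenstein 2) z)
  else Qspan (divisors N) (fun d => dilate d (eisenstein k)).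

Definition old_set k N : set (C -> C) :=
  \bigcup_(d in [set d | (1 < d)%N /\ (d %| N)%N])
    (eis_space k (N %/ d)%N
     `|` [set f | exists2 g, eis_space k (N %/ d)%N g & eqH f (dilate d g)]).

Definition primitive_set k N : set (C -> C) := eis_space k N `\` old_set k N.

Definition eta_quotient N f : Prop :=
  exists r : nat -> int,
    eqH f (fun z => \prod_(t <- divisors N) dilate t dedekind_eta z ^ r t).

End ModularFunctions.

Arguments eis_space {R} k N.
Arguments old_set {R} k N.
Arguments primitive_set {R} k N.
Arguments eta_quotient {R} N f.

(* Main.v *)
Require Import Defs.
From Stdlib Require Import Rdefinitions.
From HB Require Import structures.
From mathcomp Require Import all_boot all_order all_algebra.
From mathcomp Require Import all_classical all_reals all_analysis.
From mathcomp Require Import complex Rstruct Rstruct_topology.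
From mathcomp Require Import ring lra zify.

Set Implicit Arguments.
Unset Strict Implicit.
Unset Printing Implicit Defensive.

Import Order.TTheory GRing.Theory Num.Theory.
Import numFieldNormedType.Exports.

Local Open Scope ring_scope.

(** For n prime to p, the q-expansion a of an element of E_k(p^m) satisfies
    a(p^j n) = a(p^j) sigma_(k-1)(n), and a(1) <> 0 when the element is
    primitive.  Hence a primitive eta quotient is a = q^h G with h = 0 or 1,
    where G is a product of integer powers of P(q^(p^i)) and
    P = prod (1 - q^n).  The logarithmic derivative of P is the generating
    series of - sigma_1; for n prime to p, the n-th coefficient of that of G
    therefore depends only on the exponent of P(q).  Comparing the resulting
    recurrence for a(n) with the values sigma_(k-1)(n) at small n gives
    polynomial equations in powers p'^(k-1) of small primes p', which leave
    p = 2 or 3, k = 2 or 4 and finitely many values of the exponent.  In each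
    remaining case the dissections of the theta function and of the Borweins'
    cubic theta functions compare a with U_p a, and force a(p^j) to satisfy
    a(p^j) - (1 + p^(k-1)) a(p^(j-1)) + p^(k-1) a(p^(j-2)) = 0 for j beyond the
    exceptional levels.  At j = m the left-hand side is the coefficient of
    E_k(p^m z), which is nonzero for primitive forms. *)

(** The obstacle is that the equations at small n determine, up to finitely many values, only the
    exponent x of P(q); the exponents of P(q^p), P(q^(p^2)), ... stay arbitrary. They are never
    solved for. A model with the same x, built from theta, psi or the cubic theta functions, is
    divided out, so that G is the model times an unknown series H(q^p). The part of a prime to p is
    then a fixed series times H(q^p), and its coefficient of q^3 or q^4 shows that H is itself a
    series in q^p. In the basic cases comparing a with U_p a now yields H(q^p) = H(q), hence H = 1;
    the other models are carried by U_p to one already treated, or to a series with odd exponents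
    only. At p = 2 the substitution q -> -q reverses the sign of x, so only positive first
    coefficients need a model, and the equations involve that coefficient through its square u
    alone. The passage from functions to formal series uses real numbers only: on the imaginary axis
    q = w^24 with 0 < w < 1, and asymptotic expansions as w -> 0+ are unique. *)

Record fps (F : Type) := Fps { fcoef :> nat -> F }.

Lemma fpsP (F : Type) (f g : fps F) : (forall n, f n = g n) <-> f = g.
Proof.
by case: f g => [f] [g]; split=> [fg|->//]; congr Fps; apply: functional_extensionality_dep.
Qed.

HB.instance Definition _ (F : Type) := gen_eqMixin (fps F).
HB.instance Definition _ (F : Type) := gen_choiceMixin (fps F).

(** * The ring of formal power series *)

Section FpsRing.
Variable F : fieldType.
Implicit Types (f g h : fps F) (n M : nat).

Definition fps_zero : fps F := Fps (fun=> 0).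
Definition fps_opp f : fps F := Fps (fun n => - f n).
Definition fps_add f g : fps F := Fps (fun n => f n + g n).
Definition fps_one : fps F := Fps (fun n => (n == 0%N)%:R).
Definition fps_mul f g : fps F := Fps (fun n => \sum_(i < n.+1) f i * g (n - i)%N).

Fact fps_addA : associative fps_add.
Proof. by move=> f g h; apply/fpsP => n /=; rewrite addrA. Qed.
Fact fps_addC : commutative fps_add.
Proof. by move=> f g; apply/fpsP => n /=; rewrite addrC. Qed.
Fact fps_add0 : left_id fps_zero fps_add.
Proof. by move=> f; apply/fpsP => n /=; rewrite add0r. Qed.
Fact fps_addN : left_inverse fps_zero fps_opp fps_add.
Proof. by move=> f; apply/fpsP => n /=; rewrite addNr. Qed.

HB.instance Definition _ :=
  GRing.isZmodule.Build (fps F) fps_addA fps_addC fps_add0 fps_addN.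

Definition fps_trunc M f : {poly F} := \poly_(i < M) f i.

Lemma coef_fps_trunc M f n : (n < M)%N -> (fps_trunc M f)`_n = f n.
Proof. by move=> ltnM; rewrite coef_poly ltnM. Qed.

(** Each coefficient of a product is a coefficient of a product of polynomials, from which the ring
    axioms are inherited. *)
Lemma fps_mul_trunc M f g n : (n < M)%N ->
  fps_mul f g n = (fps_trunc M f * fps_trunc M g)`_n.
Proof.
move=> ltnM; rewrite coefM; apply: eq_bigr => i _.
by rewrite !coef_fps_trunc //; move: (ltn_ord i); lia.
Qed.

Fact fps_mulA : associative fps_mul.
Proof.
move=> f g h; apply/fpsP => n; set T := fps_trunc n.+1.
transitivity ((T f * (T g * T h))`_n); last rewrite mulrA.
  rewrite coefM; apply: eq_bigr => i _.
  by rewrite coef_fps_trunc // (@fps_mul_trunc n.+1) //; move: (ltn_ord i); lia.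
rewrite coefM; apply: eq_bigr => i _.
by rewrite coef_fps_trunc ?(@fps_mul_trunc n.+1) //; move: (ltn_ord i); lia.
Qed.

Fact fps_mulC : commutative fps_mul.
Proof.
by move=> f g; apply/fpsP => n; rewrite !(@fps_mul_trunc n.+1) // mulrC.
Qed.

Fact fps_mul1 : left_id fps_one fps_mul.
Proof.
move=> f; apply/fpsP => n; rewrite /= big_ord_recl mul1r subn0 big1 ?addr0 //.
by move=> i _; rewrite mul0r.
Qed.

Fact fps_mulDl : left_distributive fps_mul fps_add.
Proof.
move=> f g h; apply/fpsP => n; rewrite /= -big_split.
by apply: eq_bigr => i _; rewrite mulrDl.
Qed.

Fact fps_one_neq0 : fps_one != fps_zero.
Proof.
by apply/eqP => /(congr1 (fun f : fps F => f 0%N))/eqP; rewrite /= oner_eq0.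
Qed.

HB.instance Definition _ := GRing.Zmodule_isComNzRing.Build (fps F)
  fps_mulA fps_mulC fps_mul1 fps_mulDl fps_one_neq0.

Lemma fpsD f g n : (f + g) n = f n + g n. Proof. by []. Qed.
Lemma fpsN f n : (- f) n = - f n. Proof. by []. Qed.
Lemma fpsB f g n : (f - g) n = f n - g n. Proof. by []. Qed.
Lemma fps0 n : (0 : fps F) n = 0. Proof. by []. Qed.
Lemma fps1 n : (1 : fps F) n = (n == 0%N)%:R. Proof. by []. Qed.
Lemma fpsM f g n : (f * g) n = \sum_(i < n.+1) f i * g (n - i)%N.
Proof. by []. Qed.

Lemma fps_sum (I : Type) (r : seq I) (Q : pred I) (u : I -> fps F) n :
  (\sum_(i <- r | Q i) u i) n = \sum_(i <- r | Q i) u i n.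
Proof. by elim/big_rec2: _ => // i y1 y2 _ <-. Qed.

Lemma fpsMn f m n : (f *+ m) n = f n *+ m.
Proof. by elim: m => // m IH; rewrite !mulrS fpsD IH. Qed.

Lemma fpsMz f (m : int) n : (f *~ m) n = f n *~ m.
Proof. by case: m => m; rewrite ?NegzE ?mulrNz ?fpsN fpsMn. Qed.

Lemma fpsM0 f g : (f * g) 0%N = f 0%N * g 0%N.
Proof. by rewrite fpsM big_ord1. Qed.

Lemma fpsX0 f m : (f ^+ m) 0%N = f 0%N ^+ m.
Proof. by elim: m => [|m IH]; rewrite ?expr0 // !exprS fpsM0 IH. Qed.

Definition fpsC (c : F) : fps F := Fps (fun n => if n == 0%N then c else 0).

Lemma fpsCM c f n : (fpsC c * f) n = c * f n.
Proof.
by rewrite fpsM big_ord_recl subn0 big1 ?addr0 // => i _; rewrite mul0r.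
Qed.

Fact fpsC_zmod : zmod_morphism fpsC.
Proof. by move=> a b; apply/fpsP => n; rewrite fpsB; case: n => //= n; rewrite subr0. Qed.
HB.instance Definition _ := GRing.isZmodMorphism.Build F (fps F) fpsC fpsC_zmod.
Fact fpsC_monoid : monoid_morphism fpsC.
Proof.
split=> [|a b]; first by apply/fpsP => -[].
by apply/fpsP => -[|n]; rewrite fpsCM //= mulr0.
Qed.
HB.instance Definition _ := GRing.isMonoidMorphism.Build F (fps F) fpsC fpsC_monoid.

Lemma fps_natM m f n : (m%:R * f) n = m%:R * f n.
Proof. by rewrite -(rmorph_nat fpsC) fpsCM. Qed.

Definition fpsX : fps F := Fps (fun n => (n == 1%N)%:R).

Lemma fpsXM f n : (fpsX * f) n = if n is n'.+1 then f n' else 0.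
Proof.
rewrite fpsM; case: n => [|n]; first by rewrite big_ord1 mul0r.
rewrite big_ord_recl mul0r add0r big_ord_recl mul1r big1 ?addr0 /=.
  by rewrite /bump /= subSS subn0.
by move=> i _; rewrite mul0r.
Qed.

Lemma fpsXnM m f n : (fpsX ^+ m * f) n = if (m <= n)%N then f (n - m)%N else 0.
Proof.
elim: m n => [|m IH] n; first by rewrite mul1r subn0.
by rewrite exprS -mulrA fpsXM; case: n => // n; rewrite IH.
Qed.

Lemma fpsXn m n : (fpsX ^+ m) n = (n == m)%:R.
Proof. by rewrite -[_ ^+ _]mulr1 fpsXnM fps1 subn_eq0 eqn_leq andbC; case: leqP. Qed.

Lemma fpsX_inj f g : fpsX * f = fpsX * g -> f = g.
Proof.
by move=> fg; apply/fpsP => n; move: (fpsXM f n.+1); rewrite fg fpsXM.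
Qed.

(* congruence modulo q^M *)
Definition eqm M f g := forall n, (n < M)%N -> f n = g n.

Lemma eqm_eq f g : (forall M, eqm M f g) -> f = g.
Proof. by move=> fg; apply/fpsP => n; apply: (fg n.+1). Qed.

Lemma eqm_refl M f : eqm M f f. Proof. by []. Qed.
Lemma eqm_sym M f g : eqm M f g -> eqm M g f.
Proof. by move=> fg n /fg. Qed.
Lemma eqm_trans M g f h : eqm M f g -> eqm M g h -> eqm M f h.
Proof. by move=> fg gh n nM; rewrite fg ?gh. Qed.

Lemma eqmD M f f' g g' : eqm M f f' -> eqm M g g' -> eqm M (f + g) (f' + g').
Proof. by move=> ff gg n nM; rewrite !fpsD ff ?gg. Qed.

Lemma eqmM M f f' g g' : eqm M f f' -> eqm M g g' -> eqm M (f * g) (f' * g').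
Proof.
move=> ff gg n nM; rewrite !fpsM; apply: eq_bigr => i _.
by rewrite ff ?gg //; move: (ltn_ord i); lia.
Qed.

Lemma eqmX M f f' m : eqm M f f' -> eqm M (f ^+ m) (f' ^+ m).
Proof.
by move=> ff; elim: m => [|m IH] //; rewrite !exprS; apply: eqmM.
Qed.

Lemma eqm_sum M (I : Type) (r : seq I) (Q : pred I) (u v : I -> fps F) :
  (forall i, Q i -> eqm M (u i) (v i)) ->
  eqm M (\sum_(i <- r | Q i) u i) (\sum_(i <- r | Q i) v i).
Proof.
by move=> uv n nM; rewrite !fps_sum; apply: eq_bigr => i Qi; apply: uv.
Qed.

Lemma fpsX_ord f m n : f 0%N = 0 -> (n < m)%N -> (f ^+ m) n = 0.
Proof.
move=> f0; elim: m n => // m IH n nm; rewrite exprS fpsM big1 // => -[[|i] lei] _.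
  by rewrite f0 mul0r.
by rewrite /= IH ?mulr0 //; lia.
Qed.

Definition fps_unit : pred (fps F) := fun f => f 0%N != 0.

(* the geometric series of 1 - f / f 0, truncated coefficientwise *)
Definition fps_inv f : fps F := if fps_unit f then
  fpsC (f 0%N)^-1 *
    Fps (fun n => (\sum_(i < n.+1) (1 - fpsC (f 0%N)^-1 * f) ^+ i) n)
  else f.

Fact fps_mulV : {in fps_unit, left_inverse 1 fps_inv *%R}.
Proof.
move=> f uf; have {}uf : f 0%N != 0 := uf; rewrite /fps_inv /fps_unit uf; set c := fpsC _;
  set g := 1 - c * f.
have g0 : g 0%N = 0 by rewrite fpsB fpsCM mulVf ?subrr.
rewrite mulrAC -/g; have -> : c * f = 1 - g by rewrite /g opprB addrCA subrr addr0.
apply: eqm_eq => M; apply: (@eqm_trans _ ((1 - g) * \sum_(i < M) g ^+ i)).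
  (* The coefficient of q^n uses only the powers g^i with i <= n; the others below M can be added
     because g^i starts at q^i or later. The sum then telescopes. *)
  apply: eqmM => // n nM /=; rewrite !fps_sum.
  rewrite (big_ord_widen_cond M xpredT (fun i => (g ^+ i) n) nM) big_mkcond /=.
  by apply: eq_bigr => i _; case: ltnP => // ni; rewrite fpsX_ord.
rewrite -[1 - g]opprB mulNr -subrX1 opprB => n nM.
by rewrite fpsB fpsX_ord ?subr0.
Qed.

Fact fps_unitPl f g : g * f = 1 -> fps_unit f.
Proof.
move=> /(congr1 (fun f : fps F => f 0%N)); rewrite fpsM0 fps1 /= => gf.
by apply/eqP => f0; move/eqP: gf; rewrite f0 mulr0 eq_sym oner_eq0.
Qed.

Fact fps_inv_out : {in [predC fps_unit], fps_inv =1 id}.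
Proof. by move=> f nuf; rewrite /fps_inv (negPf (nuf : ~~ fps_unit f)). Qed.

HB.instance Definition _ := GRing.ComNzRing_hasMulInverse.Build (fps F)
  fps_mulV fps_unitPl fps_inv_out.

Lemma fps_unitE f : (f \is a GRing.unit) = (f 0%N != 0). Proof. by []. Qed.

Lemma fpsV0 f : f 0%N != 0 -> (f^-1) 0%N = (f 0%N)^-1.
Proof.
move=> uf; have : (f^-1 * f) 0%N = 1 by rewrite mulVr.
by rewrite fpsM0 => /(congr1 (fun x => x / f 0%N)); rewrite mulfK // mul1r.
Qed.

Lemma eqmV M f g : f 0%N != 0 -> g 0%N != 0 -> eqm M f g -> eqm M f^-1 g^-1.
Proof.
move=> uf ug fg; have : eqm M (f^-1 * (g * g^-1)) (f^-1 * (f * g^-1)).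
  by apply: eqmM; [exact: eqm_refl | apply: eqmM; [exact: eqm_sym | exact: eqm_refl]].
by rewrite divrr // mulr1 mulrA mulVr // mul1r.
Qed.

End FpsRing.
Arguments fpsX {F}.

(** * Dilation, dissection, derivation and the substitution q -> -q *)

Section Operators.
Variable F : fieldType.
Implicit Types (f g h : fps F) (n d M : nat).

(* f(q^d) *)
Definition fdil d f : fps F := Fps (fun n => if (d %| n)%N then f (n %/ d)%N else 0).

Lemma fdilE d f n : fdil d f n = if (d %| n)%N then f (n %/ d)%N else 0.
Proof. by []. Qed.

Lemma fdil_mul d f n : (0 < d)%N -> fdil d f (d * n) = f n.
Proof. by move=> d0; rewrite fdilE dvdn_mulr // mulKn. Qed.

Lemma fdil1 f : fdil 1 f = f.
Proof. by apply/fpsP => n; rewrite fdilE dvd1n divn1. Qed.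

Lemma fdil0 d f : (0 < d)%N -> fdil d f 0%N = f 0%N.
Proof. by move=> d0; rewrite fdilE dvdn0 div0n. Qed.

Fact fdil_zmod d : zmod_morphism (fdil d).
Proof.
by move=> f g; apply/fpsP => n; rewrite fpsB !fdilE fpsB; case: ifP; rewrite ?subr0.
Qed.
HB.instance Definition _ d :=
  GRing.isZmodMorphism.Build (fps F) (fps F) (fdil d) (fdil_zmod d).

Fact fdil_monoid d : monoid_morphism (fdil d).
Proof.
split=> [|f g]; apply/fpsP => n; rewrite fdilE.
  rewrite !fps1; case: (posnP d) => [->|d0].
    by rewrite dvd0n divn0; case: eqP.
  case: ifP => [/dvdnP[m ->]|]; first by rewrite mulnK // muln_eq0 (gtn_eqF d0) orbF.
  by case: eqP => // ->; rewrite dvdn0.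
case: (posnP d) => [->|d0].
  rewrite dvd0n divn0; case: eqP => [->|/eqP n0]; first by rewrite !fpsM0 !fdilE.
  rewrite fpsM big1 // => i _; rewrite !fdilE !dvd0n.
  case: eqP => [->|]; last by rewrite mul0r.
  by rewrite subn0 (negPf n0) mulr0.
pose T := @fps_trunc F n.+1.
have dT h i : (i < n.+1)%N -> fdil d h i = (T h \Po 'X^d)`_i.
  move=> ni; rewrite coef_comp_poly_Xn // fdilE; case: ifP => // _.
  by rewrite coef_fps_trunc //; apply: leq_ltn_trans ni; apply: leq_div.
transitivity ((T f * T g \Po 'X^d)`_n).
  rewrite coef_comp_poly_Xn //; case: ifP => // _.
  by rewrite [LHS](@fps_mul_trunc _ n.+1) // ltnS; apply: leq_div.
rewrite comp_polyM coefM fpsM; apply: eq_bigr => i _.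
by rewrite !dT //; move: (ltn_ord i); lia.
Qed.
HB.instance Definition _ d :=
  GRing.isMonoidMorphism.Build (fps F) (fps F) (fdil d) (fdil_monoid d).

Lemma fdilA d e f : (0 < d)%N -> (0 < e)%N -> fdil d (fdil e f) = fdil (d * e) f.
Proof.
move=> d0 e0; apply/fpsP => n; rewrite !fdilE.
case: (boolP (d %| n)%N) => [/dvdnP[m ->]|ndn].
  by rewrite mulnK // [(m * d)%N]mulnC dvdn_pmul2l // divnMl.
by rewrite ifF //; apply: contraNF ndn; apply: dvdn_trans; apply: dvdn_mulr.
Qed.

Lemma fdilX d : (0 < d)%N -> fdil d fpsX = fpsX ^+ d.
Proof.
move=> d0; apply/fpsP => n; rewrite fdilE fpsXn /=.
case: ifP => [/dvdnP[m ->]|nd]; first by rewrite mulnK // -{2}[d]mul1n eqn_pmul2r.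
by case: eqP nd => // ->; rewrite dvdnn.
Qed.

Lemma fdilC d c : (0 < d)%N -> fdil d (fpsC c) = fpsC c.
Proof.
move=> d0; apply/fpsP => n; rewrite fdilE /=; case: ifP => [/dvdnP[m ->]|nd].
  by rewrite mulnK // muln_eq0 (gtn_eqF d0) orbF.
by case: eqP nd => // ->; rewrite dvdn0.
Qed.

Lemma fdil_unit d f : (0 < d)%N -> f 0%N != 0 -> fdil d f \is a GRing.unit.
Proof. by move=> d0 f0; rewrite fps_unitE fdil0. Qed.

Lemma fdil_eqm d M f g : (0 < d)%N -> eqm M f g -> eqm M (fdil d f) (fdil d g).
Proof.
move=> d0 fg n nM; rewrite !fdilE; case: ifP => // _.
by apply: fg; apply: leq_ltn_trans nM; apply: leq_div.
Qed.

Lemma fdil_inj d : (0 < d)%N -> injective (fdil d).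
Proof.
by move=> d0 f g fg; apply/fpsP => n; rewrite -(fdil_mul f n d0) fg fdil_mul.
Qed.

(** A coefficient at n > 0 equals the one at n / d, or is zero when d does not divide n, and n / d <
    n. Identities whose two sides satisfy the same dilation equation are closed by this descent. *)
Lemma fdil_fix d f : (1 < d)%N -> fdil d f = f -> f = fpsC (f 0%N).
Proof.
move=> d1 fE; apply/fpsP => n; elim/ltn_ind: n => -[|n] IH //=.
rewrite -fE fdilE; case: ifP => // dn; rewrite IH ?ltn_Pdiv //= ifF //.
by apply/negbTE; rewrite -lt0n divn_gt0 ?(dvdn_leq _ dn) //; lia.
Qed.

(** The operator U_d. *)
Definition fsec d f : fps F := Fps (fun n => f (d * n)%N).

Definition no_multiple d f := forall n, f (d * n)%N = 0.

Lemma no_multipleD d f g : no_multiple d f -> no_multiple d g -> no_multiple d (f + g).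
Proof. by move=> f0 g0 n; rewrite fpsD f0 g0 addr0. Qed.

Lemma no_multipleM d f g : no_multiple d f -> no_multiple d (f * fdil d g).
Proof.
move=> f0 n; rewrite fpsM big1 // => i _; case: (boolP (d %| i)%N) => [/dvdnP[m ->]|ndi].
  by rewrite mulnC f0 mul0r.
rewrite fdilE ifF ?mulr0 //; apply: contraNF ndi => dni.
by rewrite -(subKn (_ : i <= d * n)%N) -1?ltnS // dvdn_sub // dvdn_mulr.
Qed.

Lemma no_multipleC d c f : no_multiple d f -> no_multiple d (fpsC c * f).
Proof. by move=> f0 n; rewrite fpsCM f0 mulr0. Qed.

Lemma no_multiple_nat d m f : no_multiple d f -> no_multiple d (m%:R * f).
Proof. by rewrite -(rmorph_nat (@fpsC F)); apply: no_multipleC. Qed.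

Lemma no_multipleX d m : (1 < d)%N -> ~~ (d %| m)%N -> no_multiple d (fpsX ^+ m).
Proof.
by move=> d1 dm n; rewrite fpsXn; case: eqP => // nm; rewrite -nm dvdn_mulr in dm.
Qed.

(** Exponents divisible by d and the others do not interact. Every later dissection is read off
    through this uniqueness. *)
Lemma fdil_split_inj d f f' g g' : (0 < d)%N ->
  no_multiple d g -> no_multiple d g' ->
  fdil d f + g = fdil d f' + g' -> f = f' /\ g = g'.
Proof.
move=> d0 g0 g0' E.
have ff : f = f'.
  apply/fpsP => n; have := congr1 (fun f : fps F => f (d * n)%N) E.
  by rewrite !fpsD g0 g0' !addr0 !fdil_mul.
by split=> //; move: E; rewrite ff => /addrI.
Qed.

(** The derivation q d/dq. *)
Definition fder f : fps F := Fps (fun n => n%:R * f n).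

Lemma fderE f n : fder f n = n%:R * f n. Proof. by []. Qed.

Lemma fderM f g : fder (f * g) = fder f * g + f * fder g.
Proof.
apply/fpsP => n; rewrite fpsD !fpsM fderE fpsM mulr_sumr -big_split.
apply: eq_bigr => i _ /=; have le_in : (i <= n)%N by rewrite -ltnS.
by rewrite -{1}(subnKC le_in) natrD mulrDl mulrA; congr (_ + _); ring.
Qed.

Fact fder_zmod : zmod_morphism fder.
Proof. by move=> f g; apply/fpsP => n; rewrite fpsB !fderE fpsB mulrBr. Qed.
HB.instance Definition _ :=
  GRing.isZmodMorphism.Build (fps F) (fps F) fder fder_zmod.

Lemma fder1 : fder 1 = 0.
Proof. by apply/fpsP => -[|n]; rewrite fderE ?mul0r ?mulr0. Qed.

Lemma fderC c f : fder (fpsC c * f) = fpsC c * fder f.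
Proof. by apply/fpsP => n; rewrite fderE !fpsCM fderE mulrCA. Qed.

Lemma fder_dil d f : (0 < d)%N -> fder (fdil d f) = fpsC d%:R * fdil d (fder f).
Proof.
move=> d0; apply/fpsP => n; rewrite fderE fpsCM !fdilE.
case: ifP => [/dvdnP[m ->]|]; last by rewrite !mulr0.
by rewrite mulnK // fderE natrM; ring.
Qed.

Definition ldlog f := fder f / f.

Lemma ldlog1 : ldlog 1 = 0. Proof. by rewrite /ldlog fder1 mul0r. Qed.

Lemma fder_ldlog f : f \is a GRing.unit -> fder f = f * ldlog f.
Proof. by move=> uf; rewrite /ldlog mulrC divrK. Qed.

Lemma ldlog_uniq f g : f \is a GRing.unit -> fder f = f * g -> ldlog f = g.
Proof. by move=> uf E; rewrite /ldlog E mulrAC divrr ?mul1r. Qed.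

Lemma ldlogM f g : f \is a GRing.unit -> g \is a GRing.unit ->
  ldlog (f * g) = ldlog f + ldlog g.
Proof.
move=> uf ug; apply: ldlog_uniq; first by rewrite unitrM uf.
by rewrite fderM !fder_ldlog //; ring.
Qed.

Lemma ldlogX f m : f \is a GRing.unit -> ldlog (f ^+ m) = ldlog f *+ m.
Proof.
move=> uf; elim: m => [|m IH]; first by rewrite ldlog1.
by rewrite exprS ldlogM ?unitrX // IH mulrS.
Qed.

Lemma ldlogV f : f \is a GRing.unit -> ldlog f^-1 = - ldlog f.
Proof.
move=> uf; apply/eqP; rewrite -addr_eq0 addrC -ldlogM ?unitrV // divrr //.
by rewrite ldlog1.
Qed.

Lemma ldlogXz f (m : int) : f \is a GRing.unit -> ldlog (f ^ m) = ldlog f *~ m.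
Proof.
by move=> uf; case: m => m; rewrite ?NegzE ?exprnN ?ldlogV ?mulrNz ?unitrX // ldlogX.
Qed.

Lemma ldlog_dil d f : (0 < d)%N -> f \is a GRing.unit ->
  ldlog (fdil d f) = fpsC d%:R * fdil d (ldlog f).
Proof.
move=> d0 uf; apply: ldlog_uniq; first exact: fdil_unit.
by rewrite fder_dil // fder_ldlog // rmorphM /=; ring.
Qed.

(* q |-> -q *)
Definition fsgn f : fps F := Fps (fun n => (-1) ^+ n * f n).

Lemma fsgnE f n : fsgn f n = (-1) ^+ n * f n. Proof. by []. Qed.

Fact fsgn_zmod : zmod_morphism fsgn.
Proof. by move=> f g; apply/fpsP => n; rewrite fpsB !fsgnE fpsB mulrBr. Qed.
HB.instance Definition _ :=
  GRing.isZmodMorphism.Build (fps F) (fps F) fsgn fsgn_zmod.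

Fact fsgn_monoid : monoid_morphism fsgn.
Proof.
split=> [|f g]; apply/fpsP => n; rewrite fsgnE; first by case: n => [|n];
  rewrite fps1 ?mul1r ?mulr0.
rewrite !fpsM mulr_sumr; apply: eq_bigr => i _; rewrite !fsgnE.
have le_in : (i <= n)%N by rewrite -ltnS.
by rewrite -{1}(subnKC le_in) exprD; ring.
Qed.
HB.instance Definition _ :=
  GRing.isMonoidMorphism.Build (fps F) (fps F) fsgn fsgn_monoid.

Lemma fsgn_dil f : fsgn (fdil 2 f) = fdil 2 f.
Proof.
apply/fpsP => n; rewrite fsgnE fdilE dvdn2; case: ifP; last by rewrite mulr0.
by move=> en; rewrite -signr_odd (negPf en) mul1r.
Qed.

Lemma fsgn_unit f : f \is a GRing.unit -> fsgn f \is a GRing.unit.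
Proof. by rewrite !fps_unitE fsgnE mul1r. Qed.

Lemma fder_sgn f : fder (fsgn f) = fsgn (fder f).
Proof. by apply/fpsP => n; rewrite !(fsgnE, fderE); ring. Qed.

Lemma ldlog_sgn f : f \is a GRing.unit -> ldlog (fsgn f) = fsgn (ldlog f).
Proof.
move=> uf; apply: ldlog_uniq; first exact: fsgn_unit.
by rewrite fder_sgn fder_ldlog // rmorphM.
Qed.

End Operators.

Section LogDerivativeInjective.
Variable F : numFieldType.
Implicit Types f g : fps F.

Lemma fder_eq0 f : fder f = 0 -> f = fpsC (f 0%N).
Proof.
move=> f0; apply/fpsP => -[|n] //=; have := congr1 (fun f : fps F => f n.+1) f0.
by rewrite fderE fps0 => /eqP; rewrite mulf_eq0 pnatr_eq0 => /eqP.
Qed.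

(** The quotient has derivative zero, hence is constant in characteristic zero. Product identities
    thereby become linear identities between divisor sums. *)
Lemma ldlog_inj f g : f 0%N = 1 -> g 0%N = 1 -> ldlog f = ldlog g -> f = g.
Proof.
move=> f0 g0 fg.
have uf : f \is a GRing.unit by rewrite fps_unitE f0 oner_eq0.
have ug : g \is a GRing.unit by rewrite fps_unitE g0 oner_eq0.
have uh : f / g \is a GRing.unit by rewrite unitrM uf unitrV.
have : fder (f / g) = 0.
  by rewrite fder_ldlog // ldlogM ?unitrV // ldlogV // fg subrr mulr0.
move/fder_eq0; rewrite fpsM0 fpsV0 g0 ?oner_eq0 // f0 divr1 rmorph1 => fg1.
by rewrite -[f](divrK ug) fg1 mul1r.
Qed.

End LogDerivativeInjective.

(** * Divisor sums at prime powers *)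

Section Sigma.
Implicit Types (K n p s : nat).

Lemma sum_divisors_ord (V : nmodType) n M (G : nat -> V) : (0 < n <= M)%N ->
  \sum_(d <- divisors n) G d = \sum_(i < M | (i.+1 %| n)%N) G i.+1.
Proof.
case/andP=> n0 nM; rewrite -(big_mkord (fun i => i.+1 %| n)%N (fun i => G i.+1)).
rewrite -(big_add1 _ _ 0 M.+1 (fun i => i %| n)%N G) -big_filter.
apply: perm_big; apply: uniq_perm; rewrite ?divisors_uniq ?filter_uniq ?iota_uniq //.
move=> d; rewrite mem_filter mem_index_iota -dvdn_divisors //.
by case: (boolP (d %| n)%N) => //= dn; rewrite (dvdn_gt0 n0 dn) ltnS (leq_trans (dvdn_leq n0 dn)).
Qed.

(** The divisors prime to p are those of n; the others are p times the divisors of p^s n. *)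
Lemma sigma_mulp K p n s : prime p -> (0 < n)%N -> ~~ (p %| n)%N ->
  sigma K (p ^ s.+1 * n) = (sigma K n + p ^ K * sigma K (p ^ s * n))%N.
Proof.
move=> pp n0 pn; have p0 := prime_gt0 pp.
have N0 t : (0 < p ^ t * n)%N by rewrite muln_gt0 expn_gt0 p0.
rewrite /sigma (bigID (fun d => p %| d)%N) /= addnC; congr (_ + _)%N.
  rewrite -big_filter; apply: perm_big; apply: uniq_perm; rewrite ?filter_uniq ?divisors_uniq //.
  move=> d; rewrite mem_filter -!dvdn_divisors //; apply/andP/idP => [[pd]|dn].
    by rewrite Gauss_dvdr // coprimeXr // coprime_sym prime_coprime.
  split; first by apply: contra pn => /dvdn_trans; apply.
  by rewrite dvdn_mull.
rewrite big_distrr /= -big_filter.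
transitivity (\sum_(d <- [seq (p * d)%N | d <- divisors (p ^ s * n)]) d ^ K)%N.
  apply: perm_big; apply: uniq_perm; rewrite ?filter_uniq ?divisors_uniq ?map_inj_uniq //.
  - by rewrite divisors_uniq.
  - by move=> x y /eqP; rewrite eqn_pmul2l // => /eqP.
  move=> d; rewrite mem_filter -dvdn_divisors //; apply/andP/mapP => [[/dvdnP[e ->]]|[e]].
    rewrite expnS -mulnA mulnC dvdn_pmul2l // => de; exists e => //.
    by rewrite -dvdn_divisors.
  by rewrite -dvdn_divisors // => de ->; rewrite dvdn_mulr // expnS -mulnA dvdn_pmul2l.
by rewrite big_map; apply: eq_bigr => d _; rewrite expnMn.
Qed.

(** For prime p this geometric sum is sigma_K(p^s), see [sigma_powM]. *)
Definition sigma_pow K p s : nat := (\sum_(i < s.+1) (p ^ K) ^ i)%N.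

Lemma sigma_powS K p s : sigma_pow K p s.+1 = (1 + p ^ K * sigma_pow K p s)%N.
Proof.
rewrite /sigma_pow big_ord_recl big_distrr; congr (_ + _)%N.
by apply: eq_bigr => i _; rewrite expnS.
Qed.

Lemma sigma_powM K p n s : prime p -> (0 < n)%N -> ~~ (p %| n)%N ->
  sigma K (p ^ s * n) = (sigma_pow K p s * sigma K n)%N.
Proof.
move=> pp n0 pn; elim: s => [|s IH]; first by rewrite /sigma_pow big_ord1 !mul1n.
by rewrite sigma_mulp // IH sigma_powS mulnDl mul1n mulnA.
Qed.

Lemma sigma1E K : sigma K 1 = 1%N.
Proof. by rewrite /sigma /= big_seq1 exp1n. Qed.

Lemma sigma_prime K p : prime p -> sigma K p = (1 + p ^ K)%N.
Proof.
move=> pp; have p1 : ~~ (p %| 1)%N by rewrite dvdn1 (gtn_eqF (prime_gt1 pp)).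
by have := @sigma_mulp K p 1 0 pp isT p1; rewrite !muln1 sigma1E muln1.
Qed.

Lemma sigma4 K : sigma K 4 = (1 + 2 ^ K + 4 ^ K)%N.
Proof.
by rewrite (@sigma_mulp K 2 1 1) // sigma1E muln1 expn1 sigma_prime // mulnDr muln1 -expnMn addnA.
Qed.

(** The Hecke relation in weight 2: U_p + p V_p acts on sigma_1 with eigenvalue p + 1. *)
Lemma sigma_1_mulp p n : prime p -> (0 < n)%N ->
  (sigma 1 (p * n) + p * (if p %| n then sigma 1 (n %/ p) else 0) = p.+1 * sigma 1 n)%N.
Proof.
move=> pp n0; have p0 := prime_gt0 pp.
have [n' pn nE] := pfactor_coprime pp n0; have {}pn : ~~ (p %| n')%N by rewrite -prime_coprime.
have n0' : (0 < n')%N by case: (n') pn; rewrite ?dvdn0.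
move: (logn p n) nE => s ->; rewrite [(n' * _)%N]mulnC mulnA -expnS.
case: s => [|s].
  rewrite !expn0 mul1n (negPf pn) muln0 addn0 sigma_mulp // mul1n expn1 mulSn //.
have E : (p ^ s.+1 * n' = p * (p ^ s * n'))%N by rewrite expnS mulnA.
rewrite {1 2}E dvdn_mulr // mulKn // !sigma_powM //.
by rewrite !sigma_powS expn1; ring.
Qed.

End Sigma.

(** * Euler's product P and its logarithmic derivative *)

Section Euler.
Variable F : numFieldType.
Implicit Types (f g G : fps F) (n d p M : nat).

Definition qfact M : fps F := \prod_(k < M) (1 - fpsX ^+ k.+1).

Lemma qfact0 : qfact 0 = 1. Proof. by rewrite /qfact big_ord0. Qed.
Lemma qfactS M : qfact M.+1 = qfact M * (1 - fpsX ^+ M.+1).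
Proof. by rewrite /qfact big_ord_recr. Qed.

Lemma qfact_coef0 M : qfact M 0%N = 1.
Proof.
by elim: M => [|M IH]; rewrite ?qfact0 // qfactS fpsM0 IH fpsB fpsXn subr0 mulr1.
Qed.

(** The infinite product: the factors after 1 - q^n leave the coefficient of q^n unchanged, so it
    can be read off the n-th partial product. *)
Definition euler : fps F := Fps (fun n => qfact n n).

Lemma qfact_euler M N : (M <= N.+1)%N -> eqm M (qfact N) euler.
Proof.
move=> MN n nM; have {MN}nM : (n <= N)%N by lia.
elim: N nM => [|N IH]; first by rewrite leqn0 => /eqP ->.
rewrite leq_eqVlt => /orP[/eqP -> //|nN]; rewrite qfactS mulrBr mulr1 fpsB IH //.
by rewrite mulrC fpsXnM leqNgt nN subr0.
Qed.

Lemma euler0 : euler 0%N = 1. Proof. by rewrite /= qfact_coef0. Qed.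

Lemma euler_unit : euler \is a GRing.unit.
Proof. by rewrite fps_unitE euler0 oner_eq0. Qed.
Hint Resolve euler_unit : core.

(* [sigma 1 0] is [1] since [divisors 0 = [:: 1]] *)
Definition eulerS : fps F := Fps (fun n => if n == 0%N then 0 else - (sigma 1 n)%:R).

Lemma eulerSE n : (0 < n)%N -> eulerS n = - (sigma 1 n)%:R.
Proof. by case: n. Qed.

Lemma ldlog_euler : ldlog euler = eulerS.
Proof.
(* The logarithmic derivative of 1 - q^d, that is -d (q^d + q^(2d) + ...). *)
pose L d : fps F := Fps (fun n => if (0 < n)%N && (d %| n)%N then - d%:R else 0).
have fderL d : (0 < d)%N -> fder (1 - fpsX ^+ d) = (1 - fpsX ^+ d) * L d.
  move=> d0; apply/fpsP => n; rewrite fderE mulrBl mul1r !fpsB fpsXnM fpsXn fps1.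
  have LE i : L d i = if (0 < i)%N && (d %| i)%N then - d%:R else 0 by [].
  rewrite !LE; case: (ltngtP n d) => [nd|dn|->].
  - rewrite ifF; last by apply/negbTE/negP => /andP[n0 /(dvdn_leq n0)]; rewrite leqNgt nd.
    by case: n nd => [|n] nd; rewrite ?mul0r !subr0 ?mulr0.
  - by rewrite subn_gt0 dn (ltn_trans d0 dn) (dvdn_subl (ltnW dn)) // gtn_eqF ?(ltn_trans d0 dn)
    // !subrr mulr0.
  - by rewrite subnn d0 dvdnn gtn_eqF //= subr0 sub0r mulrN1.
have finite M : fder (qfact M) = qfact M * \sum_(k < M) L k.+1.
  elim: M => [|M IH]; first by rewrite qfact0 big_ord0 fder1 mulr0.
  by rewrite qfactS fderM IH fderL // big_ord_recr /=; ring.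
apply: ldlog_uniq => //; apply: eqm_eq => M.
apply: (@eqm_trans _ _ (fder (qfact M))).
  by move=> n nM; rewrite !fderE (@qfact_euler M M).
rewrite finite; apply: eqmM; first exact: qfact_euler.
move=> n nM; rewrite fps_sum; case: (posnP n) => [->|n0]; first by rewrite big1.
rewrite eulerSE // /sigma natr_sum (sum_divisors_ord _ (_ : 0 < n <= M)%N); last by rewrite n0 ltnW.
rewrite -sumrN [RHS]big_mkcond; apply: eq_bigr => i _ /=; rewrite n0 expn1 /=.
by case: ifP.
Qed.

Lemma eulerS_sec p : prime p ->
  fsec p eulerS = fpsC p.+1%:R * eulerS - fpsC p%:R * fdil p eulerS.
Proof.
move=> pp; have p0 := prime_gt0 pp.
apply/fpsP => n; rewrite fpsB !fpsCM fdilE; case: (posnP n) => [->|n0].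
  by rewrite /= muln0 dvdn0 div0n !mulr0 subr0.
have -> : fsec p eulerS n = eulerS (p * n) by [].
rewrite (eulerSE n0) (@eulerSE (p * n)) ?muln_gt0 ?p0 //.
have /(congr1 (fun m => m%:R : F)) := sigma_1_mulp pp n0.
rewrite natrD !natrM; case: ifP => pn E.
  by rewrite eulerSE ?divn_gt0 ?(dvdn_leq n0) // !mulrN -E; ring.
by rewrite mulr0 subr0 mulrN -E mulr0 addr0.
Qed.

End Euler.
#[global] Hint Resolve euler_unit : core.

(** * Finite forms of the theta identities, by q-binomial coefficients *)

Section ThreeTermSum.
Variables (A : comNzRingType) (a b x y : A) (w e e' : nat -> A) (N : nat).

(** Summation by parts: the symmetric operator a e_j + b (e_(j-1) + e_(j+1)) multiplies by a + 2b
    every pairing with weights of vanishing second difference. The theta series are sums over all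
    integers folded onto j >= 0; x and y are the corrections that folding makes in row 0, and the
    two conditions on [w 0], [w 1], [w 2] say that the weights absorb them. *)
Lemma three_term_sum :
  (forall j, (1 <= j)%N -> w j.+2 + w j = w j.+1 *+ 2) ->
  w 0 * x + b * w 1 = b * w 0 *+ 2 -> w 0 * y + b * (w 2 + w 0) = b * w 1 *+ 2 ->
  (forall j, e' j.+1 = a * e j.+1 + b * (e j + e j.+2)) ->
  e' 0 = (a + x) * e 0 + (b + y) * e 1 ->
  e N = 0 -> e N.+1 = 0 -> (0 < N)%N ->
  \sum_(j < N.+1) w j * e' j = (a + b *+ 2) * \sum_(j < N.+1) w j * e j.
Proof.
move=> hw h0 h1 he he0 eN eN1 N0.
have A1 : \sum_(j < N) w j.+1 * e j = w 1 * e 0 + \sum_(j < N) w j.+2 * e j.+1.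
  have := big_ord_recr N (idx := 0) (op := +%R) (fun j : 'I_N.+1 => w j.+1 * e j).
  by rewrite /= eN mulr0 addr0 => <-; rewrite big_ord_recl.
have A2 : \sum_(j < N) w j.+1 * e j.+2 = \sum_(j < N) w j * e j.+1 - w 0 * e 1.
  have := big_ord_recr N (idx := 0) (op := +%R) (fun j : 'I_N.+1 => w j * e j.+1).
  by rewrite /= eN1 mulr0 addr0 => <-; rewrite big_ord_recl /= addrAC subrr add0r.
have A3 : \sum_(j < N) (w j.+2 + w j) * e j.+1 =
    (\sum_(j < N) w j.+1 * e j.+1) *+ 2 + (w 2 + w 0 - w 1 *+ 2) * e 1.
  case: N N0 {A1 A2 eN eN1} => // M _; rewrite !big_ord_recl /= mulrnDl -sumrMnl.
  rewrite addrAC; congr (_ + _); first by rewrite /bump /=; ring.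
  by apply: eq_bigr => i _; rewrite hw // mulrnAl.
rewrite !big_ord_recl /= he0.
have -> : \sum_(i < N) w i.+1 * e' i.+1 = a * \sum_(j < N) w j.+1 * e j.+1 +
    b * (\sum_(j < N) w j.+1 * e j + \sum_(j < N) w j.+1 * e j.+2).
  rewrite -big_split !mulr_sumr -big_split; apply: eq_bigr => i _ /=.
  by rewrite he; ring.
rewrite A1 A2; set s1 := \sum_(j < N) w j.+1 * _.
have -> : w 1 * e 0 + \sum_(j < N) w j.+2 * e j.+1 +
   (\sum_(j < N) w j * e j.+1 - w 0 * e 1) =
   w 1 * e 0 - w 0 * e 1 + \sum_(j < N) (w j.+2 + w j) * e j.+1.
  have -> : \sum_(j < N) (w j.+2 + w j) * e j.+1 =
     \sum_(j < N) w j.+2 * e j.+1 + \sum_(j < N) w j * e j.+1.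
    by rewrite -big_split; apply: eq_bigr => i _; rewrite mulrDl.
  by ring.
rewrite A3 -/s1.
have -> : w 0 * ((a + x) * e 0 + (b + y) * e 1) = (w 0 * x + b * w 1) * e 0 +
   (w 0 * y + b * (w 2 + w 0)) * e 1 + (a * w 0 - b * w 1) * e 0
   + (w 0 * b - b * (w 2 + w 0)) * e 1 by ring.
by rewrite h0 h1; ring.
Qed.

End ThreeTermSum.

Definition tri j : nat := 'C(j.+1, 2).

Lemma triS j : tri j.+1 = (tri j + j.+1)%N.
Proof. by rewrite /tri binS bin1. Qed.

Lemma tri2 j : (2 * tri j = j * j.+1)%N.
Proof. by elim: j => // j IH; rewrite triS mulnDr IH; ring. Qed.

Lemma leq_tri j : (j <= tri j)%N.
Proof. by case: j => // j; rewrite triS leq_addl. Qed.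

Section QBinomial.
Variable F : numFieldType.
Implicit Types (n j M : nat).
Local Notation X := (@fpsX F).
Local Notation qf := (@qfact F).
Local Notation P := (@euler F).

Lemma qfact_unit n : qf n \is a GRing.unit.
Proof. by rewrite fps_unitE qfact_coef0 oner_eq0. Qed.

(* the q-binomial coefficient [m+n choose m] *)
Definition qbin m n : fps F := qf (m + n) / (qf m * qf n).

Lemma qbin0 n : qbin 0 n = 1.
Proof. by rewrite /qbin qfact0 mul1r divrr ?qfact_unit. Qed.

Lemma qbinE m n : qbin m n * (qf m * qf n) = qf (m + n).
Proof. by rewrite /qbin divrK // unitrM !qfact_unit. Qed.

(** This is the step from n to n + 1 in the symmetric sums below: the total m + n drops by two and
    the three index pairs stay centred. Over the common denominator every term is [qf (m + n)] times
    a polynomial in q^m, q^n and q. The factors [(n != 0%N)%:R] and [(m != 0%N)%:R] switch off the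
    terms whose index would be -1, where [.-1] returns 0. *)
Lemma qbin_three_term m n :
  qbin m.+1 n.+1 = (1 + X ^+ (m + n).+1) * qbin m n
     + X ^+ m.+1 * qbin m.+1 n.-1 * (n != 0%N)%:R
     + X ^+ n.+1 * qbin m.-1 n.+1 * (m != 0%N)%:R.
Proof.
have u k l : qf k * qf l \is a GRing.unit by rewrite unitrM !qfact_unit.
apply: (mulIr (u m.+1 n.+1)); rewrite qbinE.
have t0 : qbin m n * (qf m.+1 * qf n.+1) =
    qf (m + n) * ((1 - X ^+ m.+1) * (1 - X ^+ n.+1)).
  by rewrite !qfactS -qbinE; ring.
have t1 : qbin m.+1 n.-1 * (n != 0%N)%:R * (qf m.+1 * qf n.+1) =
    qf (m + n) * ((1 - X ^+ n) * (1 - X ^+ n.+1)).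
  case: n {t0} => [|n]; first by rewrite expr0 subrr !(mul0r, mulr0).
  by rewrite addnS -addSn -qbinE (qfactS F n.+1) (qfactS F n) /= mulr1; ring.
have t2 : qbin m.-1 n.+1 * (m != 0%N)%:R * (qf m.+1 * qf n.+1) =
    qf (m + n) * ((1 - X ^+ m) * (1 - X ^+ m.+1)).
  case: m {t0 t1} => [|m]; first by rewrite expr0 subrr !(mul0r, mulr0).
  by rewrite addSn -addnS -qbinE (qfactS F m.+1) (qfactS F m) /= mulr1; ring.
transitivity ((1 + X ^+ (m + n).+1) * (qbin m n * (qf m.+1 * qf n.+1))
  + X ^+ m.+1 * (qbin m.+1 n.-1 * (n != 0%N)%:R * (qf m.+1 * qf n.+1))
  + X ^+ n.+1 * (qbin m.-1 n.+1 * (m != 0%N)%:R * (qf m.+1 * qf n.+1))); last by ring.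
rewrite t0 t1 t2.
rewrite addSn addnS !qfactS !exprS exprD; ring.
Qed.

Lemma qbin_euler M m n : (M <= m)%N -> (M <= n)%N -> eqm M (qbin m n) P^-1.
Proof.
move=> Mm Mn; have uP := euler_unit F.
have -> : P^-1 = P / (P * P) by rewrite invrM // mulrA divrr // mul1r.
apply: eqmM; first by apply: qfact_euler; lia.
apply: eqmV; rewrite ?fpsM0 ?qfact_coef0 ?euler0 ?mulr1 ?oner_eq0 //.
by apply: eqmM; apply: qfact_euler; lia.
Qed.

(* Both sums run over j <= n only, the terms beyond being zero. *)
Definition odd_term (eps : F) n j : fps F :=
  if (j <= n)%N then fpsC eps ^+ j * X ^+ tri j * qbin (n - j) (n + j).+1 else 0.

Definition even_term n j : fps F :=
  if (j <= n)%N then X ^+ (j ^ 2) * fdil 2 (qbin (n - j) (n + j)) else 0.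

Lemma qbinC m n : qbin m n = qbin n m.
Proof. by rewrite /qbin addnC [qf m * _]mulrC. Qed.

Lemma odd_termS eps n j : eps ^+ 2 = 1 ->
  odd_term eps n.+1 j.+1 = (1 + X ^+ n.+1 ^+ 2) * odd_term eps n j.+1
    + fpsC eps * X ^+ n.+1 * (odd_term eps n j + odd_term eps n j.+2).
Proof.
move=> eps2; have c2 : fpsC eps * fpsC eps = 1 by rewrite -rmorphM -expr2 eps2 rmorph1.
rewrite /odd_term ltnS; case: (ltngtP j n) => [jn|nj|->].
- have [m nE] : exists m, n = (m + j).+1 by exists (n - j.+1)%N; lia.
  have -> : (n.+1 - j.+1 = m.+1)%N by lia.
  have -> : (n.+1 + j.+1).+1 = (n + j.+1).+2 by [].
  have -> : (n - j.+1 = m)%N by lia.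
  have -> : (n - j = m.+1)%N by lia.
  have -> : (n - j.+2 = m.-1)%N by lia.
  have -> : (j.+1 < n)%N = (m != 0%N) by lia.
  rewrite qbin_three_term /= !triS (_ : (m + (n + j.+1).+1).+1 = n.+1 + n.+1)%N; last by lia.
  have -> : (n + j.+2 = (n + j.+1).+1)%N by rewrite !addnS.
  have -> : (if m != 0%N then fpsC eps ^+ j.+2 * X ^+ (tri j + j.+1 + j.+2) *
      qbin m.-1 (n + j.+1).+2 else 0) = fpsC eps ^+ j.+2 * X ^+ (tri j + j.+1 + j.+2) *
      qbin m.-1 (n + j.+1).+2 * (m != 0%N)%:R by case: eqP; rewrite ?mulr0 ?mulr1.
  have -> : (n + j).+1 = (n + j.+1)%N by rewrite addnS.
  rewrite mulr1; set q1 := qbin m _; set q2 := qbin m.+1 _; set q3 := qbin m.-1 _;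
    set e := (m != 0%N)%:R.
  have E0 : X ^+ (n.+1 + n.+1) = X ^+ n.+1 ^+ 2 by rewrite exprD expr2.
  have E1 : X ^+ (tri j + j.+1) * X ^+ m.+1 = X ^+ n.+1 * X ^+ tri j.
    by rewrite -!exprD; congr (_ ^+ _); lia.
  have E2 : X ^+ (tri j + j.+1) * X ^+ (n + j.+1).+2 = X ^+ n.+1 * X ^+ (tri j + j.+1 + j.+2).
    by rewrite -!exprD; congr (_ ^+ _); lia.
  transitivity ((1 + X ^+ n.+1 ^+ 2) * (fpsC eps ^+ j.+1 * X ^+ (tri j + j.+1) * q1)
     + fpsC eps ^+ j.+1 * (X ^+ (tri j + j.+1) * X ^+ m.+1) * q2
     + fpsC eps ^+ j.+1 * (X ^+ (tri j + j.+1) * X ^+ (n + j.+1).+2) * (q3 * e)).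
    by rewrite E0; ring.
  have cc t : t = t * (fpsC eps * fpsC eps) by rewrite c2 mulr1.
  rewrite E1 E2 !(exprS (fpsC eps)) [Z in _ + Z = _]cc;
    move: (X ^+ _) (X ^+ _) (X ^+ _) (X ^+ _) => x1 x2 x3 x4.
  by ring.
- by rewrite !ifF ?(mulr0, addr0) //; lia.
- rewrite !ifF ?leqnn; [|lia..]; rewrite !subnn !qbin0 mulr0 add0r addr0 !mulr1 triS.
  by rewrite exprS exprD; ring.
Qed.

(** Triangular numbers are symmetric under j -> -1 - j, so the left neighbour of index 0 is eps
    times the term at 0; together with the factor eps of the recurrence this is the extra
    [X ^+ n.+1]. *)
Lemma odd_term0 eps n : eps ^+ 2 = 1 ->
  odd_term eps n.+1 0 = (1 + X ^+ n.+1 ^+ 2 + X ^+ n.+1) * odd_term eps n 0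
    + (fpsC eps * X ^+ n.+1 + 0) * odd_term eps n 1.
Proof.
move=> eps2; have c2 : fpsC eps * fpsC eps = 1 by rewrite -rmorphM -expr2 eps2 rmorph1.
rewrite /odd_term !leq0n !subn0 !addn0 !expr0 !mul1r qbin_three_term /= mulr1 addr0.
rewrite (_ : (n + n.+1).+1 = n.+1 + n.+1)%N; last by lia.
rewrite (qbinC n.+1 n) exprD subn1 addn1 /tri /= (exprS _ n.+1) !expr1.
case: n => [|n] /=; rewrite ?mulr0 ?addr0 ?mulr1; first by ring.
transitivity ((1 + X ^+ n.+2 * X ^+ n.+2 + X ^+ n.+2) * qbin n.+1 n.+2
  + X ^+ n.+2 * X * qbin n n.+3 * (fpsC eps * fpsC eps)); last by rewrite expr2; ring.
by rewrite c2; ring.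
Qed.

Lemma even_termS n j :
  even_term n.+1 j.+1 = (1 + X ^+ (2 * n).+1 ^+ 2) * even_term n j.+1
    + X ^+ (2 * n).+1 * (even_term n j + even_term n j.+2).
Proof.
rewrite /even_term ltnS; case: (ltngtP j n) => [jn|nj|->].
- have [m nE] : exists m, n = (m + j).+1 by exists (n - j.+1)%N; lia.
  have -> : (n.+1 - j.+1 = m.+1)%N by lia.
  have -> : (n.+1 + j.+1 = (n + j.+1).+1)%N by [].
  have -> : (n - j.+1 = m)%N by lia.
  have -> : (n - j = m.+1)%N by lia.
  have -> : (n - j.+2 = m.-1)%N by lia.
  have -> : (j.+1 < n)%N = (m != 0%N) by lia.
  rewrite qbin_three_term (_ : (m + (n + j.+1)).+1 = (2 * n).+1)%N; last by lia.
  have -> : (n + j.+2 = (n + j.+1).+1)%N by rewrite !addnS.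
  have -> : (n + j.+1).-1 = (n + j)%N by rewrite addnS.
  have -> : (n + j.+1 != 0)%N by rewrite addnS.
  have -> : (if m != 0%N then X ^+ (j.+2 ^ 2) * fdil 2 (qbin m.-1 (n + j.+1).+1)
      else 0) = X ^+ (j.+2 ^ 2) * fdil 2 (qbin m.-1 (n + j.+1).+1) * (m != 0%N)%:R.
    by case: eqP; rewrite ?mulr0 ?mulr1.
  move: (qbin m _) (qbin m.+1 _) (qbin m.-1 _) => q1 q2 q3.
  rewrite !rmorphD !rmorphM !rmorphD /= !rmorphXn !rmorph1 /= fdilX //= rmorph_nat mulr1.
  set e := (m != 0%N)%:R.
  have E1 : X ^+ (j.+1 ^ 2) * X ^+ 2 ^+ m.+1 = X ^+ (2 * n).+1 * X ^+ (j ^ 2).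
    by rewrite -exprM -!exprD; congr (_ ^+ _); lia.
  have E2 : X ^+ (j.+1 ^ 2) * X ^+ 2 ^+ (n + j.+1).+1 = X ^+ (2 * n).+1 * X ^+ (j.+2 ^ 2).
    by rewrite -exprM -!exprD; congr (_ ^+ _); lia.
  have E3 : X ^+ 2 ^+ (2 * n).+1 = X ^+ (2 * n).+1 ^+ 2 by rewrite -!exprM mulnC.
  rewrite E3; transitivity ((1 + X ^+ (2 * n).+1 ^+ 2) * (X ^+ (j.+1 ^ 2) * fdil 2 q1)
     + (X ^+ (j.+1 ^ 2) * X ^+ 2 ^+ m.+1) * fdil 2 q2
     + (X ^+ (j.+1 ^ 2) * X ^+ 2 ^+ (n + j.+1).+1) * (fdil 2 q3 * e)); first by ring.
  by rewrite E1 E2; ring.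
- by rewrite !ifF ?(mulr0, addr0) //; lia.
- rewrite !ifF ?leqnn; [|lia..]; rewrite !subnn !qbin0 rmorph1 mulr0 add0r addr0 !mulr1.
  by rewrite -exprD; congr (_ ^+ _); lia.
Qed.

(** Squares are symmetric under j -> -j, so the left neighbour of index 0 is the term at 1, whose
    coefficient doubles. *)
Lemma even_term0 n :
  even_term n.+1 0 = (1 + X ^+ (2 * n).+1 ^+ 2 + 0) * even_term n 0
    + (X ^+ (2 * n).+1 + X ^+ (2 * n).+1) * even_term n 1.
Proof.
rewrite /even_term !leq0n !subn0 !addn0 !expr0 !mul1r qbin_three_term.
rewrite (_ : (n + n).+1 = (2 * n).+1)%N; last by lia.
rewrite (qbinC n.+1) subn1 addn1; move: (qbin _ _) (qbin _ _) => q1 q2.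
rewrite !rmorphD !rmorphM !rmorphD /= !rmorphXn !rmorph1 /= fdilX //= rmorph_nat.
rewrite addr0 expr1 -![X ^+ 2 ^+ _]exprM.
rewrite (_ : (2 * (2 * n).+1 = (2 * n).+1 * 2)%N); last by rewrite mulnC.
rewrite (_ : (2 * n.+1 = (2 * n).+1.+1)%N) ?exprM; last by lia.
case: n => [|n] /=; rewrite ?mulr0 ?addr0 ?mulr1 //.
by rewrite [X ^+ _.+2]exprS; ring.
Qed.

End QBinomial.

(** * Theta series: sum formulas and dissections *)

Section ThetaSums.
Variable F : numFieldType.
Implicit Types (n j M : nat).
Local Notation X := (@fpsX F).
Local Notation qf := (@qfact F).
Local Notation P := (@euler F).

(** [theta] is Jacobi's series, the sum of q^(n^2) over all integers, and [psi] is Gauss's, the sum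
    of q^(n(n+1)/2) over n >= 0. Both are entered as products of powers of P(q^d), which makes
    membership in [etaq] direct; locking keeps them opaque to rewriting. *)
Definition theta : fps F := locked (fdil 2 P ^+ 5 / (P ^+ 2 * fdil 4 P ^+ 2)).
Definition psi : fps F := locked (fdil 2 P ^+ 2 / P).

Lemma thetaE : theta = fdil 2 P ^+ 5 / (P ^+ 2 * fdil 4 P ^+ 2).
Proof. by rewrite /theta -lock. Qed.

Lemma psiE : psi = fdil 2 P ^+ 2 / P.
Proof. by rewrite /psi -lock. Qed.

Lemma fdil_euler_unit d : (0 < d)%N -> fdil d P \is a GRing.unit.
Proof. by move=> d0; rewrite fps_unitE fdil0 // euler0 oner_eq0. Qed.

(** Two choices satisfy the boundary condition: constant weights with eps = 1, which give Gauss's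
    formula for psi, and weights 2j + 1 with eps = -1, which give Jacobi's formula for P^3. *)
Lemma odd_term_sum (eps : F) (w : nat -> F) n N : eps ^+ 2 = 1 -> (n < N)%N ->
  (forall j, w j.+2 + w j = w j.+1 *+ 2) -> w 0%N + eps * w 1%N = eps * w 0%N *+ 2 ->
  \sum_(j < N.+1) fpsC (w j) * odd_term eps n j =
  fpsC (w 0%N) * (\prod_(k < n) (1 + fpsC eps * X ^+ k.+1)) ^+ 2.
Proof.
move=> eps2 nN hw h0.
have c2 : fpsC eps * fpsC eps = 1 by rewrite -rmorphM -expr2 eps2 rmorph1.
elim: n nN => [|n IH] nN.
  rewrite big_ord0 expr1n mulr1 big_ord_recl big1 => [|i _]; last by rewrite /odd_term mulr0.
  by rewrite /odd_term /= /tri qbin0 !mulr1 addr0.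
rewrite (@three_term_sum _ (1 + X ^+ n.+1 ^+ 2) (fpsC eps * X ^+ n.+1) (X ^+ n.+1) 0
   (fun j => fpsC (w j)) (odd_term eps n)); last 8 first.
- by move=> j _; rewrite -rmorphD hw rmorphMn.
- have /(congr1 (@fpsC F)) := h0; rewrite rmorphD rmorphMn !rmorphM /= => E.
  transitivity ((fpsC (w 0%N) + fpsC eps * fpsC (w 1%N)) * X ^+ n.+1); first by ring.
  by rewrite E; ring.
- by rewrite mulr0 add0r -rmorphD hw rmorphMn; ring.
- by move=> j; apply: odd_termS.
- exact: odd_term0.
- by rewrite /odd_term ifF //; lia.
- by rewrite /odd_term ifF //; lia.
- by lia.
rewrite IH; last by lia.
rewrite big_ord_recr /= !expr2.
set Q := \prod_(i < n) _; set x := X ^+ n.+1; set e := fpsC eps.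
transitivity (fpsC (w 0%N) * (Q * Q * (1 + 1 * (x * x) + (e * x) *+ 2))); first by ring.
by rewrite -[Z in Z * (x * x)]c2 -/e; ring.
Qed.

(** For j < M both indices of the q-binomial are at least M because n >= 2M, so it is 1/P modulo
    q^M; the terms with j >= M are divisible by q^M because tri j >= j. *)
Lemma odd_term_lim (eps : F) (w : nat -> F) M N n : (M + M <= n)%N -> (n <= N)%N ->
  eqm M (\sum_(j < N) fpsC (w j) * odd_term eps n j)
    ((\sum_(j < N) fpsC (w j) * fpsC eps ^+ j * X ^+ tri j) / P).
Proof.
move=> Mn nN; rewrite mulr_suml; apply: eqm_sum => j _; rewrite -!mulrA.
apply: eqmM; first exact: eqm_refl.
have XM f : (M <= j)%N -> eqm M (X ^+ tri j * f) 0.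
  by move=> Mj i iM; rewrite fpsXnM ifF //; have := leq_tri j; lia.
rewrite /odd_term; case: (leqP j n) => jn.
  rewrite -mulrA; apply: eqmM; first exact: eqm_refl.
  case: (leqP M j) => Mj; first by apply: eqm_trans (eqm_sym _); apply: XM.
  by apply: eqmM; [exact: eqm_refl | apply: qbin_euler; lia].
by apply: eqm_sym; rewrite -(mulr0 (fpsC eps ^+ j)); apply: eqmM => //; apply: XM; lia.
Qed.

Lemma prod_1DX n : qf n * \prod_(k < n) (1 + X ^+ k.+1) = fdil 2 (qf n).
Proof.
rewrite /qfact -big_split rmorph_prod; apply: eq_bigr => k _ /=.
by rewrite rmorphB rmorph1 rmorphXn /= fdilX // -exprM mulnC exprM; ring.
Qed.

Lemma psi_sum M n : (M + M <= n)%N -> eqm M psi (\sum_(j < n.+2) X ^+ tri j).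
Proof.
move=> Mn; have uP := euler_unit F.
have := @odd_term_sum 1 (fun=> 1) n n.+1 (expr1n _ _) (ltnSn n).
rewrite mulr1 rmorph1 !mul1r => /(_ (fun=> erefl) erefl) E.
have := @odd_term_lim 1 (fun=> 1) M n.+2 n Mn (leqW (leqnSn n)).
under eq_bigr do rewrite rmorph1; rewrite {}E rmorph1.
under [Z in eqm _ _ (Z / _)]eq_bigr do rewrite expr1n !mul1r.
move=> /eqm_sym E; set S := \sum_(j < _) _ in E *.
have -> : psi = fdil 2 P ^+ 2 / P ^+ 2 * P.
  by rewrite psiE -mulrA; congr (_ * _); rewrite expr2 invrM // -mulrA mulVr // mulr1.
rewrite -[S](divrK uP); apply: eqmM; last exact: eqm_refl.
apply: (eqm_trans _ (eqm_sym E)).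
have -> : \prod_(k < n) (1 + 1 * X ^+ k.+1) = fdil 2 (qf n) / qf n.
  by rewrite -prod_1DX mulrAC divrr ?qfact_unit // mul1r; apply: eq_bigr => k _; rewrite mul1r.
rewrite expr_div_n; apply: eqmM.
  by apply: eqmX; apply: fdil_eqm => //; apply: eqm_sym; apply: qfact_euler; lia.
apply: eqmV; rewrite ?fpsX0 ?euler0 ?qfact_coef0 ?expr1n ?oner_eq0 //.
by apply: eqmX; apply: eqm_sym; apply: qfact_euler; lia.
Qed.

Lemma jacobi_sum M n : (M + M <= n)%N ->
  eqm M (P ^+ 3) (\sum_(j < n.+2) fpsC (2 * j + 1)%:R * fpsC (-1) ^+ j * X ^+ tri j).
Proof.
move=> Mn; have uP := euler_unit F.
have e2 : (-1 : F) ^+ 2 = 1 by rewrite sqrrN expr1n.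
have := @odd_term_sum (-1) (fun j => (2 * j + 1)%:R) n n.+1 e2 (ltnSn n).
have h1 j : (2 * j.+2 + 1)%:R + (2 * j + 1)%:R = (2 * j.+1 + 1)%:R *+ 2 :> F.
  by rewrite -natrD -mulrnA; congr _%:R; lia.
have h2 : (2 * 0 + 1)%:R + -1 * (2 * 1 + 1)%:R = -1 * (2 * 0 + 1)%:R *+ 2 :> F.
  by rewrite muln0 muln1 !natrD; ring.
move=> /(_ h1 h2) E.
have := @odd_term_lim (-1) (fun j => (2 * j + 1)%:R) M n.+2 n Mn (leqW (leqnSn n)).
rewrite {}E muln0 add0n rmorph1 mul1r => /eqm_sym E; set S := \sum_(j < _) _ in E *.
rewrite -[S](divrK uP) exprSr; apply: eqmM; last exact: eqm_refl.
apply: (eqm_trans _ (eqm_sym E)); apply: eqmX.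
have -> : \prod_(k < n) (1 + fpsC (-1) * X ^+ k.+1) = qf n.
  by apply: eq_bigr => k _; rewrite rmorphN rmorph1 mulN1r.
by apply: eqm_sym; apply: qfact_euler; lia.
Qed.

(** The number of integers of absolute value j. *)
Definition sqw j : F := if j == 0%N then 1 else 2%:R.

Lemma even_term_sum n N : (n < N)%N ->
  \sum_(j < N.+1) fpsC (sqw j) * even_term F n j =
  (\prod_(k < n) (1 + X ^+ (2 * k).+1)) ^+ 2.
Proof.
elim: n => [|n IH] nN.
  rewrite big_ord0 expr1n big_ord_recl big1 => [|i _]; last by rewrite /even_term mulr0.
  by rewrite /even_term /= qbin0 !rmorph1 !mulr1 addr0.
rewrite (@three_term_sum _ (1 + X ^+ (2 * n).+1 ^+ 2) (X ^+ (2 * n).+1) 0 (X ^+ (2 * n).+1)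
   (fun j => fpsC (sqw j)) (even_term F n)); last 8 first.
- by case=> // j _; rewrite /sqw /= -rmorphD -rmorphMn.
- by rewrite /sqw /= mulr0 add0r rmorph1 rmorph_nat; ring.
- by rewrite /sqw /= rmorph1 rmorph_nat; ring.
- by move=> j; apply: even_termS.
- exact: even_term0.
- by rewrite /even_term ifF //; lia.
- by rewrite /even_term ifF //; lia.
- by lia.
rewrite IH; last by lia.
by rewrite big_ord_recr /=; move: (X ^+ _) (\prod_(_ < n) _) => x y; ring.
Qed.

Lemma even_term_lim M N n : (M + M <= n)%N -> (n <= N)%N ->
  eqm M (\sum_(j < N) fpsC (sqw j) * even_term F n j)
    ((\sum_(j < N) fpsC (sqw j) * X ^+ (j ^ 2)) / fdil 2 P).
Proof.
move=> Mn nN; rewrite mulr_suml; apply: eqm_sum => j _; rewrite -!mulrA.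
apply: eqmM; first exact: eqm_refl.
have XM f : (M <= j)%N -> eqm M (X ^+ (j ^ 2) * f) 0.
  by move=> Mj i iM; rewrite fpsXnM ifF //; nia.
rewrite /even_term; case: (leqP j n) => jn.
  case: (leqP M j) => Mj; first by apply: eqm_trans (eqm_sym _); apply: XM.
  apply: eqmM; first exact: eqm_refl.
  have -> : (fdil 2 P)^-1 = fdil 2 P^-1 by rewrite rmorphV ?euler_unit.
  by apply: fdil_eqm => //; apply: qbin_euler; lia.
by apply: eqm_sym; apply: XM; lia.
Qed.

Lemma prod_1DXodd n : (\prod_(k < n) (1 + X ^+ (2 * k).+1)) * (qf (2 * n) * fdil 4 (qf n)) =
  fdil 2 (qf (2 * n)) * fdil 2 (qf n).
Proof.
elim: n => [|n IH]; first by rewrite muln0 !qfact0 !rmorph1 big_ord0 !mulr1.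
have -> : (2 * n.+1 = (2 * n).+2)%N by lia.
rewrite big_ord_recr /= !qfactS !rmorphM /= !rmorphB !rmorph1 !rmorphXn /= !fdilX //.
set Q := \prod_(i < n) _ in IH *; set a := qf (2 * n) in IH *; set b := fdil 4 (qf n) in IH *.
set c := fdil 2 a in IH *; set d := fdil 2 (qf n) in IH *.
have -> : X ^+ 4 ^+ n.+1 = X ^+ 2 ^+ (2 * n).+2 by rewrite -!exprM; congr (_ ^+ _); lia.
have -> : X ^+ 2 ^+ n.+1 = X ^+ (2 * n).+2 by rewrite -!exprM; congr (_ ^+ _); lia.
transitivity ((Q * (a * b)) * ((1 + X ^+ (2 * n).+1) * (1 - X ^+ (2 * n).+1) *
   (1 - X ^+ (2 * n).+2) * (1 - X ^+ 2 ^+ (2 * n).+2))).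
  by move: Q a b {IH c} (X ^+ (2 * n).+1) (X ^+ (2 * n).+2) (X ^+ 2 ^+ _) => *; ring.
rewrite IH -![X ^+ 2 ^+ _]exprM ![(2 * _)%N]mulnC ![X ^+ (_ * 2)]exprM; ring.
Qed.

Lemma theta_sum M n : (M + M <= n)%N ->
  eqm M theta (\sum_(j < n.+2) fpsC (sqw j) * X ^+ (j ^ 2)).
Proof.
move=> Mn; have uP := euler_unit F; have uP2 := @fdil_euler_unit 2 isT.
have uP4 := @fdil_euler_unit 4 isT.
have := @even_term_lim M n.+2 n Mn (leqW (leqnSn n)).
rewrite even_term_sum // => /eqm_sym E; set S := \sum_(j < _) _ in E *.
have -> : theta = (fdil 2 P * fdil 2 P / (P * fdil 4 P)) ^+ 2 * fdil 2 P.
  by rewrite thetaE expr_div_n [RHS]mulrAC [(P * _) ^+ 2]exprMn; congr (_ * _); ring.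
rewrite -[S](divrK uP2); apply: eqmM; last exact: eqm_refl.
apply: (eqm_trans _ (eqm_sym E)); apply: eqmX.
have u1 : qf (2 * n) * fdil 4 (qf n) \is a GRing.unit.
  by rewrite unitrM qfact_unit fps_unitE fdil0 // qfact_coef0 oner_eq0.
rewrite -[Z in eqm _ _ Z](mulrK u1) prod_1DXodd.
have qe k : (M <= k)%N -> eqm M P (qf k).
  by move=> Mk; apply: eqm_sym; apply: qfact_euler; lia.
apply: eqmM; first by apply: eqmM; apply: fdil_eqm => //; apply: qe; lia.
apply: eqmV; first by rewrite -fps_unitE unitrM uP.
  by rewrite -fps_unitE.
by apply: eqmM; [|apply: fdil_eqm => //]; apply: qe; lia.
Qed.

(** Even and odd squares are separated: (2k)^2 = 4 k^2 and (2k+1)^2 = 1 + 8 tri k. *)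
Lemma theta_dissect : theta = fdil 4 theta + fpsC 2%:R * X * fdil 8 psi.
Proof.
apply: eqm_eq => M; pose n := (M + M)%N.
have finite k : \sum_(j < 2 * k) fpsC (sqw j) * X ^+ (j ^ 2) =
    fdil 4 (\sum_(j < k) fpsC (sqw j) * X ^+ (j ^ 2)) +
    fpsC 2%:R * X * fdil 8 (\sum_(j < k) X ^+ tri j).
  elim: k => [|k IH]; first by rewrite !big_ord0 !rmorph0 mulr0 addr0.
  have -> : (2 * k.+1 = (2 * k).+2)%N by lia.
  rewrite !big_ord_recr /= IH !rmorphD !rmorphM /= !rmorphXn /= !fdilC // !fdilX //.
  have -> : sqw (2 * k) = sqw k by case: k {IH}.
  have -> : X ^+ ((2 * k).+1 ^ 2) = X * X ^+ 8 ^+ tri k.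
    by rewrite -exprM -exprS; congr (_ ^+ _); have := tri2 k; lia.
  have -> : X ^+ ((2 * k) ^ 2) = X ^+ 4 ^+ (k ^ 2) by rewrite -exprM; congr (_ ^+ _); lia.
  by rewrite /sqw /=; ring.
have k2 : (2 * n.+2 = (2 * n).+2.+2)%N by lia.
apply: (@eqm_trans _ _ (\sum_(j < 2 * n.+2) fpsC (sqw j) * X ^+ (j ^ 2))).
  by rewrite k2; apply: theta_sum; rewrite /n; lia.
rewrite finite; apply: eqmD.
  by apply: fdil_eqm => //; apply: eqm_sym; apply: theta_sum.
apply: eqmM; first exact: eqm_refl.
by apply: fdil_eqm => //; apply: eqm_sym; apply: psi_sum.
Qed.

(** The triangular numbers of 3k and 3k + 2 are divisible by 3, and that of 3k + 1 is 1 + 9 tri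
    k. *)
Lemma tri_dissect (c : nat -> F) (t : F) k : (forall j, c (3 * j).+1 = - (t * c j)) ->
  exists A, \sum_(j < 3 * k) fpsC (c j) * X ^+ tri j =
    fdil 3 A - fpsC t * X * fdil 9 (\sum_(j < k) fpsC (c j) * X ^+ tri j).
Proof.
move=> c3; elim: k => [|k [A IH]]; first by exists 0; rewrite !big_ord0 !rmorph0 mulr0 subr0.
have -> : (3 * k.+1 = (3 * k).+3)%N by lia.
have [t0 t0E] : exists t, tri (3 * k) = (3 * t)%N.
  by exists ((3 * tri k) - k)%N; have := tri2 k; have := tri2 (3 * k); have := leq_tri k; nia.
have [t2 t2E] : exists t, tri (3 * k).+2 = (3 * t)%N.
  by exists ((3 * tri k) + k + 1)%N; have := tri2 k; have := tri2 (3 * k).+2; nia.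
have t1E : tri (3 * k).+1 = (1 + 9 * tri k)%N.
  by have := tri2 k; have := tri2 (3 * k).+1; nia.
exists (A + fpsC (c (3 * k)%N) * X ^+ t0 + fpsC (c (3 * k).+2) * X ^+ t2).
rewrite !big_ord_recr /= IH c3 !rmorphD !rmorphM /= !rmorphXn /= !fdilC // !fdilX //.
rewrite t0E t1E t2E exprD !exprM rmorphN rmorphM /=.
by move: (fdil 3 A) (fdil 9 _) => *; ring.
Qed.

(** In Jacobi's formula the coefficient (2j+1)(-1)^j is multiplied by -3 when j becomes 3j + 1, so
    the part with exponents 1 modulo 3 reproduces P^3 at q^9. *)
Lemma euler3_dissect : exists A, P ^+ 3 = fdil 3 A - fpsC 3%:R * X * fdil 9 P ^+ 3.
Proof.
have c3 j : (2 * (3 * j).+1 + 1)%:R * (-1) ^+ (3 * j).+1 =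
    - (3%:R * ((2 * j + 1)%:R * (-1) ^+ j)) :> F.
  have -> : (2 * (3 * j).+1 + 1 = 3 * (2 * j + 1))%N by lia.
  rewrite natrM -signr_odd -[in RHS]signr_odd /= oddM /=.
  by case: odd; rewrite !(expr0, expr1) !(mulrN1, mulr1, mulrN, opprK).
have finite k := tri_dissect k c3.
(* The finite sums give a different first part at every truncation; this choice is forced in the
   limit, and the truncations are used only to see that the exponents not divisible by 3 cancel. *)
pose A := fsec 3 (P ^+ 3 + fpsC 3%:R * X * fdil 9 P ^+ 3); exists A.
apply/eqP; rewrite -subr_eq0 opprB addrA subr_eq0; apply/eqP/fpsP => i.
rewrite fdilE; case: (boolP (3 %| i)%N) => [/dvdnP[j ->]|ni].
  by rewrite mulnK // mulnC.
have [B E] := finite (i.+1 + i.+1).+2.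
have jac M n : (M + M <= n)%N -> eqm M (P ^+ 3)
    (\sum_(j < n.+2) fpsC ((2 * j + 1)%:R * (-1) ^+ j) * X ^+ tri j).
  move=> Mn; apply: eqm_trans (jacobi_sum Mn) _; apply: eqm_sum => j _.
  by rewrite rmorphM rmorphXn; exact: eqm_refl.
have H1 : eqm i.+1 (P ^+ 3) (\sum_(j < 3 * (i.+1 + i.+1).+2)
    fpsC ((2 * j + 1)%:R * (-1) ^+ j) * X ^+ tri j).
  by rewrite (_ : 3 * _ = (3 * (i.+1 + i.+1) + 4).+2)%N; [apply: jac|]; lia.
have H2 : eqm i.+1 (fdil 9 P ^+ 3) (fdil 9 (\sum_(j < (i.+1 + i.+1).+2)
    fpsC ((2 * j + 1)%:R * (-1) ^+ j) * X ^+ tri j)).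
  by rewrite -rmorphXn; apply: fdil_eqm => //; apply: jac.
have := eqmD H1 (eqmM (@eqm_refl F i.+1 (fpsC 3%:R * X)) H2) (ltnSn i).
by rewrite E subrK fdilE (negPf ni).
Qed.

End ThetaSums.

(** * Formal eta quotients of p-power level *)

Section EtaQuotients.
Variable (F : numFieldType) (p : nat).
Hypothesis p_gt1 : (1 < p)%N.
Local Notation P := (@euler F).
Local Notation V := (@fdil F p).
Implicit Types (f g G H : fps F) (x y : int).

Let p_gt0 : (0 < p)%N. Proof. exact: ltnW. Qed.

(* products of integer powers of the series P(q^(p^i)) *)
Inductive etaq : fps F -> Prop :=
| etaq1 : etaq 1
| etaqS x G : etaq G -> etaq (P ^ x * V G).

(* an element of etaq with the exponent of P(q) made explicit *)
Definition etax x f := exists2 G, etaq G & f = P ^ x * V G.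

Lemma eulerXz0 x : (P ^ x) 0%N = 1.
Proof.
by case: x => n; rewrite ?NegzE ?exprnN ?fpsV0 fpsX0 euler0 expr1n ?invr1 ?oner_eq0.
Qed.

Lemma etaq0 f : etaq f -> f 0%N = 1.
Proof. by elim=> // x G _ IH; rewrite fpsM0 eulerXz0 fdil0 // IH mulr1. Qed.

Lemma etaq_unit f : etaq f -> f \is a GRing.unit.
Proof. by move=> /etaq0 f0; rewrite fps_unitE f0 oner_eq0. Qed.

Lemma etax_etaq x f : etax x f -> etaq f.
Proof. by case=> G eG ->; apply: etaqS. Qed.

Lemma etaq_etax f : etaq f -> exists x, etax x f.
Proof.
case=> [|x G eG]; last by exists x, G.
by exists 0, 1; rewrite ?rmorph1 ?mulr1; [exact: etaq1|].
Qed.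

Lemma etaqM f g : etaq f -> etaq g -> etaq (f * g).
Proof.
move=> ef; elim: ef g => [|x G _ IH] g eg; first by rewrite mul1r.
have [y [G' eG' ->]] := etaq_etax eg.
have -> : P ^ x * V G * (P ^ y * V G') = P ^ (x + y) * V (G * G').
  by rewrite exprzDr ?euler_unit // rmorphM mulrACA.
by apply: etaqS; apply: IH.
Qed.

Lemma etaqV f : etaq f -> etaq f^-1.
Proof.
elim=> [|x G eG IH]; first by rewrite invr1; exact: etaq1.
have uP := euler_unit F.
rewrite invrM ?unitrXz ?fdil_unit // ?etaq0 ?oner_eq0 // mulrC -rmorphV ?etaq_unit //.
by rewrite invr_expz; apply: etaqS.
Qed.

Lemma etaqX f n : etaq f -> etaq (f ^+ n).
Proof.
by move=> ef; elim: n => [|n IH]; [exact: etaq1 | rewrite exprS; apply: etaqM].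
Qed.

Lemma etaq_euler : etaq P.
Proof. by rewrite -[P]mulr1 -(rmorph1 V); apply: (etaqS 1 etaq1). Qed.

Lemma etaq_dil G : etaq G -> etaq (V G).
Proof. by move=> eG; rewrite -[V G]mul1r; apply: (etaqS 0). Qed.

Lemma etaxM x y f g : etax x f -> etax y g -> etax (x + y) (f * g).
Proof.
move=> [G eG ->] [G' eG' ->]; exists (G * G'); first exact: etaqM.
by rewrite exprzDr ?euler_unit // rmorphM mulrACA.
Qed.

Lemma etaxX x f n : etax x f -> etax (x *+ n) (f ^+ n).
Proof.
move=> ef; elim: n => [|n IH]; last by rewrite exprS mulrS; apply: etaxM.
by exists 1; rewrite ?rmorph1 ?mulr1; [exact: etaq1|].
Qed.

Lemma etax_dil G : etaq G -> etax 0 (V G).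
Proof. by move=> eG; exists G; rewrite ?mul1r. Qed.

Lemma etax_dilM x f G : etax x f -> etaq G -> etax x (f * V G).
Proof. by move=> ef eG; rewrite -[x]addr0; apply: etaxM => //; apply: etax_dil. Qed.

Lemma etax_eulerXz x : etax x (P ^ x).
Proof. by exists 1; rewrite ?rmorph1 ?mulr1; [exact: etaq1|]. Qed.

(** This divides a model out of an unknown quotient with the same exponent of P(q); all other
    exponents remain hidden in H. *)
Lemma etax_split x f g : etax x f -> etax x g -> exists2 H, etaq H & f = g * V H.
Proof.
move=> [G eG ->] [G' eG' ->]; exists (G / G'); first by apply: etaqM => //; apply: etaqV.
by rewrite -mulrA -rmorphM mulrCA divrr ?etaq_unit ?mulr1.
Qed.

(** L is the logarithmic derivative of the next layer, to which the same formula applies. So the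
    coefficients at p n with n prime to p involve one further unknown y. *)
Lemma ldlog_etaxE x f : etax x f -> exists2 L, ldlog f = (eulerS F) *~ x + fpsC p%:R * V L
  & exists y, forall n, ~~ (p %| n)%N -> L n = eulerS F n *~ y.
Proof.
have step y G : etaq G -> ldlog (P ^ y * V G) = (eulerS F) *~ y + fpsC p%:R * V (ldlog G).
  move=> eG; have uP := euler_unit F; have G0 := etaq_unit eG.
  by rewrite ldlogM ?unitrXz ?fdil_unit // ldlogXz // ldlog_euler ldlog_dil.
move=> [G eG ->]; exists (ldlog G); first exact: step.
have [y [G' eG' ->]] := etaq_etax eG; exists y => n pn.
by rewrite step // fpsD fpsMz fpsCM fdilE (negPf pn) mulr0 addr0.
Qed.

Lemma fps1M f g : (f * g) 1%N = f 0%N * g 1%N + f 1%N * g 0%N.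
Proof. by rewrite fpsM big_ord_recl big_ord1. Qed.

Lemma etax_coef1 x f : etax x f -> f 1%N = - x%:~R.
Proof.
move=> ef; have eqf := etax_etaq ef; have [L LE _] := ldlog_etaxE ef.
have : fder f 1%N = (f * ldlog f) 1%N by rewrite -fder_ldlog ?etaq_unit.
rewrite fps1M fderE mul1r (etaq0 eqf) mul1r => ->.
rewrite LE !fpsD !fpsMz !fpsCM !fdilE dvdn1 gtn_eqF // mulr0 addr0.
rewrite dvdn0 div0n eulerSE // sigma1E mulNrz.
have ->: eulerS F 0%N = 0 by [].
have -> : L 0%N = 0.
  have : fder f 0%N = (f * ldlog f) 0%N by rewrite -fder_ldlog ?etaq_unit.
  rewrite fpsM0 fderE mul0r (etaq0 eqf) mul1r LE fpsD fpsMz fpsCM fdil0 //.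
  have ->: eulerS F 0%N = 0 by [].
  rewrite mul0rz add0r => /esym/eqP; rewrite mulf_eq0 pnatr_eq0 gtn_eqF //= => /eqP //.
by rewrite mul0rz mulr0 add0r mulr0 addr0.
Qed.

(** The coefficient of q is minus the exponent of P(q), so that exponent is zero. *)
Lemma etaq_coef1_eq0 H : etaq H -> H 1%N = 0 -> exists2 H', etaq H' & H = V H'.
Proof.
move=> /etaq_etax [x ex]; rewrite (etax_coef1 ex) => /eqP; rewrite oppr_eq0 intr_eq0 => /eqP x0.
by case: ex => G eG ->; exists G; rewrite // x0 mul1r.
Qed.

End EtaQuotients.

(** * Series with Eisenstein eigenvalues away from p, and rigidity *)

Section EisensteinShape.
Variables (F : numFieldType) (K p : nat).
Hypothesis p_prime : prime p.
Local Notation V := (@fdil F p).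
Implicit Types (f g : fps F).

(** The property shared by all combinations of the E_(K+1)(p^i z), with the constant term and the
    values at the powers of p left free. *)
Definition eis f := forall j n, (0 < n)%N -> ~~ (p %| n)%N ->
  f (p ^ j * n)%N = f (p ^ j)%N * (sigma K n)%:R.

(** The p-depleted Eisenstein series of weight K + 1. *)
Definition eisO : fps F := Fps (fun n => if (p %| n)%N then 0 else (sigma K n)%:R).

Let p_gt1 : (1 < p)%N. Proof. exact: prime_gt1. Qed.
Let p_gt0 : (0 < p)%N. Proof. exact: prime_gt0. Qed.

Lemma eisOE n : ~~ (p %| n)%N -> eisO n = (sigma K n)%:R.
Proof. by move=> /negPf /= ->. Qed.

Lemma eisO1 : eisO 1%N = 1.
Proof.
have p1 : ~~ (p %| 1)%N by rewrite dvdn1 (gtn_eqF p_gt1).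
by rewrite eisOE // sigma1E.
Qed.

Lemma eisO_no_multiple : no_multiple p eisO.
Proof. by move=> n /=; rewrite dvdn_mulr. Qed.

Lemma eisO_cancel f g : eisO * f = eisO * g -> f = g.
Proof.
pose U : fps F := Fps (fun n => eisO n.+1).
have -> : eisO = fpsX * U by apply/fpsP => -[|n]; rewrite fpsXM //= dvdn0.
have uU : U \is a GRing.unit by rewrite fps_unitE [U _]eisO1 oner_eq0.
by rewrite -!mulrA => /fpsX_inj/(mulrI uU).
Qed.

Lemma eis_sec f : eis f -> eis (fsec p f).
Proof. by move=> ef j n n0 pn /=; rewrite mulnA -!expnS ef. Qed.

Lemma eisB f g : eis f -> eis g -> eis (f - g).
Proof. by move=> ef eg j n n0 pn; rewrite !fpsB ef // eg // mulrBl. Qed.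

Lemma eisC c f : eis f -> eis (fpsC c * f).
Proof. by move=> ef j n n0 pn; rewrite !fpsCM ef // mulrA. Qed.

Lemma eis_split f : eis f -> f = V (fsec p f) + fpsC (f 1%N) * eisO.
Proof.
move=> ef; apply/fpsP => n; rewrite fpsD fpsCM fdilE /=.
case: ifP => [/dvdnP[m ->]|/negbT pn]; first by rewrite mulnK // mulr0 addr0 mulnC.
by rewrite add0r -[n in LHS]mul1n (ef 0%N) //; case: n pn => //; rewrite dvdn0.
Qed.

(** Turns the dissection of a product formula for f into formulas for U_p f and for the depleted
    series. *)
Lemma eis_dissect f a b : eis f -> f = V a + b -> no_multiple p b ->
  fsec p f = a /\ fpsC (f 1%N) * eisO = b.
Proof.
move=> ef fE b0; apply: (@fdil_split_inj _ p) => //.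
  by apply: no_multipleC; apply: eisO_no_multiple.
by rewrite -fE -eis_split.
Qed.

(* Comparing the coefficients not divisible by p of both sides. *)
Lemma eis_rigid f H H' u c : eis f -> H = V H' -> H 0%N = 1 ->
  fsec p f * V H = (V u + c%:R * eisO) * H -> (0 < c)%N -> H = 1 /\ f p = c%:R.
Proof.
move=> ef HE H0 + c0; rewrite -(rmorph_nat (@fpsC F)) {1}(eis_split (eis_sec ef)) {2}HE !mulrDl
  -!rmorphM.
have nm a h : no_multiple p (fpsC a * eisO * V h).
  by apply: no_multipleM; apply: no_multipleC; apply: eisO_no_multiple.
move=> /(fdil_split_inj p_gt0 (nm _ _) (nm _ _))[_].
rewrite -!mulrA ![fpsC _ * (eisO * _)]mulrCA => /eisO_cancel.
have -> : fsec p f 1%N = f p by rewrite /= muln1.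
have VC a h : fpsC a * V h = V (fpsC a * h) by rewrite rmorphM /= fdilC.
rewrite !VC => /(fdil_inj p_gt0) E.
have H0' : H' 0%N = 1 by rewrite -H0 HE fdil0.
have fp : f p = c%:R.
  have : (fpsC (f p) * H) 0%N = (fpsC c%:R * H') 0%N by rewrite E.
  by rewrite !fpsCM H0 H0' !mulr1.
split=> //; move: E; rewrite fp => /mulrI HH.
have {}HH : H = H' by apply: HH; rewrite fps_unitE /= pnatr_eq0 -lt0n.
have /(fdil_fix p_gt1) -> : V H = H by rewrite [in RHS]HE -HH.
by rewrite H0 rmorph1.
Qed.

End EisensteinShape.

(** * The models at p = 2 *)

Section LevelTwo.
Variable F : numFieldType.
Local Notation X := (@fpsX F).
Local Notation P := (@euler F).
Local Notation V := (@fdil F 2).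
Local Notation theta := (@theta F).
Local Notation psi := (@psi F).
Local Notation O K := (@eisO F K 2).
Local Notation etaq := (@etaq F 2).
Local Notation etax := (@etax F 2).
Implicit Types (f g G H a : fps F).

Lemma fdil4 f : fdil 4 f = V (V f). Proof. by rewrite fdilA. Qed.
Lemma fdil8 f : fdil 8 f = V (V (V f)). Proof. by rewrite !fdilA. Qed.
Lemma fdil2X : V X = X ^+ 2. Proof. exact: fdilX. Qed.

Lemma fdil2_1 f : V f 1%N = 0. Proof. by []. Qed.
Lemma fdil2_2 f : V f 2%N = f 1%N. Proof. by []. Qed.
Let lt12 : (1 < 2)%N. Proof. by []. Qed.
Let pr2 : prime 2. Proof. by []. Qed.

Lemma psi_etax : etax (-1) psi.
Proof.
exists (P ^+ 2); first by apply: etaqX; apply: etaq_euler.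
by rewrite psiE rmorphXn mulrC.
Qed.

Lemma theta_etax : etax (-2) theta.
Proof.
have uP := euler_unit F; have uV : V P \is a GRing.unit by apply: fdil_euler_unit.
exists (P ^+ 5 * V P ^- 2).
  by do ?[apply: etaqM | apply: etaqV | apply: etaqX | apply: etaq_dil | apply: etaq_euler].
have uP2 : P ^+ 2 \is a GRing.unit by rewrite unitrX.
have uV2 : V P ^+ 2 \is a GRing.unit by rewrite unitrX.
rewrite rmorphM rmorphXn rmorphV // rmorphXn /= -fdil4 thetaE invrM //; last first.
  by rewrite unitrX ?fdil_euler_unit.
by rewrite mulrA mulrC.
Qed.

Lemma theta_coef0 : theta 0%N = 1.
Proof. exact: (etaq0 lt12 (etax_etaq theta_etax)). Qed.

Lemma psi_coef0 : psi 0%N = 1.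
Proof. exact: (etaq0 lt12 (etax_etaq psi_etax)). Qed.

Lemma psi_sq : psi ^+ 2 = theta * V psi.
Proof.
have uP := euler_unit F; have uV : V P \is a GRing.unit by apply: fdil_euler_unit.
have uV4 : fdil 4 P \is a GRing.unit by apply: fdil_euler_unit.
rewrite psiE thetaE rmorphM rmorphV //= rmorphXn /= -fdil4 expr_div_n.
apply: (mulIr (_ : P ^+ 2 * (P ^+ 2 * fdil 4 P ^+ 2) * V P \is a GRing.unit)).
  by rewrite fps_unitE !(fpsX0, fpsM0) !fdil0 // euler0 !expr1n !mulr1 oner_eq0.
transitivity (V P ^+ 2 ^+ 2 * (P ^+ 2 * fdil 4 P ^+ 2) * V P * ((P ^+ 2)^-1 * P ^+ 2)).
  by ring.
transitivity (V P ^+ 5 * (fdil 4 P ^+ 2) * P ^+ 2 *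
   ((P ^+ 2 * fdil 4 P ^+ 2)^-1 * (P ^+ 2 * fdil 4 P ^+ 2)) * ((V P)^-1 * V P)); last by ring.
have u2 : P ^+ 2 * fdil 4 P ^+ 2 \is a GRing.unit by rewrite unitrM !unitrX.
have u3 : P ^+ 2 \is a GRing.unit by rewrite unitrX.
by rewrite !mulVr //; ring.
Qed.

Lemma theta_psi : V theta * V (V psi) = V psi ^+ 2.
Proof. by rewrite -rmorphXn psi_sq rmorphM. Qed.

Lemma Vpsi4 : V psi ^+ 4 = V theta ^+ 2 * V (V psi) ^+ 2.
Proof. by rewrite -exprMn theta_psi -exprM. Qed.

Lemma VVpsi2 : V (V psi) ^+ 2 = V (V theta) * V (V (V psi)).
Proof. by rewrite -rmorphXn -theta_psi rmorphM. Qed.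

Lemma theta_dissect2 : theta = V (V theta) + 2%:R * X * V (V (V psi)).
Proof. by rewrite -fdil4 -fdil8 -(rmorph_nat (@fpsC F)); apply: theta_dissect. Qed.

(* The difference Z of the two sides satisfies Z(q) = - Z(q^2), hence vanishes. *)
Lemma theta_sq : theta ^+ 2 = V (theta ^+ 2) + 4%:R * X * V (V (psi ^+ 2)).
Proof.
set Y := _ + _; have YE : Y = V (theta ^+ 2) + 4%:R * X * V (V (psi ^+ 2)) by [].
have T2 : theta ^+ 2 = V Y + 4%:R * X * V (V (psi ^+ 2)).
  rewrite {1}theta_dissect2 YE !(rmorph_nat, rmorphXn, rmorphD, rmorphM) /= fdil2X.
  by rewrite VVpsi2; ring.
pose Z := theta ^+ 2 - Y; have ZE : V Z = - Z.
  by rewrite /Z rmorphB opprB {2}T2 {2}YE; ring.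
have Z4 : fdil 4 Z = Z by rewrite fdil4 ZE rmorphN /= ZE opprK.
apply/eqP; rewrite -subr_eq0 -/Z (fdil_fix _ Z4) //.
suff -> : Z 0%N = 0 by rewrite rmorph0.
by rewrite /Z fpsB /Y fpsD -mulrA fps_natM fpsXM mulr0 addr0 fdil0 // subrr.
Qed.

(** Classically q psi(q^2)^4 is the generating series of sigma_1(n) over odd n; it carries the odd
    part in every dissection below. *)
Definition etaw : fps F := locked (X * V (psi ^+ 4)).

Lemma etawE : etaw = X * V (psi ^+ 4). Proof. by rewrite /etaw -lock. Qed.
Local Notation w := etaw.

(** The square of [theta_sq]: by [Vpsi4] the cross term is 8 w, and the last term 16 q^2 psi(q^4)^4
    is 16 w(q^2). *)
Lemma theta_4 : theta ^+ 4 = V (theta ^+ 4 + 16%:R * w) + 8%:R * w.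
Proof.
rewrite (exprM theta 2 2) {1}theta_sq etawE !(rmorph_nat, rmorphXn, rmorphD, rmorphM) /= fdil2X.
by rewrite Vpsi4; ring.
Qed.

Lemma no_multiple_Xdil g : no_multiple 2 (X * V g).
Proof. by apply: no_multipleM; rewrite -[X]expr1; apply: no_multipleX. Qed.

Lemma w_no_multiple : no_multiple 2 w. Proof. by rewrite etawE; apply: no_multiple_Xdil. Qed.

Lemma w_coef1 G : (w * V G) 1%N = G 0%N.
Proof.
rewrite etawE -mulrA -rmorphM fpsXM fdil0 // fpsM0 fpsX0 (etaq0 lt12 (etax_etaq psi_etax)).
by rewrite expr1n mul1r.
Qed.

Lemma w_coef3 G : (w * V G) 3%N = 4%:R * G 0%N + G 1%N.
Proof.
rewrite etawE -mulrA -rmorphM fpsXM fdil2_2 fps1M.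
rewrite (etax_coef1 lt12 (etaxX 4 psi_etax)) fpsX0 (etaq0 lt12 (etax_etaq psi_etax)).
by rewrite expr1n mul1r addrC; congr (_ * _ + _); rewrite mulNrn rmorphN /= opprK.
Qed.

Lemma dissect_scale K f c (b : fps F) : f 1%N = c%:R -> (0 < c)%N ->
  fpsC (f 1%N) * O K = c%:R * b -> O K = b.
Proof.
move=> -> c0; rewrite -[in RHS](rmorph_nat (@fpsC F)) => /mulrI; apply.
by rewrite fps_unitE /= pnatr_eq0 -lt0n.
Qed.

(** The coefficient of q^3 is sigma_1(3) = 4 on one side and 4 + H(1) on the other, so the exponent
    of P(q) in H is zero. *)
Lemma O1_rigid H : etaq H -> O 1 = w * V H -> exists2 H', etaq H' & H = V H'.
Proof.
move=> eH OE; apply: etaq_coef1_eq0 => //; have : O 1 3%N = (w * V H) 3%N by rewrite OE.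
rewrite w_coef3 (etaq0 lt12 eH) mulr1 eisOE //.
by rewrite sigma_prime // -[LHS]addr0 => /addrI.
Qed.

(** Since f = theta^4 V H, U_2 f = (theta^4 + 16 w) H and O = w V H, one gets U_2 f * V H = (f + 16
    O) H. The odd part of f is 8 O, whence the constant 24 = 8 + 16 in the rigidity argument. It
    gives H = 1, so U_2 f = f + 16 O and the values at powers of two repeat from the first on. *)
Lemma eis_theta4 f H : eis 1 2 f -> etaq H -> f = theta ^+ 4 * V H ->
  forall j, (1 <= j)%N -> f (2 ^ j)%N = 24%:R.
Proof.
move=> ef eH fE.
have fE2 : f = V ((theta ^+ 4 + 16%:R * w) * H) + 8%:R * (w * V H).
  by rewrite fE {1}theta_4 [in RHS]rmorphM /=; ring.
have f1 : f 1%N = 8%:R.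
  by rewrite fE2 fpsD fps_natM w_coef1 (etaq0 lt12 eH) mulr1 fdil2_1 add0r.
have [fs /(dissect_scale f1 isT) OE] := eis_dissect pr2 ef fE2
  (no_multiple_nat _ (no_multipleM H w_no_multiple)).
have [H' eH' HE] := O1_rigid eH OE.
have E : fsec 2 f * V H = (V (fsec 2 f) + 24%:R * O 1) * H.
  have -> : V (fsec 2 f) + 24%:R * O 1 = f + 16%:R * O 1.
    by rewrite [in RHS](eis_split pr2 ef) f1 rmorph_nat; ring.
  by rewrite fs fE OE; ring.
have [] := eis_rigid pr2 ef HE (etaq0 lt12 eH) E isT.
move=> H1 f2; have {}fs : fsec 2 f = f + 16%:R * O 1.
  by rewrite fs fE OE H1 rmorph1; ring.
case=> // j _; elim: j => [|j IH]; first by rewrite f2.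
have := congr1 (fun f : fps F => f (2 ^ j.+1)%N) fs.
have -> : (f + 16%:R * O 1) (2 ^ j.+1)%N = 24%:R.
  by rewrite fpsD fps_natM IH expnS (@eisO_no_multiple F 1 2) mulr0 addr0.
by rewrite /= -expnS.
Qed.

(** U_2 turns f into theta^4 V H', the preceding case, at the cost of one power of two. *)
Lemma eis_theta22 f H : eis 1 2 f -> etaq H -> f = theta ^+ 2 * V (theta ^+ 2 * H) ->
  f 2%N = 8%:R /\ forall j, (2 <= j)%N -> f (2 ^ j)%N = 24%:R.
Proof.
move=> ef eH fE.
have fE2 : f = V (theta ^+ 4 * H) + 4%:R * (w * V H).
  rewrite fE {1}theta_sq etawE !(rmorph_nat, rmorphXn, rmorphD, rmorphM) /=.
  by rewrite Vpsi4; ring.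
have f1 : f 1%N = 4%:R.
  by rewrite fE2 fpsD fps_natM w_coef1 (etaq0 lt12 eH) mulr1 fdil2_1 add0r.
have [fs /(dissect_scale f1 isT) OE] := eis_dissect pr2 ef fE2
  (no_multiple_nat _ (no_multipleM H w_no_multiple)).
have [H' eH' HE] := O1_rigid eH OE.
have fs2 : fsec 2 f = theta ^+ 4 * V H' by rewrite fs -HE.
split=> [|[|[|j]] // _].
  have -> : f 2%N = fsec 2 f 1%N by [].
  rewrite fs2 fps1M fdil2_1 mulr0 add0r fdil0 // (etaq0 lt12 eH') mulr1.
  by rewrite (etax_coef1 lt12 (etaxX 4 theta_etax)) -mulrNz -mulNrn opprK.
by rewrite expnS; apply: (eis_theta4 (eis_sec ef) eH' fs2 (j := j.+1)).
Qed.

(** U_2 turns f into the preceding shape, so the repetition starts one power of two later again. *)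
Lemma eis_theta121 f H : eis 1 2 f -> etaq H ->
  f = theta * V (theta ^+ 2 * V theta * H) ->
  f 2%N = 4%:R /\ forall j, (3 <= j)%N -> f (2 ^ j)%N = 24%:R.
Proof.
move=> ef eH fE.
have fE2 : f = V (theta ^+ 2 * V (theta ^+ 2) * H) + 2%:R * (w * V H).
  rewrite fE {1}theta_dissect2 etawE !(rmorph_nat, rmorphXn, rmorphD, rmorphM) /=.
  by rewrite Vpsi4 VVpsi2; ring.
have f1 : f 1%N = 2%:R.
  by rewrite fE2 fpsD fps_natM w_coef1 (etaq0 lt12 eH) mulr1 fdil2_1 add0r.
have [fs /(dissect_scale f1 isT) OE] := eis_dissect pr2 ef fE2
  (no_multiple_nat _ (no_multipleM H w_no_multiple)).
have [H' eH' HE] := O1_rigid eH OE.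
have fs2 : fsec 2 f = theta ^+ 2 * V (theta ^+ 2 * H') by rewrite fs HE (rmorphM V _ H') mulrA.
split=> [|[|[|[|j]]] // _].
  have -> : f 2%N = fsec 2 f 1%N by [].
  rewrite fs2 fps1M fdil2_1 mulr0 add0r fdil0 // fpsM0 (etaq0 lt12 eH') mulr1.
  rewrite fpsX0 theta_coef0 expr1n mulr1.
  by rewrite (etax_coef1 lt12 (etaxX 2 theta_etax)) -mulrNz -mulNrn opprK.
by rewrite expnS; apply: (proj2 (eis_theta22 (eis_sec ef) eH' fs2)) _ (_ : 2 <= j.+2)%N.
Qed.

Lemma odd_zero G j : (1 <= j)%N -> (X * V G) (2 ^ j)%N = 0.
Proof. by case: j => // j _; rewrite expnS; apply: no_multiple_Xdil. Qed.

(** Here U_2 f = 4 w V H' has odd exponents only, so U_2 applied twice gives zero. *)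
Lemma eis_Xtheta2psi4 f H : eis 1 2 f -> etaq H ->
  f = X * theta ^+ 2 * V (V (psi ^+ 2) * H) ->
  f 2%N = 4%:R /\ forall j, (2 <= j)%N -> f (2 ^ j)%N = 0.
Proof.
move=> ef eH fE.
have fE2 : f = V (4%:R * w * H) + 1%:R * (w * V H).
  rewrite fE {1}theta_sq etawE !(rmorph_nat, rmorphXn, rmorphD, rmorphM) /= fdil2X.
  by rewrite Vpsi4; ring.
have f1 : f 1%N = 1%:R.
  by rewrite fE2 fpsD fps_natM w_coef1 (etaq0 lt12 eH) mulr1 fdil2_1 add0r.
have [fs /(dissect_scale f1 isT) OE] := eis_dissect pr2 ef fE2
  (no_multiple_nat _ (no_multipleM H w_no_multiple)).
have [H' eH' HE] := O1_rigid eH OE.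
split=> [|[|[|j]] // _].
  have -> : f 2%N = fsec 2 f 1%N by [].
  by rewrite fs -mulrA fps_natM HE w_coef1 (etaq0 lt12 eH') mulr1.
have -> : f (2 ^ j.+2)%N = fsec 2 f (2 ^ j.+1)%N by rewrite expnS.
by rewrite fs -mulrA fps_natM HE etawE -mulrA -rmorphM odd_zero ?mulr0.
Qed.

(** Here U_2 f is twice a series of the preceding shape. *)
Lemma eis_Xtheta12psi8 f H : eis 1 2 f -> etaq H ->
  f = X * theta * V (theta ^+ 2 * V (V psi) * H) ->
  f 2%N = 2%:R /\ forall j, (3 <= j)%N -> f (2 ^ j)%N = 0.
Proof.
move=> ef eH fE.
have fE2 : f = V (2%:R * (X * theta ^+ 2 * (V (V (psi ^+ 2)) * H))) + 1%:R * (w * V H).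
  rewrite fE {1}theta_dissect2 etawE !(rmorph_nat, rmorphXn, rmorphD, rmorphM) /= fdil2X.
  by rewrite Vpsi4 VVpsi2; ring.
have f1 : f 1%N = 1%:R.
  by rewrite fE2 fpsD fps_natM w_coef1 (etaq0 lt12 eH) mulr1 fdil2_1 add0r.
have [fs /(dissect_scale f1 isT) OE] := eis_dissect pr2 ef fE2
  (no_multiple_nat _ (no_multipleM H w_no_multiple)).
have [H' eH' HE] := O1_rigid eH OE.
pose g := fpsC 2%:R^-1 * fsec 2 f.
have gE : g = X * theta ^+ 2 * V (V (psi ^+ 2) * H').
  by rewrite /g fs -(rmorph_nat (@fpsC F)) mulrA -rmorphM mulVf ?pnatr_eq0 // rmorph1 mul1r HE
    (rmorphM V _ H').
have fg j : f (2 ^ j.+1)%N = 2%:R * g (2 ^ j)%N.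
  by rewrite /g fpsCM mulVKf ?pnatr_eq0 // expnS.
have [g2 gj] := eis_Xtheta2psi4 (eisC _ (eis_sec ef)) eH' gE.
split=> [|[|[|[|j]]] // _]; last by rewrite fg gj ?mulr0.
rewrite (fg 0%N) expn0 gE -mulrA fpsXM fpsM0 fdil0 // fpsM0 fdil0 // !fpsX0.
by rewrite theta_coef0 psi_coef0 (etaq0 lt12 eH') !expr1n !mulr1.
Qed.

(** By [theta_4] this is U_2 applied to theta^4. *)
Local Notation a := (theta ^+ 4 + 16%:R * w).

Lemma theta8_psi8 : theta ^+ 4 * w = X * psi ^+ 8.
Proof.
rewrite etawE rmorphXn (exprM psi 2 4) psi_sq exprMn; ring.
Qed.

Lemma Vtheta8_psi8 : V (theta ^+ 4 * w) = w ^+ 2.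
Proof.
by rewrite theta8_psi8 etawE !(rmorphXn, rmorphM) /= fdil2X exprMn -exprM.
Qed.

Lemma a_coef0 : a 0%N = 1.
Proof. by rewrite fpsD fpsX0 theta_coef0 expr1n fps_natM etawE fpsXM mulr0 addr0. Qed.

Lemma a_coef1 : a 1%N = 24%:R.
Proof.
rewrite fpsD fps_natM (etax_coef1 lt12 (etaxX 4 theta_etax)) -[w]mulr1 -(rmorph1 V) w_coef1.
by rewrite -mulrNz -mulNrn opprK mulr1 -[_%:~R]/(8%:R) -natrD.
Qed.

(** At q^3 the two sides are sigma_3(3) = 28 and 4 + 24 + H(1). *)
Lemma O3_rigid H : etaq H -> O 3 = w * V (a * H) -> exists2 H', etaq H' & H = V H'.
Proof.
move=> eH OE; apply: etaq_coef1_eq0 => //; have : O 3 3%N = (w * V (a * H)) 3%N by rewrite OE.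
rewrite w_coef3 fpsM0 fps1M a_coef0 a_coef1 (etaq0 lt12 eH) !mulr1 eisOE // mul1r.
rewrite sigma_prime // [H 1%N + _]addrC addrA -natrD -[LHS]addr0 => /addrI //.
Qed.

(** With q psi^8 = theta^4 w, dissection gives U_2 f * V H = 8 f H. Rigidity with c = 8 forces H =
    1, and f is an eigenvector of U_2 with eigenvalue 8. *)
Lemma eis_Xpsi8 f H : eis 3 2 f -> etaq H -> f = X * psi ^+ 8 * V H ->
  forall j, f (2 ^ j)%N = 8%:R ^+ j.
Proof.
move=> ef eH; rewrite -theta8_psi8 => fE.
have fE2 : f = V (8%:R * (theta ^+ 4 * w) * H) + 1%:R * (w * V (a * H)).
  rewrite fE {1}theta_4 (rmorphM V _ H) (rmorphM V 8%:R) rmorph_nat /=.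
  by rewrite Vtheta8_psi8 (rmorphM V a) /=; ring.
have f1 : f 1%N = 1%:R.
  by rewrite fE2 fpsD fps_natM w_coef1 fpsM0 a_coef0 (etaq0 lt12 eH) !mulr1 fdil2_1 add0r.
have [fs /(dissect_scale f1 isT) OE] := eis_dissect pr2 ef fE2
  (no_multiple_nat _ (no_multipleM (a * H) w_no_multiple)).
have [H' eH' HE] := O3_rigid eH OE.
have E : fsec 2 f * V H = (V (8%:R * fsec 2 f) + 8%:R * O 3) * H.
  have -> : V (8%:R * fsec 2 f) + 8%:R * O 3 = 8%:R * f.
    by rewrite [in RHS](eis_split pr2 ef) f1 rmorph1 mul1r rmorphM rmorph_nat mulrDr.
  by rewrite fs fE; ring.
have [] := eis_rigid pr2 ef HE (etaq0 lt12 eH) E isT.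
move=> H1 f2; have {}fs : fsec 2 f = 8%:R * f by rewrite fs fE H1 rmorph1; ring.
elim=> [|j IH]; first by rewrite f1.
have := congr1 (fun f : fps F => f (2 ^ j)%N) fs.
by rewrite fps_natM IH /= -expnS exprS.
Qed.

(** Squaring theta^4 = V a + 8 w gives U_2 f = (a^2 + 64 g1) H with g1 = theta^4 w = q psi^8, and
    the odd part 16 O. Rigidity with c = 112 = 16 + 96 gives H = 1 and U_2 f = f + 96 O + 1024 V g1,
    so the increments at powers of two are governed by g1, an eigenvector of U_2. *)
Lemma eis_theta8 f H : eis 3 2 f -> etaq H -> f = theta ^+ 8 * V H ->
  f 2%N = 112%:R /\ forall j, (1 <= j)%N ->
    f (2 ^ j.+1)%N = f (2 ^ j)%N + 1024%:R * 8%:R ^+ j.-1.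
Proof.
move=> ef eH fE; set g1 := theta ^+ 4 * w.
have fE2 : f = V ((a ^+ 2 + 64%:R * g1) * H) + 16%:R * (w * V (a * H)).
  rewrite fE (exprM _ 4 2) {1}theta_4 (rmorphM V _ H) (rmorphD V (a ^+ 2)) (rmorphM V 64%:R)
    rmorph_nat /=.
  by rewrite [V g1]Vtheta8_psi8 (rmorphXn V 2) (rmorphM V a) /=; ring.
have f1 : f 1%N = 16%:R.
  by rewrite fE2 fpsD fps_natM w_coef1 fpsM0 a_coef0 (etaq0 lt12 eH) !mulr1 fdil2_1 add0r.
have [fs /(dissect_scale f1 isT) OE] := eis_dissect pr2 ef fE2
  (no_multiple_nat _ (no_multipleM (a * H) w_no_multiple)).
have [H' eH' HE] := O3_rigid eH OE.
have fsE : (a ^+ 2 + 64%:R * g1) = theta ^+ 8 + 96%:R * (w * V a) + 1024%:R * V g1.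
  have wVa : w * V a = g1 - 8%:R * w ^+ 2.
    by rewrite /g1 {2}theta_4; ring.
  by rewrite wVa [V g1]Vtheta8_psi8 /g1; ring.
have E : fsec 2 f * V H = (V (fsec 2 f + 1024%:R * g1 * H) + 112%:R * O 3) * H.
  have -> : V (fsec 2 f + 1024%:R * g1 * H) + 112%:R * O 3 =
      f + 96%:R * O 3 + 1024%:R * V g1 * V H.
    rewrite [in RHS](eis_split pr2 ef) f1 rmorphD (rmorphM V _ H) (rmorphM V 1024%:R)
      (rmorph_nat V) /= (rmorph_nat (@fpsC F)).
    by ring.
  by rewrite fs fsE fE OE [V (a * H)]rmorphM /=; ring.
have [] := eis_rigid pr2 ef HE (etaq0 lt12 eH) E isT.
move=> H1 f2; split=> //.
have fs2 : fsec 2 f = f + 96%:R * O 3 + 1024%:R * V g1.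
  by rewrite fs fsE fE OE H1 mulr1 !rmorph1; ring.
have n1024 : 1024%:R != 0 :> F by rewrite pnatr_eq0.
(* To apply [eis_Xpsi8], g1 must be known to have Eisenstein shape; it inherits it from f, being a
   combination of U_2 U_2 f and U_2 f. *)
have g1E : g1 = fpsC 1024%:R^-1 * (fsec 2 (fsec 2 f) - fsec 2 f).
  apply/fpsP => n; rewrite fpsCM fpsB.
  have -> : fsec 2 (fsec 2 f) n = fsec 2 f (2 * n)%N by [].
  rewrite {1}fs2 !fpsD !fps_natM fdil_mul // (eisO_no_multiple _ _ _ n) mulr0 addr0.
  by rewrite addrAC subrr add0r mulKf.
have eg : eis 3 2 g1.
  by rewrite g1E; apply: eisC; apply: eisB; do ?apply: eis_sec.
have := @eis_Xpsi8 g1 1 eg (etaq1 _ _); rewrite rmorph1 mulr1 -theta8_psi8 => /(_ erefl) gj.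
case=> // j _; have := congr1 (fun f : fps F => f (2 ^ j.+1)%N) fs2.
rewrite !fpsD !fps_natM expnS (eisO_no_multiple _ _ _ _) fdil_mul // mulr0 addr0 gj => E2.
by rewrite -E2 /= -!expnS.
Qed.

End LevelTwo.

(** * Cubic theta functions and the model at p = 3 *)

Section LevelThree.
Variable F : numFieldType.
Local Notation X := (@fpsX F).
Local Notation P := (@euler F).
Local Notation V := (@fdil F 3).
Local Notation S := (@eulerS F).
Local Notation O := (@eisO F 1 3).
Local Notation etaq := (@etaq F 3).
Local Notation etax := (@etax F 3).
Implicit Types (f g G H : fps F).

Let lt13 : (1 < 3)%N. Proof. by []. Qed.
Let pr3 : prime 3. Proof. by []. Qed.

Lemma fdil3X : V X = X ^+ 3. Proof. exact: fdilX. Qed.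

(** In the Borweins' notation [cb] is b(q), and c(q) is 3 q^(1/3) times [ckappa]; thus
    [3%:R * X * V kappa] is c(q^3). *)
Definition ckappa : fps F := locked (V P ^+ 3 / P).
Definition cb : fps F := locked (P ^+ 3 / V P).
Local Notation kappa := ckappa.
Local Notation b := cb.

Lemma ckappaE : kappa * P = V P ^+ 3.
Proof. by rewrite /ckappa -lock divrK ?euler_unit. Qed.

Lemma cbE : b * V P = P ^+ 3.
Proof. by rewrite /cb -lock divrK ?fdil_euler_unit. Qed.

Lemma kappa_etax : etax (-1) kappa.
Proof.
exists (P ^+ 3); first by apply: etaqX; apply: etaq_euler.
by rewrite /ckappa -lock rmorphXn mulrC.
Qed.

Lemma b_etax : etax 3 b.
Proof.
exists P^-1; first by apply: etaqV => //; apply: etaq_euler.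
by rewrite /cb -lock rmorphV ?euler_unit.
Qed.

Lemma kappa_coef0 : kappa 0%N = 1.
Proof. exact: (etaq0 lt13 (etax_etaq kappa_etax)). Qed.

Lemma b_coef0 : b 0%N = 1.
Proof. exact: (etaq0 lt13 (etax_etaq b_etax)). Qed.

Lemma kappa_b : kappa ^+ 3 * b = V kappa * V b ^+ 3.
Proof.
have uVP : V P \is a GRing.unit by apply: fdil_euler_unit.
have uP := euler_unit F.
apply: (mulIr (_ : P ^+ 3 * V P * V (V P) ^+ 3 \is a GRing.unit)).
  by rewrite fps_unitE !(fpsX0, fpsM0) !fdil0 // euler0 !expr1n !mulr1 oner_eq0.
transitivity ((kappa * P) ^+ 3 * (b * V P) * V (V P) ^+ 3); first by ring.
transitivity ((V kappa * V P) * (V b * V (V P)) ^+ 3 * P ^+ 3); last by ring.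
rewrite -!(rmorphM V) /= ckappaE cbE !(rmorphXn V) /=; ring.
Qed.

Lemma ldlog_b : ldlog b = 3%:R * (S - V S).
Proof.
have uP := euler_unit F; have uVP : V P \is a GRing.unit by apply: fdil_euler_unit.
rewrite /cb -lock ldlogM ?unitrV ?unitrX // ldlogV // ldlogX // ldlog_euler ldlog_dil //
  ldlog_euler.
by rewrite (rmorph_nat (@fpsC F)); ring.
Qed.

(** The Borweins' relations b = a(q^3) - c(q^3) and a = a(q^3) + 2 c(q^3). The series a comes from
    the 3-dissection of P^3 divided by P(q^3), which is the first relation. Logarithmic derivatives
    then give a^3 = b^3 + c^3, the last conclusion being this identity at q^3, and a cube root gives
    the second relation. *)
Lemma cubic_theta : exists a : fps F, [/\ a 0%N = 1, b = V a - 3%:R * X * V kappa,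
  a = V a + 6%:R * X * V kappa &
  V b ^+ 3 = b * (V a ^+ 2 + V a * (3%:R * X * V kappa) + (3%:R * X * V kappa) ^+ 2)].
Proof.
have uP := euler_unit F; have uVP : V P \is a GRing.unit by apply: fdil_euler_unit.
have [A AE] := euler3_dissect F; pose a := A / P; exists a.
have bE : b = V a - 3%:R * X * V kappa.
  have aP : V a * V P = V A by rewrite -rmorphM /a divrK.
  have kP : V kappa * V P = fdil 9 P ^+ 3.
    by rewrite -rmorphM ckappaE rmorphXn /= fdilA.
  apply: (mulIr uVP); rewrite cbE AE (rmorph_nat (@fpsC F)) -aP -kP; ring.
have a0 : a 0%N = 1.
  have := b_coef0; rewrite bE fpsB -!mulrA fps_natM fpsXM mulr0 subr0 fdil0 //.
set al := V a in bE; set be := 3%:R * X * V kappa in bE.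
(* This is a^3 - c^3, to be identified with b^3; n(q^3) has the factor b because b = al - be. *)
pose n := a ^+ 3 - 27%:R * X * kappa ^+ 3.
have nE : V n = al ^+ 3 - be ^+ 3.
  by rewrite /n /be /al !(rmorph_nat, rmorphXn, rmorphB, rmorphM) /= fdil3X; ring.
have nb : V n = b * (al ^+ 2 + al * be + be ^+ 2) by rewrite nE bE; ring.
have n0 : n 0%N = 1.
  by rewrite /n fpsB fpsX0 a0 expr1n -mulrA fps_natM fpsXM mulr0 subr0.
have un : n \is a GRing.unit by rewrite fps_unitE n0 oner_eq0.
have uVn : V n \is a GRing.unit by apply: fdil_unit; rewrite ?n0 ?oner_eq0.
have ub : b \is a GRing.unit by rewrite fps_unitE b_coef0 oner_eq0.
have Db : fder b = fder al - fder be by rewrite bE raddfB.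
have Dal : fder al = V (3%:R * fder a).
  by rewrite /al fder_dil // (rmorph_nat (@fpsC F)) rmorphM rmorph_nat.
have fderX (g : fps F) : fder (X * g) = X * (g + fder g).
  by apply/fpsP => -[|i]; rewrite fderE !fpsXM ?mul0r // fpsD fderE -natr1; ring.
have [k' Dbe] : exists k', fder be = X * V k'.
  exists (3%:R * (kappa + 3%:R * fder kappa)).
  rewrite /be -mulrA -(rmorph_nat (@fpsC F)) fderC fderX fder_dil // !(rmorph_nat (@fpsC F)).
  by rewrite !(rmorph_nat V, rmorphM V, rmorphD V) /=; ring.
(* In V n * ldlog b the exponents divisible by 3 form al' al^2 - be' be^2, with primes for
   derivatives. This is a third of the derivative of V n; the mixed terms have exponents 1 or 2
   modulo 3. *)
have logn : ldlog n = 3%:R * ldlog b.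
  have Lb : V n * ldlog b = fder b * (al ^+ 2 + al * be + be ^+ 2).
    by rewrite nb (fder_ldlog ub); ring.
  have DVn : fder (V n) = 3%:R * (fder al * al ^+ 2 - fder be * be ^+ 2).
    by rewrite nE raddfB /= !(exprS, expr0, mulr1) !fderM; ring.
  have [r' rE] : exists r', fder al * al ^+ 2 - fder be * be ^+ 2 = V r'.
    exists (3%:R * fder a * a ^+ 2 - 9%:R * X * k' * kappa ^+ 2).
    rewrite Dal Dbe /al /be !(rmorph_nat V, rmorphXn V, rmorphB V, rmorphM V) /= fdil3X; ring.
  have split : V n * ldlog b = V r' +
     (X * V (3%:R * fder a * (a * (3%:R * kappa)) - k' * a ^+ 2)
      + X ^+ 2 * V (27%:R * fder a * kappa ^+ 2 - k' * (a * (3%:R * kappa)))).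
    rewrite Lb Db -rE Dal Dbe /al /be !(rmorph_nat V, rmorphXn V, rmorphB V, rmorphM V) /=; ring.
  have nm : no_multiple 3 (X * V (3%:R * fder a * (a * (3%:R * kappa)) - k' * a ^+ 2)
      + X ^+ 2 * V (27%:R * fder a * kappa ^+ 2 - k' * (a * (3%:R * kappa)))).
    apply: no_multipleD; apply: no_multipleM; last exact: no_multipleX.
    by rewrite -[X]expr1; apply: no_multipleX.
  pose lb := fsec 3 (ldlog b).
  have lbE : ldlog b = V lb + (ldlog b - V lb) by rewrite addrC subrK.
  have nm2 : no_multiple 3 (V n * (ldlog b - V lb)).
    rewrite mulrC; apply: no_multipleM => i; rewrite fpsB fdil_mul //; exact: subrr.
  have E : V (n * lb) + V n * (ldlog b - V lb) = V n * ldlog b.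
    by rewrite rmorphM -mulrDr -lbE.
  rewrite split in E; have [nlb _] := fdil_split_inj (isT : (0 < 3)%N) nm2 nm E.
  (* The Hecke relation at 3: U_3 sends S - S(q^3) to (4 S - 3 S(q^3)) - S, three times itself. *)
  have lb3 : lb = 3%:R * ldlog b.
    have -> : lb = 3%:R * (fsec 3 S - S).
      apply/fpsP => i; have -> : lb i = ldlog b (3 * i)%N by [].
      by rewrite ldlog_b !fps_natM !fpsB fdil_mul.
    rewrite (eulerS_sec F pr3) !(rmorph_nat (@fpsC F)) ldlog_b; ring.
  apply: ldlog_uniq => //; apply: (@fdil_inj F 3) => //.
  have three : (3%:R : fps F) \is a GRing.unit.
    by rewrite -(rmorph_nat (@fpsC F)) fps_unitE /= pnatr_eq0.
  apply: (mulrI three); rewrite -lb3 nlb -rE -DVn fder_dil // (rmorph_nat (@fpsC F)) //.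
have nb3 : n = b ^+ 3.
  apply: ldlog_inj => //; first by rewrite fpsX0 b_coef0 expr1n.
  by rewrite logn ldlogX // mulr_natl.
split=> //; last by rewrite -/al -/be -nb nb3 rmorphXn.
have -> : 6%:R * X * V kappa = 2%:R * be by rewrite /be; ring.
have cube : a ^+ 3 = (al + 2%:R * be) ^+ 3.
  apply: (mulIr ub).
  have -> : a ^+ 3 * b = n * b + 27%:R * X * (kappa ^+ 3 * b) by rewrite /n; ring.
  have -> : (al + 2%:R * be) ^+ 3 * b =
      b ^+ 3 * b + 9%:R * be * (b * (al ^+ 2 + al * be + be ^+ 2)).
    by rewrite bE; ring.
  by rewrite -nb nb3 kappa_b rmorphXn /= /be; ring.
(* The quadratic cofactor of a difference of cubes; its constant term 3 makes it a unit, so the cube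
   root is unique. *)
have u3 : a ^+ 2 + a * (al + 2%:R * be) + (al + 2%:R * be) ^+ 2 \is a GRing.unit.
  have c0 : (al + 2%:R * be) 0%N = 1.
    by rewrite fpsD fps_natM /be -mulrA fps_natM fpsXM !mulr0 addr0 /al fdil0.
  rewrite fps_unitE (_ : _ 0%N = 3%:R) ?pnatr_eq0 //.
  by rewrite [LHS]fpsD [_ 0%N + _]addrC fpsD fpsM0 !fpsX0 a0 c0 !expr1n mulr1; ring.
apply/eqP; rewrite -subr_eq0; apply/eqP; apply: (mulIr u3); rewrite mul0r.
transitivity (a ^+ 3 - (al + 2%:R * be) ^+ 3); first by ring.
by rewrite cube subrr.
Qed.

(** Set u = q V(a kappa) + 3 q^2 V(kappa^2). The relations of [cubic_theta] give f = V(a^2 H) + 3 u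
    V H and a^2 = V b^3 / b + 9 u, hence U_3 f * V H = (f + 9 O) H. Rigidity applies with c = 12 = 3
    + 9. *)
Lemma eis_cubic f H : eis 1 3 f -> etaq H -> f = V b ^+ 3 / b * V H ->
  forall j, (1 <= j)%N -> f (3 ^ j)%N = 12%:R.
Proof.
move=> ef eH fE; have [a [a0 bE aE b3E]] := cubic_theta.
have ub : b \is a GRing.unit by rewrite fps_unitE b_coef0 oner_eq0.
have H0 := etaq0 lt13 eH.
pose u := X * V (a * kappa) + 3%:R * (X ^+ 2 * V (kappa ^+ 2)).
have a2 : a ^+ 2 = V b ^+ 3 / b + 9%:R * u.
  rewrite b3E mulrAC divrr // mul1r {1}aE /u !(rmorphXn V, rmorphM V) /=; ring.
have fE2 : f = V (a ^+ 2 * H) + 3%:R * (u * V H).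
  rewrite fE b3E [b * _ / b]mulrAC divrr // mul1r /u !(rmorphXn V, rmorphM V) /=; ring.
have nmu : no_multiple 3 u.
  apply: no_multipleD; last apply: no_multiple_nat; apply: no_multipleM.
    by rewrite -[X]expr1; apply: no_multipleX.
  exact: no_multipleX.
have uVH G : u * V G = X * V (a * kappa * G) + 3%:R * (X ^+ 2 * V (kappa ^+ 2 * G)).
  by rewrite /u !(rmorphXn V, rmorphM V) /=; ring.
have u1 : (u * V H) 1%N = 1.
  rewrite uVH fpsD fps_natM fpsXM fdil0 // !fpsM0 a0 kappa_coef0 H0 fpsXnM /=.
  by rewrite !mulr1 mulr0 addr0.
have f1 : f 1%N = 3%:R.
  by rewrite fE2 fpsD fps_natM u1 mulr1 fdilE /= add0r.
have [fs OE0] := eis_dissect pr3 ef fE2 (no_multiple_nat _ (no_multipleM H nmu)).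
have OE : O = u * V H.
  have three : (3%:R : fps F) \is a GRing.unit.
    by rewrite -(rmorph_nat (@fpsC F)) fps_unitE /= pnatr_eq0.
  by apply: (mulrI three); rewrite -OE0 f1 rmorph_nat.
have a1 : a 1%N = 6%:R.
  rewrite aE fpsD -mulrA fps_natM fpsXM fdil0 // kappa_coef0 mulr1.
  by rewrite (_ : V a 1%N = 0) ?add0r.
(* The coefficient of q^4 is sigma_1(4) = 7 on the left and H(1) + 6 + 1 on the right, from a(1) = 6
   and kappa(1) = 1. *)
have [H' eH' HE] : exists2 H', etaq H' & H = V H'.
  apply: etaq_coef1_eq0 => //; have : O 4%N = (u * V H) 4%N by rewrite OE.
  rewrite uVH fpsD fps_natM fpsXM (_ : V (a * kappa * H) 3%N = (a * kappa * H) 1%N) //.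
  rewrite fpsXnM (_ : V _ 2%N = 0) // mulr0 addr0 fps1M fpsM0 fps1M a0 kappa_coef0 H0 a1.
  have -> : kappa 1%N = 1 by rewrite (etax_coef1 lt13 kappa_etax) rmorphN /= opprK.
  rewrite eisOE // sigma4 !mulr1 !mul1r nat1r -[LHS]add0r => /addIr //.
have E : fsec 3 f * V H = (V (fsec 3 f) + 12%:R * O) * H.
  have -> : V (fsec 3 f) + 12%:R * O = f + 9%:R * O.
    by rewrite [in RHS](eis_split pr3 ef) f1 rmorph_nat; ring.
  by rewrite fs a2 fE OE; ring.
have [H1 f3] := eis_rigid pr3 ef HE H0 E isT.
have {}fs : fsec 3 f = f + 9%:R * O.
  by rewrite fs a2 fE OE H1 rmorph1; ring.
case=> // j _; elim: j => [|j IH]; first by rewrite f3.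
have := congr1 (fun f : fps F => f (3 ^ j.+1)%N) fs.
have -> : (f + 9%:R * O) (3 ^ j.+1)%N = 12%:R.
  by rewrite fpsD fps_natM IH expnS (@eisO_no_multiple F 1 3) mulr0 addr0.
by rewrite /= -expnS.
Qed.

End LevelThree.

(** * The substitution q -> -q on eta quotients *)

Section Sign.
Variable F : numFieldType.
Local Notation P := (@euler F).
Local Notation V := (@fdil F 2).
Implicit Types (f G : fps F).

Lemma fsgnD f : fsgn f + f = 2%:R * V (fsec 2 f).
Proof.
apply/fpsP => n; rewrite fpsD fsgnE fps_natM fdilE dvdn2 -signr_odd.
case: (boolP (odd n)) => on /=; first by rewrite expr1 mulN1r addNr mulr0.
by rewrite expr0 mul1r mulr2n mulrDl mul1r mul2n divn2 even_halfK.
Qed.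

(** The identity P(-q) = P(q^2)^3 / (P(q) P(q^4)), checked on logarithmic derivatives: after adding
    S only the even part of S is left, which the Hecke relation at 2 expresses by S and S(q^2). *)
Lemma fsgn_euler : fsgn P = P^-1 * V (P ^+ 3 / V P).
Proof.
have uP := euler_unit F; have uVP : V P \is a GRing.unit by apply: fdil_euler_unit.
have u3 : P ^+ 3 \is a GRing.unit by rewrite unitrX.
have uV : (V P)^-1 \is a GRing.unit by rewrite unitrV.
have u4 : P ^+ 3 / V P \is a GRing.unit by rewrite unitrM u3.
apply: ldlog_inj; first by rewrite fsgnE mul1r euler0.
  by rewrite fpsM0 fpsV0 euler0 ?oner_eq0 // fdil0 // fpsM0 fpsX0 fpsV0 ?fdil0 ?euler0 ?oner_eq0
    // invr1 expr1n !mulr1.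
rewrite ldlog_sgn // ldlogM ?unitrV ?fdil_unit // ldlogV // ldlog_dil // ldlogM //.
rewrite ldlogV // ldlogX // ldlog_dil // ldlog_euler !(rmorph_nat (@fpsC F)).
apply/eqP; rewrite -(inj_eq (addIr (eulerS F))) fsgnD (eulerS_sec F (isT : prime 2)).
rewrite !(rmorph_nat (@fpsC F)); apply/eqP.
by rewrite !(rmorph_nat V, rmorphB V, rmorphMn V, rmorphM V) /=; ring.
Qed.

(** P(-q) is P(q)^-1 times a series in q^2. *)
Lemma etax_sgn x f : etax 2 x f -> etax 2 (- x) (fsgn f).
Proof.
have uP := euler_unit F.
move=> [G eG ->]; rewrite rmorphM rmorphXz //= fsgn_dil fsgn_euler.
have eQ : etaq 2 (P ^+ 3 / V P).
  by do ?[apply: etaqM | apply: etaqV | apply: etaqX | apply: etaq_dil | apply: etaq_euler].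
have eQx (n : nat) : etaq 2 ((P ^+ 3 / V P) ^+ n) by apply: etaqX.
rewrite exprMz_comm ?unitrV ?fdil_unit ?(etaq0 _ eQ) ?oner_eq0 //; last exact: mulrC.
rewrite exprz_inv -(rmorphXz V) ?(etaq_unit _ eQ) // -mulrA -rmorphM.
eexists; last by [].
apply: etaqM => //; case: x => n; first exact: eQx.
by apply: (etaqV _ (eQx n.+1)).
Qed.

Lemma eis_sgn K f : eis K 2 f -> eis K 2 (fsgn f).
Proof.
move=> ef j n n0 pn; rewrite !fsgnE ef // mulrA -!(signr_odd _ (2 ^ _ * _)) -(signr_odd _ (2 ^ _)).
by rewrite oddM; move: pn; rewrite dvdn2 negbK => ->; rewrite andbT.
Qed.

End Sign.

Section LowCoefficients.
Variable F : numFieldType.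
Implicit Types (G : fps F).

Lemma ldlog_rec p x G : (1 < p)%N -> etax p x G ->
  forall n, n%:R * G n = \sum_(i < n.+1) G i * ldlog G (n - i)%N.
Proof.
move=> p1 eG n; have uG := etaq_unit p1 (etax_etaq eG).
by rewrite -fpsM -fder_ldlog.
Qed.

Lemma ldlog_coef p x G n : (1 < p)%N -> etax p x G -> (0 < n)%N -> ~~ (p %| n)%N ->
  ldlog G n = - x%:~R * (sigma 1 n)%:R.
Proof.
move=> p1 eG n0 pn; have [L -> _] := ldlog_etaxE p1 eG.
by rewrite fpsD fpsMz fpsCM fdilE (negPf pn) mulr0 addr0 eulerSE // mulNrz -mulrzr mulNr mulrC.
Qed.

Lemma ldlog_coef_dvd p x G : (1 < p)%N -> etax p x G -> exists y : int,
  forall n, (0 < n)%N -> ~~ (p %| n)%N ->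
  ldlog G (p * n)%N = - x%:~R * (sigma 1 (p * n))%:R - p%:R * y%:~R * (sigma 1 n)%:R.
Proof.
move=> p1 eG; have [L -> [y yE]] := ldlog_etaxE p1 eG; exists y => n n0 pn.
rewrite fpsD fpsMz fpsCM fdil_mul ?(ltnW p1) // yE // !eulerSE // ?muln_gt0 ?(ltnW p1) //.
have mz (m : F) (z : int) : - m *~ z = - z%:~R * m.
  by rewrite mulNrz -mulrzr mulNr mulrC.
by rewrite !mz; ring.
Qed.

End LowCoefficients.

(** * The polynomial equations in 2^K, 3^K, 5^K, 7^K *)

Section Diophantine.
Variable F : realFieldType.
Implicit Types (u A B C y c : F).

(** Induction works because 5 < 9 and 7 < 27; at 9 the exponent is large enough for the bound on
    5^K, which fails at 7 and 8. *)
Lemma pow_facts K : (9 <= K)%N ->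
  [/\ 2000 <= 1 + 3 ^+ K :> F, 150 * (1 + 5 ^+ K) <= (1 + 3 ^+ K) ^+ 2 :> F
    & 1000 * (1 + 7 ^+ K) <= (1 + 3 ^+ K) ^+ 3 :> F].
Proof.
suff base : (9 <= K)%N -> [/\ 2000 <= 3 ^+ K :> F,
    150 * (1 + 5 ^+ K) <= 3 ^+ K ^+ 2 :> F & 1000 * (1 + 7 ^+ K) <= 3 ^+ K ^+ 3 :> F].
  have t0 : 0 <= 3 ^+ K :> F by rewrite exprn_ge0.
  by move=> /base[h1 h2 h3]; move: (3 ^+ K) h1 h2 h3 t0 => t *; split; nra.
elim: K => // K IH; rewrite leq_eqVlt => /orP[/eqP <-|/IH[h1 h2 h3]].
  by split; lra.
rewrite !(exprS _ K); have : 0 <= 3 ^+ K :> F by rewrite exprn_ge0.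
have : 0 <= 5 ^+ K :> F by rewrite exprn_ge0.
have : 0 <= 7 ^+ K :> F by rewrite exprn_ge0.
move: (3 ^+ K) (5 ^+ K) (7 ^+ K) h1 h2 h3 => t s r h1 h2 h3 r0 s0 t0.
have : 0 <= t ^+ 2 by rewrite exprn_ge0.
have : 0 <= t ^+ 3 by rewrite exprn_ge0.
by rewrite !exprMn => t3 t2; split; lra.
Qed.

Lemma pow_gt0 K : [/\ 2 <= 1 + 5 ^+ K :> F & 2 <= 1 + 7 ^+ K :> F].
Proof.
have : 1 <= 5 ^+ K :> F by rewrite exprn_ege1 // ler1n.
by have : 1 <= 7 ^+ K :> F; [rewrite exprn_ege1 // ler1n | split; lra].
Qed.

Lemma large_facts A B : 2000 <= A -> 150 * B <= A ^+ 2 ->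
  [/\ 150 * (A * B) <= A ^+ 3, 2000 * A <= A ^+ 2 & 2000 * A ^+ 2 <= A ^+ 3].
Proof.
move=> h1 h2; have A0 : 0 <= A by lra.
split; last 2 first.
- by rewrite expr2 ler_wpM2r.
- by rewrite exprS ler_wpM2r // sqr_ge0.
by rewrite mulrCA exprS ler_wpM2l.
Qed.

(** The quadratic forces u <= 10 A: beyond it, the terms with u exceed 98 A^3, more than 90 A^3 can
    balance. Then 2 u^2 (u - 9A) <= 200 A^3, so the term -270 A^3 keeps the cubic negative. *)
Lemma dioph2_h0_large A B C u : 2000 <= A -> 2 <= B -> 2 <= C ->
  150 * B <= A ^+ 2 -> 1000 * C <= A ^+ 3 -> 0 <= u ->
  (A - 4) * u ^+ 2 + (110 - 5 * A - 15 * B) * u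
    + (270 * A * B + 274 * A + 45 * A ^+ 2 - 90 * A ^+ 3 + 60 * B - 315 * C - 376) = 0 ->
  2 * u ^+ 3 - (18 * A + 96) * u ^+ 2 + (90 * A + 270 * B + 708) * u
    + (810 * A * B + 2628 * A - 810 * A ^+ 2 - 270 * A ^+ 3 - 1080 * B - 1424) = 0 ->
  False.
Proof.
move=> h1 B2 C2 h2 h3 u0; have [AB A2 A3] := large_facts h1 h2.
have A0 : 0 <= A by lra.
have AB0 : 0 <= A * B by apply: mulr_ge0; [|clear -B2; lra].
move=> e7; have u10 : u <= 10 * A.
  rewrite leNgt; apply/negP => ltu; pose Q := (A - 4) * u - 5 * A - 15 * B + 110.
  have f1 : (A - 4) * (10 * A) <= (A - 4) * u.
    by apply: ler_wpM2l; [clear -h1; lra | exact: ltW].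
  have f2 : 98 * A ^+ 2 <= 10 * Q by rewrite /Q; clear -h1 h2 A2 f1; lra.
  have Q0 : 0 <= Q by have := sqr_ge0 A; clear -f2; lra.
  have f3 : Q * (10 * A) <= Q * u by rewrite ler_wpM2l // ltW.
  have f4 : 98 * A ^+ 2 * A <= 10 * Q * A by rewrite ler_wpM2r.
  have f5 : Q * u =
      - (270 * (A * B) + 274 * A + 45 * A ^+ 2 - 90 * A ^+ 3 + 60 * B - 315 * C - 376).
    by rewrite /Q; clear -e7; lra.
  have f6 : 98 * A ^+ 2 * A = 98 * A ^+ 3 by rewrite -mulrA -exprSr.
  have f7 : Q * (10 * A) = 10 * Q * A by rewrite mulrCA mulrA.
  have f8 := sqr_ge0 A; clear -f3 f4 f5 f6 f7 f8 AB0 A3 h1 h3 B2 A0; lra.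
have g1 : u ^+ 2 <= 100 * A ^+ 2.
  have -> : 100 * A ^+ 2 = (10 * A) ^+ 2 by ring.
  by rewrite lerXn2r // nnegrE // mulr_ge0.
have g2 : u ^+ 2 * (u - 9 * A) <= u ^+ 2 * A.
  by apply: ler_wpM2l; [exact: sqr_ge0 | clear -u10; lra].
have g3 : u ^+ 2 * A <= 100 * A ^+ 2 * A by exact: ler_wpM2r.
have g4 : (90 * A + 270 * B + 708) * u <= (90 * A + 270 * B + 708) * (10 * A).
  by apply: ler_wpM2l; [clear -A0 B2; lra | exact: u10].
have g5 : 0 <= u ^+ 2 by rewrite sqr_ge0.
have g6 : u ^+ 2 * (u - 9 * A) <= 100 * A ^+ 3.
  by apply: le_trans g2 (le_trans g3 _); rewrite -mulrA -exprSr.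
clear -g4 g5 g6 AB A2 A3 h1 B2 => e6; lra.
Qed.

(** Elimination of u: pseudo-division of the cubic by the quadratic leaves l1 u + l0 = 0, which is
    substituted back. It turns K = 5 and K = 7 into numerical checks. *)
Lemma cubic_quadratic (al be ga c3 c2 c1 c0 u : F) :
  al * u ^+ 2 + be * u + ga = 0 -> c3 * u ^+ 3 + c2 * u ^+ 2 + c1 * u + c0 = 0 ->
  let l1 := c3 * (be ^+ 2 - al * ga) - c2 * al * be + c1 * al ^+ 2 in
  let l0 := c3 * be * ga - c2 * al * ga + c0 * al ^+ 2 in
  al * l0 ^+ 2 - be * l0 * l1 + ga * l1 ^+ 2 = 0.
Proof.
move=> q c l1 l0; have l : l0 = - l1 * u.
  apply/eqP; rewrite -subr_eq0; apply/eqP.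
  transitivity (al ^+ 2 * (c3 * u ^+ 3 + c2 * u ^+ 2 + c1 * u + c0)
     - (al * c3 * u - c3 * be + al * c2) * (al * u ^+ 2 + be * u + ga)).
    by rewrite /l0 /l1; ring.
  by rewrite q c !mulr0 subr0.
transitivity (l1 ^+ 2 * (al * u ^+ 2 + be * u + ga)); first by rewrite l; ring.
by rewrite q mulr0.
Qed.

(* The weight is k = K + 1; the unknown u is the square of the coefficient of q. *)
Lemma dioph2_h0 K u : odd K -> 0 <= u ->
  let A := 1 + 3 ^+ K in let B := 1 + 5 ^+ K in let C := 1 + 7 ^+ K in
  (A - 4) * u ^+ 2 + (110 - 5 * A - 15 * B) * u
    + (270 * A * B + 274 * A + 45 * A ^+ 2 - 90 * A ^+ 3 + 60 * B - 315 * C - 376) = 0 ->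
  2 * u ^+ 3 - (18 * A + 96) * u ^+ 2 + (90 * A + 270 * B + 708) * u
    + (810 * A * B + 2628 * A - 810 * A ^+ 2 - 270 * A ^+ 3 - 1080 * B - 1424) = 0 ->
  K = 1%N /\ (u - 4) * (u - 16) * (u - 64) = 0 \/ K = 3 /\ u = 256.
Proof.
move=> oK u0; case: (leqP 9 K) => [/pow_facts[h1 h2 h3] A B C e7 e6|K9].
  by have [B2 C2] := pow_gt0 K; case: (dioph2_h0_large h1 B2 C2 h2 h3 u0 e7 e6).
have {oK K9} : K \in [:: 1; 3; 5; 7]%N by move: oK; do 9?[case: K K9 => [|K] K9 //].
rewrite !inE => /or4P[] /eqP -> A B C e7 e6; [left|right|exfalso|exfalso].
(* For K = 1 the quadratic vanishes identically (A = 4, B = 6, C = 8), and the cubic is 2 (u - 4)(u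
   - 16)(u - 64). *)
- by rewrite /A /B /C in e6; split=> //; clear -e6; lra.
- rewrite /A /B /C in e7; split=> //; have : (u - 256) * (u + 176) = 0 by clear -e7; lra.
  by move/eqP; rewrite mulf_eq0 => /orP[] /eqP ?; lra.
- by rewrite -mulNr in e6; have := cubic_quadratic e7 e6; rewrite /A /B /C; clear; lra.
- by rewrite -mulNr in e6; have := cubic_quadratic e7 e6; rewrite /A /B /C; clear; lra.
Qed.

(** The linear relation places u between 2.3 A and 2.47 A. There 2 u^2 - 5 u A <= -0.06 u A
    outweighs 15 B <= A^2 / 10, so the quadratic is negative. *)
Lemma dioph2_h1_large A B C u : 2000 <= A -> 2 <= B -> 2 <= C ->
  150 * B <= A ^+ 2 -> 1000 * C <= A ^+ 3 -> 0 <= u ->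
  2 * u ^+ 2 - 5 * u * A - 20 * u + 5 * A + 15 * B + 18 = 0 ->
  u * (5 * A ^+ 2 - 2 * A - 6 * B - 36) =
    12 * A ^+ 3 + 5 * A ^+ 2 - 21 * (A * B) - 50 * A - 60 * B + 36 * C - 72 -> False.
Proof.
move=> h1 B2 C2 h2 h3 u0 + lin; have [AB A2 A3] := large_facts h1 h2.
have A0 : 0 <= A by lra.
have D1 : u * (5 * A ^+ 2 - 2 * A - 6 * B - 36) <= u * (5 * A ^+ 2).
  by apply: ler_wpM2l => //; clear -A0 B2; lra.
have D2 : u * (49 * A ^+ 2) <= 10 * (u * (5 * A ^+ 2 - 2 * A - 6 * B - 36)).
  by rewrite [10 * (u * _)]mulrCA ler_wpM2l //; clear -A2 B2 h2 h1; lra.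
have A20 : 0 < A ^+ 2 by rewrite exprn_gt0 //; lra.
have lo : 23 * A <= 10 * u.
  rewrite -(ler_pM2r A20) -mulrA -exprS; rewrite lin in D1; clear -D1 AB A2 A3 h1 h2 C2; lra.
have hi : 100 * u <= 247 * A.
  rewrite -(ler_pM2r A20) -[247 * A * _]mulrA -exprS; rewrite lin in D2.
  have AB0 : 0 <= A * B by apply: mulr_ge0; lra.
  clear -D2 AB0 A2 A3 h1 h3 B2; lra.
have f1 : u * (2 * u - 5 * A) * 100 <= u * (- 6 * A).
  by rewrite -mulrA ler_wpM2l //; clear -hi; lra.
have f2 : 23 * A * A <= 10 * u * A by rewrite ler_wpM2r.
clear -f1 f2 lo h1 h2 A0 A2 => e5; nra.
Qed.

Lemma dioph2_h1 K u : odd K -> 0 <= u ->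
  let A := 1 + 3 ^+ K in let B := 1 + 5 ^+ K in let C := 1 + 7 ^+ K in
  2 * u ^+ 2 - 5 * u * A - 20 * u + 5 * A + 15 * B + 18 = 0 ->
  (A - 4) * u ^+ 2 + (22 - A - 3 * B) * u + (18 * A * B + 24 * A - 6 * A ^+ 3 - 18 * C) = 0 ->
  K = 1%N /\ (u - 4) * (u - 16) = 0 \/ K = 3 /\ u = 64.
Proof.
move=> oK u0 A B C e5 e6.
(* Eliminates u^2: A - 4 times the first equation minus twice the second. *)
have lin : u * (5 * A ^+ 2 - 2 * A - 6 * B - 36) =
    12 * A ^+ 3 + 5 * A ^+ 2 - 21 * (A * B) - 50 * A - 60 * B + 36 * C - 72.
  have e5A : (A - 4) * (2 * u ^+ 2 - 5 * u * A - 20 * u + 5 * A + 15 * B + 18) = 0.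
    by rewrite e5 mulr0.
  by clear e5; move: A B C e5A e6; clear => A B C e5A e6; lra.
move: @A @B @C e5 e6 lin; case: (leqP 9 K) => [/pow_facts[h1 h2 h3] A B C e5 e6 lin|K9].
  by have [B2 C2] := pow_gt0 K; case: (dioph2_h1_large h1 B2 C2 h2 h3 u0 e5 lin).
have {oK K9} : K \in [:: 1; 3; 5; 7]%N by move: oK; do 9?[case: K K9 => [|K] K9 //].
rewrite !inE => /or4P[] /eqP -> A B C e5 e6 lin; [left|right|exfalso|exfalso].
- by rewrite /A /B in e5; split=> //; clear -e5; lra.
- by rewrite /A /B /C in lin; split=> //; clear -lin; lra.
- have c : 0 * u ^+ 3 + (A - 4) * u ^+ 2 + (22 - A - 3 * B) * u +
      (18 * A * B + 24 * A - 6 * A ^+ 3 - 18 * C) = 0 by rewrite mul0r add0r.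
  have q : 2 * u ^+ 2 + (- 5 * A - 20) * u + (5 * A + 15 * B + 18) = 0 by rewrite -e5; ring.
  by have := cubic_quadratic q c; rewrite /A /B /C; clear; lra.
- have c : 0 * u ^+ 3 + (A - 4) * u ^+ 2 + (22 - A - 3 * B) * u +
      (18 * A * B + 24 * A - 6 * A ^+ 3 - 18 * C) = 0 by rewrite mul0r add0r.
  have q : 2 * u ^+ 2 + (- 5 * A - 20) * u + (5 * A + 15 * B + 18) = 0 by rewrite -e5; ring.
  by have := cubic_quadratic q c; rewrite /A /B /C; clear; lra.
Qed.

(** The left side is -6 A (A^2 - 3B - 4) - 18 C, which is negative from K = 3 on since 9^K >= 3 *
    5^K there. *)
Lemma dioph2_odd K : odd K ->
  let A := 1 + 3 ^+ K in let B := 1 + 5 ^+ K in let C := 1 + 7 ^+ K in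
  18 * A * B + 24 * A - 6 * A ^+ 3 - 18 * C = 0 :> F -> K = 1%N.
Proof.
case: K => [|[|[|K]]] // _ /= E; exfalso.
have t27 : 27 <= 3 ^+ K.+3 :> F.
  by have := exprn_ege1 K (_ : 1 <= 3 :> F); rewrite ler1n !exprS => /(_ isT); lra.
have r0 : 0 < 7 ^+ K.+3 :> F by rewrite exprn_gt0.
have h1 : 3 * 5 ^+ K.+3 <= 3 ^+ K.+3 ^+ 2 :> F.
  elim: K {E r0 t27} => [|K IH]; first by lra.
  by rewrite exprS (exprS _ K.+3) exprMn; have := sqr_ge0 (3 ^+ K.+3 : F); lra.
move: (3 ^+ K.+3) (5 ^+ K.+3) (7 ^+ K.+3) E h1 r0 t27 => t s r E h1 r0 t27.
have : 0 <= (1 + t) * ((1 + t) ^+ 2 - 3 * (1 + s) - 4).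
  by clear -h1 t27; apply: mulr_ge0; [lra | nra].
by lra.
Qed.

Lemma pow23_facts K : odd K -> K = 1%N \/
  [/\ (3 <= K)%N, 8 <= 2 ^+ K :> F, 1 <= 5 ^+ K :> F & 2 * 3 ^+ K <= 2 ^+ K ^+ 2 :> F].
Proof.
case: K => [|[|[|K]]] // _; first by left.
right; split=> //.
- by have := exprn_ege1 K (_ : 1 <= 2 :> F); rewrite ler1n !exprS => /(_ isT); lra.
- by rewrite exprn_ege1 // ler1n.
elim: K => [|K IH]; first by lra.
by rewrite exprS (exprS _ K.+3) exprMn; have := sqr_ge0 (2 ^+ K.+3 : F); lra.
Qed.

End Diophantine.

(** * Recurrences for the first coefficients of an eta quotient *)

Section LowEquations.
Variable F : realFieldType.
Implicit Types (G : fps F) (x : int).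

Lemma ldlog0 p x G : (1 < p)%N -> etax p x G -> ldlog G 0%N = 0.
Proof.
move=> p1 eG; have := ldlog_rec p1 eG 0.
by rewrite big_ord1 mul0r (etaq0 p1 (etax_etaq eG)) mul1r.
Qed.

Lemma ldlog_recS p x G n : (1 < p)%N -> etax p x G ->
  n.+1%:R * G n.+1 = ldlog G n.+1 + \sum_(i < n) G i.+1 * ldlog G (n - i)%N.
Proof.
move=> p1 eG; rewrite (ldlog_rec p1 eG).
move: (ldlog G) (ldlog0 p1 eG) => L L0; rewrite big_ord_recl big_ord_recr /= /bump /= add1n.
rewrite subn0 subnn L0 mulr0 addr0 (etaq0 p1 (etax_etaq eG)) mul1r.
by congr (_ + _); apply: eq_bigr => i _; rewrite add1n subSS.
Qed.

(** The recurrence n G(n) = sum of G(i) l(n - i), where l is the logarithmic derivative. At odd n,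
    l(n) = sigma_1(n) l(1), and l(6) = 4 l(2) since sigma_1(6) = 4 sigma_1(2) and sigma_1(3) = 4;
    the unknowns left are l(2) and l(4). *)
Lemma etax2_equations x G : etax 2 x G -> exists l2 l4, let l1 := G 1%N in
  [/\ 2 * G 2%N = G 1%N * l1 + l2,
      3 * G 3%N = G 2%N * l1 + G 1%N * l2 + 4 * l1,
      4 * G 4%N = G 3%N * l1 + G 2%N * l2 + G 1%N * (4 * l1) + l4,
      5 * G 5%N = G 4%N * l1 + G 3%N * l2 + G 2%N * (4 * l1) + G 1%N * l4 + 6 * l1 &
      6 * G 6%N = G 5%N * l1 + G 4%N * l2 + G 3%N * (4 * l1) + G 2%N * l4
         + G 1%N * (6 * l1) + 4 * l2 /\
      7 * G 7%N = G 6%N * l1 + G 5%N * l2 + G 4%N * (4 * l1) + G 3%N * l4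
         + G 2%N * (6 * l1) + G 1%N * (4 * l2) + 8 * l1].
Proof.
move=> eG; have lt12 : (1 < 2)%N by [].
have rec n := ldlog_recS n lt12 eG; have := ldlog_coef lt12 eG.
have G1 := etax_coef1 lt12 eG; rewrite -G1 => lc.
have l3 := lc 3 isT isT; have l5 := lc 5 isT isT; have l7 := lc 7 isT isT.
have l1 := lc 1%N isT isT.
have [y yE] := ldlog_coef_dvd lt12 eG.
have l26 : ldlog G 6 = 4 * ldlog G 2.
  have s6 : sigma 1 (2 * 3) = 12 by rewrite (@sigma_mulp 1 2 3 0) // mul1n sigma_prime.
  rewrite (yE 3) // (yE 1%N) // s6 sigma1E (sigma_prime 1 (isT : prime 3)).
  by rewrite (sigma_prime 1 (isT : prime (2 * 1))); lra.
rewrite sigma1E mulr1 in l1; rewrite sigma_prime // in l3; rewrite sigma_prime // in l5.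
rewrite sigma_prime // in l7.
move: (ldlog G) l1 l3 l5 l7 l26 rec => L l1 l3 l5 l7 l26 rec.
have r2 := rec 1%N; have r3 := rec 2; have r4 := rec 3; have r5 := rec 4; have r6 := rec 5;
  have r7 := rec 6.
move: r2 r3 r4 r5 r6 r7; rewrite !big_ord_recl !big_ord0 /= /bump /= !subn0 !subSS !subn0.
rewrite l1 l3 l5 l7 l26 => r2 r3 r4 r5 r6 r7.
by exists (L 2), (L 4); split; [lra.. | split; lra].
Qed.

Lemma etax3_equations x G : etax 3 x G -> exists l3, let l1 := G 1%N in
  [/\ 2 * G 2%N = G 1%N * l1 + 3 * l1,
      3 * G 3%N = G 2%N * l1 + G 1%N * (3 * l1) + l3,
      4 * G 4%N = G 3%N * l1 + G 2%N * (3 * l1) + G 1%N * l3 + 7 * l1 &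
      5 * G 5%N = G 4%N * l1 + G 3%N * (3 * l1) + G 2%N * l3 + G 1%N * (7 * l1) + 6 * l1].
Proof.
move=> eG; have lt13 : (1 < 3)%N by [].
have rec n := ldlog_recS n lt13 eG; have := ldlog_coef lt13 eG.
have G1 := etax_coef1 lt13 eG; rewrite -G1 => lc.
have l2 := lc 2 isT isT; have l5 := lc 5 isT isT; have l4 := lc 4 isT isT.
have l1 := lc 1%N isT isT.
rewrite sigma1E mulr1 in l1; rewrite sigma_prime // in l2; rewrite sigma_prime // in l5.
rewrite sigma4 in l4.
move: (ldlog G) l1 l2 l4 l5 rec => L l1 l2 l4 l5 rec.
have r2 := rec 1%N; have r3 := rec 2; have r4 := rec 3; have r5 := rec 4.
move: r2 r3 r4 r5; rewrite !big_ord_recl !big_ord0 /= /bump /= !subn0 !subSS !subn0.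
rewrite l1 l2 l4 l5 => r2 r3 r4 r5.
by exists (L 3); split; lra.
Qed.

Lemma etax5_equations p x G : (4 < p)%N -> etax p x G -> let l1 := G 1%N in
  2 * G 2%N = G 1%N * l1 + 3 * l1 /\
  3 * G 3%N = G 2%N * l1 + G 1%N * (3 * l1) + 4 * l1.
Proof.
move=> p4 eG; have lt1p : (1 < p)%N by lia.
have rec n := ldlog_recS n lt1p eG; have := ldlog_coef lt1p eG.
have G1 := etax_coef1 lt1p eG; rewrite -G1 => lc.
have nd n : (0 < n)%N -> (n < p)%N -> ~~ (p %| n)%N by move=> n0 np; rewrite gtnNdvd.
have l2 := lc 2 isT (nd 2 isT (_ : 2 < p)%N); have l3 := lc 3 isT (nd 3 isT (_ : 3 < p)%N).
have l1 := lc 1%N isT (nd 1%N isT lt1p).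
rewrite sigma1E mulr1 in l1; rewrite sigma_prime // in l2; rewrite sigma_prime // in l3.
have {}l2 := l2 (ltac:(lia)); have {}l3 := l3 (ltac:(lia)).
move: (ldlog G) l1 l2 l3 rec => L l1 l2 l3 rec.
have r2 := rec 1%N; have r3 := rec 2.
move: r2 r3; rewrite !big_ord_recl !big_ord0 /= /bump /= !subn0 !subSS !subn0.
by rewrite l1 l2 l3 => r2 r3; split; lra.
Qed.

End LowEquations.

(** * From the first coefficients to the values at powers of p *)

Section CaseAnalysis.
Variable F : realFieldType.
Implicit Types (a f G H : fps F) (x : int) (K : nat).

Lemma sigmaF K n : prime n -> (sigma K n)%:R = 1 + n%:R ^+ K :> F.
Proof. by move=> pn; rewrite sigma_prime // natrD natrX. Qed.

(** For p >= 5 the recurrence up to n = 3 has no unknown besides c = G(1). If h = 1 it gives 2 (1 +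
    3^K) = (1 + 2^K)(4 + 2^K); if h = 0 it gives c = 2^(K+1) - 1 and 3 + 3^(K+1) = 2 * 4^K + 7 *
    2^K. Both contradict 2 * 3^K <= 4^K for K >= 3, and K = 1 is checked directly. *)
Lemma no_eta_ge5 K p x G a (h : bool) : odd K -> (4 < p)%N -> etax p x G ->
  a = fpsX ^+ h * G -> a 1%N != 0 -> a 2%N = a 1%N * (sigma K 2)%:R ->
  a 3%N = a 1%N * (sigma K 3)%:R -> False.
Proof.
move=> oK p4 eG aE a1; rewrite !sigmaF // => a2 a3.
have [/= r2 r3] := etax5_equations p4 eG; have G0 := etaq0 (ltac:(lia) : (1 < p)%N) (etax_etaq eG).
have P := pow23_facts F oK; move: a1 a2 a3; rewrite aE; case: h {aE}.
  rewrite expr1 !fpsXM /= G0 !mul1r => _ G1 G2.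
  case: P => [K1|[K3 y8 _ yt]].
    by move: G1 G2; rewrite K1 !expr1 => G1 G2; rewrite G1 G2 in r2; lra.
  move: (2 ^+ K) (3 ^+ K) y8 yt G1 G2 => y t y8 yt G1 G2.
  rewrite G1 G2 in r2; clear -r2 y8 yt; nra.
rewrite expr0 mul1r => c0 G2 G3; rewrite G2 G3 in r2 r3; move: (G 1%N) c0 r2 r3 => c c0 r2 r3.
have q2 : 2 * (1 + 2 ^+ K) = c + 3 by apply: (mulfI c0); lra.
have q3 : 3 * (1 + 3 ^+ K) = c * (1 + 2 ^+ K) + 3 * c + 4 by apply: (mulfI c0); lra.
case: P => [K1|[K3 y8 _ yt]].
  move: q2 q3; rewrite K1 !expr1 => q2 q3; have cE : c = 1 + 2 by lra.
  by rewrite cE in q3; lra.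
move: (2 ^+ K) (3 ^+ K) y8 yt q2 q3 => y t y8 yt q2 q3.
have cE : c = 2 * y - 1 by lra.
rewrite cE in q3; clear -q3 y8 yt; nra.
Qed.

(** For either h, eliminating l(3) and the remaining coefficients leaves a relation in which 5^K and
    the leading power y^4 of y = 2^K have the same sign. This is impossible for y >= 8, so K = 1,
    where h = 1 fails and h = 0 gives c = 3. *)
Lemma eta_level3 K x G a (h : bool) : odd K -> etax 3 x G -> eis K 3 a ->
  a = fpsX ^+ h * G -> a 1%N != 0 ->
  [/\ K = 1%N, a 1%N = 3 & forall j, (1 <= j)%N -> a (3 ^ j)%N = 12].
Proof.
move=> oK eG ea aE a1; have lt13 : (1 < 3)%N by [].
have an n : (0 < n)%N -> ~~ (3 %| n)%N -> a n = a 1%N * (sigma K n)%:R.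
  by move=> n0 n3; have := ea 0%N n n0 n3; rewrite expn0 mul1n.
have a2 := an 2 isT isT; have a4 := an 4 isT isT; have a5 := an 5 isT isT.
have a6 : a 6 = a 3 * (sigma K 2)%:R by have := ea 1%N 2 isT isT.
rewrite !sigmaF // in a2 a5 a6; rewrite sigma4 !natrD !natrX in a4.
have y4 : 4%:R ^+ K = 2 ^+ K ^+ 2 :> F.
  by have -> : 4%:R = 2 ^+ 2 :> F; [ring | rewrite -!exprM mulnC].
rewrite {}y4 in a4.
have [l3 [/= r2 r3 r4 r5]] := etax3_equations eG; have G0 := etaq0 lt13 (etax_etaq eG).
have P := pow23_facts F oK; case: h aE => aE.
  exfalso; move: a1 a2 a4 a5 a6; rewrite aE expr1 !fpsXM /= G0 !mul1r => _ G1 G3 G4 G5.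
  case: P => [K1|[K3 y8 s1 _]].
    move: G1 G3 G4 G5; rewrite K1 !expr1 => G1 G3 G4 G5; rewrite G1 in r2 r3 r4 r5.
    have G2 : G 2 = 9 by lra. rewrite G2 in G5 r3 r4 r5.
    have l3E : l3 = - 33 by lra. rewrite l3E in r5; lra.
  move: (2 ^+ K) (5 ^+ K) y8 s1 G1 G3 G4 => y s y8 s1 G1 G3 G4.
  rewrite G1 G3 in r2 r3 r4; have G2E : G 2 = (1 + y) * (4 + y) / 2 by lra.
  have l3E : l3 = 3 * (1 + y + y ^+ 2) - G 2 * (1 + y) - 3 * (1 + y) ^+ 2 by lra.
  rewrite l3E G2E G4 in r4; clear -r4 y8 s1.
  have y3 : 8 * y ^+ 2 <= y ^+ 3 by rewrite [y ^+ 3]exprS ler_wpM2r ?sqr_ge0.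
  have y4 : 8 * y ^+ 3 <= y ^+ 4 by rewrite [y ^+ 4]exprS ler_wpM2r // exprn_ge0 //; lra.
  have y2 : 8 * y <= y ^+ 2 by rewrite expr2 ler_wpM2r //; lra.
  lra.
rewrite expr0 mul1r in aE; rewrite aE in a1 a2 a4 a5 a6 ea *.
move: (G 1%N) (etax_coef1 lt13 eG) a1 a2 a4 a5 r2 r3 r4 r5 => c cE c0 a2 a4 a5.
rewrite a4 a5 a2 => r2 r3 r4 r5.
have q2 : 2 * (1 + 2 ^+ K) = c + 3 by apply: (mulfI c0); lra.
have q4 : 4 * (1 + 2 ^+ K + 2 ^+ K ^+ 2) = G 3 + 3 * (c * (1 + 2 ^+ K)) + l3 + 7.
  by apply: (mulfI c0); lra.
have q5 : 5 * (1 + 5 ^+ K) =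
    c * (1 + 2 ^+ K + 2 ^+ K ^+ 2) + 3 * G 3 + (1 + 2 ^+ K) * l3 + 7 * c + 6.
  by apply: (mulfI c0); lra.
have {}K1 : K = 1%N.
  case: P => [//|[K3 y8 s1 _]]; exfalso.
  move: (2 ^+ K) (5 ^+ K) (G 3) y8 s1 q2 q4 q5 r3 => y s g y8 s1 q2 q4 q5 r3.
  have cy : c = 2 * y - 1 by lra.
  rewrite cy in q4 q5 r3.
  have gE : g = (4 * (1 + y + y ^+ 2) - 3 * ((2 * y - 1) * (1 + y)) - 7
     + (2 * y - 1) * (1 + y) * (2 * y - 1) + (2 * y - 1) * (3 * (2 * y - 1))) / 4 by lra.
  have lE : l3 = 3 * g - (2 * y - 1) * (1 + y) * (2 * y - 1) - (2 * y - 1) * (3 * (2 * y - 1)).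
    by lra.
  rewrite lE gE in q5; clear -q5 y8 s1.
  have y3 : 8 * y ^+ 2 <= y ^+ 3 by rewrite [y ^+ 3]exprS ler_wpM2r ?sqr_ge0.
  have y4 : 8 * y ^+ 3 <= y ^+ 4 by rewrite [y ^+ 4]exprS ler_wpM2r // exprn_ge0 //; lra.
  have y2 : 8 * y <= y ^+ 2 by rewrite expr2 ler_wpM2r //; lra.
  lra.
have c3 : c = 3 by move: q2; rewrite K1 expr1; lra.
split=> //; rewrite K1 in ea.
(* The model V b^3 / b has the same exponent -3, since b has exponent 3. *)
have x3 : x = -3.
  by apply/eqP; rewrite -(eqr_int F) rmorphN /=; apply/eqP; lra.
have ebq : etaq 3 (cb F) := etax_etaq (b_etax F).
have eg : etax 3 (-3) (fdil 3 (cb F) ^+ 3 / cb F).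
  have [Q eQ bE] := b_etax F; exists (cb F ^+ 3 / Q); first by apply: etaqM => //;
    [apply: etaqX|apply: etaqV].
  rewrite {2}bE invrM ?fdil_unit ?unitrXz ?euler_unit ?(etaq0 lt13 eQ) ?oner_eq0 //.
  rewrite rmorphM rmorphV ?(etaq_unit lt13 eQ) //= rmorphXn /= -invr_expz mulrA mulrC //.
rewrite x3 in eG; have [H eH GE] := etax_split lt13 eG eg.
exact: eis_cubic ea eH GE.
Qed.

Lemma sqr_eq_nat (c : F) (n : nat) : c ^+ 2 = n%:R ^+ 2 -> c = n%:R \/ c = - n%:R.
Proof. by move/eqP; rewrite eqf_sqr => /orP[/eqP|/eqP]; [left|right]. Qed.

Lemma etax_coef1_nat p x G (n : nat) : (1 < p)%N -> etax p x G -> G 1%N = n%:R -> x = - n%:Z.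
Proof.
move=> p1 /(etax_coef1 p1) -> /eqP; rewrite eqr_oppLR => /eqP E.
by apply/eqP; rewrite -(eqr_int F) rmorphN /= -pmulrn E.
Qed.

Let lt12 : (1 < 2)%N. Proof. by []. Qed.

Lemma even_sgn f j : (1 <= j)%N -> fsgn f (2 ^ j)%N = f (2 ^ j)%N.
Proof. by case: j => // j _; rewrite fsgnE -signr_odd expnS oddM mul1r. Qed.

(** As theta has exponent -2, the values 2, 4, 8 call for one, two or four factors theta(q). The
    models for 2 and 4 are completed to four theta factors by theta(q^2) and theta(q^4), which leave
    the exponent of P(q) alone. *)
Lemma eta_level2_h0_K1_pos x G (n : nat) : etax 2 x G -> eis 1 2 G ->
  G 1%N = n%:R -> n \in [:: 2; 4; 8] ->
  [/\ G 2 != n%:R, G 2 != - n%:R & forall j, (3 <= j)%N -> G (2 ^ j)%N = 24].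
Proof.
move=> eG ea G1; have xn := etax_coef1_nat lt12 eG G1; rewrite {}xn in eG.
have e1 := theta_etax F.
rewrite !inE => /or3P[] /eqP nE; rewrite nE in eG *.
- have eg : etax 2 (- 2%:Z) (theta F * fdil 2 (theta F ^+ 2 * fdil 2 (theta F))).
    by apply: etax_dilM => //; apply: etaqM; [apply: etaqX | apply: etaq_dil]; apply: etax_etaq e1.
  have [H eH GE] := etax_split lt12 eG eg; rewrite -mulrA -rmorphM in GE.
  have [-> h] := eis_theta121 ea eH GE; split=> //; lra.
- have eg : etax 2 (- 4%:Z) (theta F ^+ 2 * fdil 2 (theta F ^+ 2)).
    by apply: etax_dilM; [apply: (etaxX 2 e1) | apply: etaqX; apply: etax_etaq e1].
  have [H eH GE] := etax_split lt12 eG eg; rewrite -mulrA -rmorphM in GE.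
  have [-> h] := eis_theta22 ea eH GE; split; [lra|lra|] => j j3; apply: h; exact: ltnW.
- have [H eH GE] := etax_split lt12 eG (etaxX 4 e1).
  have h := eis_theta4 ea eH GE; have := h 1%N isT; rewrite expn1 => ->.
  by split; [lra|lra|] => j j3; apply: h; lia.
Qed.

(** Negative values of G(1) come from q -> -q, which fixes the coefficients at even indices; this is
    why the positive case excludes both n and -n as values of G(2). *)
Lemma eta_level2_h0_K1 x G : etax 2 x G -> eis 1 2 G ->
  (G 1%N ^+ 2 - 4) * (G 1%N ^+ 2 - 16) * (G 1%N ^+ 2 - 64) = 0 ->
  G 2 != G 1%N /\ forall j, (3 <= j)%N -> G (2 ^ j)%N = 24.
Proof.
move=> eG ea E; have [n nin nE] : exists2 n : nat, n \in [:: 2; 4; 8] & G 1%N ^+ 2 = n%:R ^+ 2.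
  move/eqP: E; rewrite !mulf_eq0 -orbA => /or3P[] /eqP E; [exists 2|exists 4|exists 8] => //; lra.
have [G1|G1] := sqr_eq_nat nE.
  by have [h1 h2 h3] := eta_level2_h0_K1_pos eG ea G1 nin; rewrite G1.
have s1 : fsgn G 1%N = n%:R by rewrite fsgnE expr1 G1 mulN1r opprK.
have [h1 h2 h3] := eta_level2_h0_K1_pos (etax_sgn eG) (eis_sgn ea) s1 nin.
rewrite (even_sgn _ (isT : (1 <= 1)%N)) in h1 h2; rewrite G1; split=> // j j3.
by rewrite -even_sgn ?h3 //; lia.
Qed.

(** The model is theta^8, whose successive increments at powers of two grow by the factor 8. *)
Lemma eta_level2_h0_K3 x G : etax 2 x G -> eis 3 2 G -> G 1%N ^+ 2 = 256 ->
  forall j, (1 <= j)%N ->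
  G (2 ^ j.+2)%N - G (2 ^ j.+1)%N = 8 * (G (2 ^ j.+1)%N - G (2 ^ j)%N).
Proof.
move=> eG ea E; have {}E : G 1%N ^+ 2 = 16%:R ^+ 2 by lra.
have pos y (f : fps F) : etax 2 y f -> eis 3 2 f -> f 1%N = 16%:R -> forall j, (1 <= j)%N ->
    f (2 ^ j.+2)%N - f (2 ^ j.+1)%N = 8 * (f (2 ^ j.+1)%N - f (2 ^ j)%N).
  move=> ef efe f1; have xE := etax_coef1_nat lt12 ef f1; rewrite {}xE in ef.
  have [H eH fE] := etax_split lt12 ef (etaxX 8 (theta_etax F)).
  have [_ h] := eis_theta8 efe eH fE; case=> // j _.
  by have h1 := h j.+1 isT; have := h j.+2 isT; rewrite /= exprS in h1 *; lra.
have [G1|G1] := sqr_eq_nat E; first exact: pos eG ea G1.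
have s1 : fsgn G 1%N = 16%:R by rewrite fsgnE expr1 G1 mulN1r opprK.
by move=> j j1; have := pos _ _ (etax_sgn eG) (eis_sgn ea) s1 j j1; rewrite !even_sgn.
Qed.

Lemma sgn_X G : fpsX * fsgn G = fpsC (-1) * fsgn (fpsX * G).
Proof.
apply/fpsP => -[|n]; rewrite fpsCM fsgnE !fpsXM ?mulr0 // fsgnE exprS; ring.
Qed.

(** If G(1) = 0, then G is a series in q^2 and q G has odd exponents only. Otherwise one or two
    factors theta(q) match the exponent, up to q -> -q, and the dilated theta and psi factors
    complete the model. *)
Lemma eta_level2_h1_K1 x G : etax 2 x G -> eis 1 2 (fpsX * G) ->
  G 1%N = 0 \/ (G 1%N ^+ 2 - 4) * (G 1%N ^+ 2 - 16) = 0 ->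
  G 1%N != 1 /\ forall j, (3 <= j)%N -> (fpsX * G) (2 ^ j)%N = 0.
Proof.
move=> eG ea [G0|E].
  have [H eH GE] := etaq_coef1_eq0 lt12 (etax_etaq eG) G0.
  by rewrite G0 eq_sym oner_eq0; split=> // j j3; rewrite GE odd_zero //; lia.
have pos y (f : fps F) (n : nat) : etax 2 y f -> eis 1 2 (fpsX * f) -> f 1%N = n%:R ->
    n \in [:: 2; 4] -> forall j, (3 <= j)%N -> (fpsX * f) (2 ^ j)%N = 0.
  move=> ef efe f1; have xn := etax_coef1_nat lt12 ef f1; rewrite {}xn in ef.
  have e1 := theta_etax F; have e2 := etax_etaq (psi_etax F).
  rewrite !inE => /orP[] /eqP nE; rewrite nE in ef *.
    have eg : etax 2 (- 2%:Z) (theta F * fdil 2 (theta F ^+ 2 * fdil 2 (fdil 2 (psi F)))).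
      apply: etax_dilM => //; apply: etaqM; first by apply: etaqX; apply: etax_etaq e1.
      by do 2!apply: etaq_dil.
    have [H eH fE] := etax_split lt12 ef eg; rewrite -mulrA -rmorphM in fE.
    have XE : fpsX * f = fpsX * theta F * fdil 2 (theta F ^+ 2 * fdil 2 (fdil 2 (psi F)) * H).
      by rewrite fE mulrA.
    by have [_] := eis_Xtheta12psi8 efe eH XE.
  have eg : etax 2 (- 4%:Z) (theta F ^+ 2 * fdil 2 (fdil 2 (psi F ^+ 2))).
    by apply: etax_dilM; [apply: (etaxX 2 e1) | apply: etaq_dil; apply: etaqX].
  have [H eH fE] := etax_split lt12 ef eg; rewrite -mulrA -rmorphM in fE.
  have XE : fpsX * f = fpsX * theta F ^+ 2 * fdil 2 (fdil 2 (psi F ^+ 2) * H) by rewrite fE mulrA.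
  by have [_ h] := eis_Xtheta2psi4 efe eH XE; move=> j j3; apply: h; lia.
have [n nin nE] : exists2 n : nat, n \in [:: 2; 4] & G 1%N ^+ 2 = n%:R ^+ 2.
  move/eqP: E; rewrite !mulf_eq0 => /orP[] /eqP E; [exists 2|exists 4] => //; lra.
split; first by apply/eqP => G1; move: nE nin; rewrite G1 !inE => nE /orP[] /eqP n2;
  rewrite n2 in nE; lra.
have [G1|G1] := sqr_eq_nat nE; first exact: pos eG ea G1 nin.
have s1 : fsgn G 1%N = n%:R by rewrite fsgnE expr1 G1 mulN1r opprK.
have es : eis 1 2 (fpsX * fsgn G) by rewrite sgn_X; apply: eisC; apply: eis_sgn.
move=> j j3; have := pos _ _ _ (etax_sgn eG) es s1 nin j j3.
rewrite sgn_X fpsCM even_sgn; last by lia.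
by move/eqP; rewrite mulN1r oppr_eq0 => /eqP.
Qed.

Lemma eta_level2_h1_K3 x G : etax 2 x G -> eis 3 2 (fpsX * G) -> G 1%N ^+ 2 = 64 ->
  forall j, (1 <= j)%N -> (fpsX * G) (2 ^ j.+2)%N - (fpsX * G) (2 ^ j.+1)%N =
    8 * ((fpsX * G) (2 ^ j.+1)%N - (fpsX * G) (2 ^ j)%N).
Proof.
move=> eG ea E; have {}E : G 1%N ^+ 2 = 8%:R ^+ 2 by lra.
have pos y (f : fps F) : etax 2 y f -> eis 3 2 (fpsX * f) -> f 1%N = 8%:R -> forall j, (1 <= j)%N ->
    (fpsX * f) (2 ^ j.+2)%N - (fpsX * f) (2 ^ j.+1)%N =
    8 * ((fpsX * f) (2 ^ j.+1)%N - (fpsX * f) (2 ^ j)%N).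
  move=> ef efe f1; have xE := etax_coef1_nat lt12 ef f1; rewrite {}xE in ef.
  have [H eH fE] := etax_split lt12 ef (etaxX 8 (psi_etax F)).
  have XE : fpsX * f = fpsX * psi F ^+ 8 * fdil 2 H by rewrite fE mulrA.
  by move=> j _; rewrite !(eis_Xpsi8 efe eH XE) !exprS; lra.
have [G1|G1] := sqr_eq_nat E; first exact: pos eG ea G1.
have s1 : fsgn G 1%N = 8%:R by rewrite fsgnE expr1 G1 mulN1r opprK.
have es : eis 3 2 (fpsX * fsgn G) by rewrite sgn_X; apply: eisC; apply: eis_sgn.
move=> j j1; have := pos _ _ (etax_sgn eG) es s1 j j1.
by rewrite sgn_X !fpsCM !even_sgn //; lra.
Qed.

Lemma eta_level2 K x G a (h : bool) : odd K -> etax 2 x G -> eis K 2 a ->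
  a = fpsX ^+ h * G -> a 1%N != 0 ->
  (K = 1%N /\ a 2 != a 1%N /\ exists d, forall j, (3 <= j)%N -> a (2 ^ j)%N = d) \/
  (K = 3 /\ forall j, (1 <= j)%N ->
     a (2 ^ j.+2)%N - a (2 ^ j.+1)%N = 8 * (a (2 ^ j.+1)%N - a (2 ^ j)%N)).
Proof.
move=> oK eG ea aE a1.
have an n : (0 < n)%N -> ~~ (2 %| n)%N -> a n = a 1%N * (sigma K n)%:R.
  by move=> n0 n2; have := ea 0%N n n0 n2; rewrite expn0 mul1n.
have a3 := an 3 isT isT; have a5 := an 5 isT isT; have a7 := an 7 isT isT.
have a6 : a 6 = a 2 * (sigma K 3)%:R by have := ea 1%N 3 isT isT.
rewrite !sigmaF // in a3 a5 a6 a7.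
have [l2 [l4 [/= r2 r3 r4 r5 [r6 r7]]]] := etax2_equations eG.
have G0 := etaq0 lt12 (etax_etaq eG); case: h aE => aE.
  rewrite expr1 in aE; move: a1 a3 a5 a6 a7; rewrite aE !fpsXM /= G0 !mul1r => _ G2 G4 G5 G6.
  rewrite G2 G4 G5 G6 in r2 r3 r4 r5 r6; rewrite aE in ea.
  (* The equation [e5] below results from division by G(1). *)
  have [s0|s0] := eqVneq (G 1%N) 0.
    have K1 : K = 1%N.
      apply: (@dioph2_odd F K oK); rewrite s0 in r2 r3 r4 r5 r6.
      move: (3 ^+ K) (5 ^+ K) (7 ^+ K) r2 r3 r4 r5 r6 => A B C r2 r3 r4 r5 r6.
      have l2E : l2 = 2 * (1 + A) by lra.
      rewrite l2E in r3 r4 r6; have G3 : G 3 = 0 by lra.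
      rewrite G3 in r4 r6; have l4E : l4 = 4 * (1 + B) - (1 + A) * (2 * (1 + A)) by lra.
      by rewrite l4E in r6; lra.
    left; split=> //; rewrite K1 in ea.
    have [h1 h2] := eta_level2_h1_K1 eG ea (or_introl s0); rewrite /= in h1.
    by split=> //; exists 0.
  have := @dioph2_h1 F K (G 1%N ^+ 2) oK (sqr_ge0 _).
  have e5 : 2 * (G 1%N ^+ 2) ^+ 2 - 5 * G 1%N ^+ 2 * (1 + 3 ^+ K) - 20 * G 1%N ^+ 2
      + 5 * (1 + 3 ^+ K) + 15 * (1 + 5 ^+ K) + 18 = 0.
    move: (3 ^+ K) (5 ^+ K) (G 1%N) s0 r2 r3 r4 r5 => A B s s0 r2 r3 r4 r5; clear -s0 r2 r3 r4 r5.
    have l2E : l2 = 2 * (1 + A) - s ^+ 2 by lra.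
    rewrite l2E in r3 r4 r5;
      have G3 : G 3 = ((1 + A) * s + s * (2 * (1 + A) - s ^+ 2) + 4 * s) / 3 by lra.
    rewrite G3 in r4 r5.
    have l4E : l4 = 4 * (1 + B) - ((1 + A) * s + s * (2 * (1 + A) - s ^+ 2) + 4 * s) / 3 * s
      - (1 + A) * (2 * (1 + A) - s ^+ 2) - s * (4 * s) by lra.
    by rewrite l4E in r5; apply: (mulfI s0); lra.
  have e6 : ((1 + 3 ^+ K) - 4) * (G 1%N ^+ 2) ^+ 2
     + (22 - (1 + 3 ^+ K) - 3 * (1 + 5 ^+ K)) * G 1%N ^+ 2
     + (18 * (1 + 3 ^+ K) * (1 + 5 ^+ K) + 24 * (1 + 3 ^+ K)
        - 6 * (1 + 3 ^+ K) ^+ 3 - 18 * (1 + 7 ^+ K)) = 0.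
    move: (3 ^+ K) (5 ^+ K) (7 ^+ K) (G 1%N) r2 r3 r4 r6 => A B C s r2 r3 r4 r6; clear -r2 r3 r4 r6.
    have l2E : l2 = 2 * (1 + A) - s ^+ 2 by lra.
    rewrite l2E in r3 r4 r6;
      have G3 : G 3 = ((1 + A) * s + s * (2 * (1 + A) - s ^+ 2) + 4 * s) / 3 by lra.
    rewrite G3 in r4 r6.
    have l4E : l4 = 4 * (1 + B) - ((1 + A) * s + s * (2 * (1 + A) - s ^+ 2) + 4 * s) / 3 * s
      - (1 + A) * (2 * (1 + A) - s ^+ 2) - s * (4 * s) by lra.
    by rewrite l4E in r6; lra.
  move=> /(_ e5 e6)[[K1 E]|[K3 E]]; [left|right]; split=> //.
    rewrite K1 in ea; have [h1 h2] := eta_level2_h1_K1 eG ea (or_intror E).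
    by split=> //; exists 0.
  by rewrite K3 in ea; apply: eta_level2_h1_K3 eG ea E.
rewrite expr0 mul1r in aE; rewrite aE in a1 a3 a5 a6 a7 ea *.
rewrite a3 a5 a6 a7 in r2 r3 r4 r5 r6 r7.
have := @dioph2_h0 F K (G 1%N ^+ 2) oK (sqr_ge0 _).
have [e7 e6] : ((1 + 3 ^+ K) - 4) * (G 1%N ^+ 2) ^+ 2
    + (110 - 5 * (1 + 3 ^+ K) - 15 * (1 + 5 ^+ K)) * G 1%N ^+ 2
    + (270 * (1 + 3 ^+ K) * (1 + 5 ^+ K) + 274 * (1 + 3 ^+ K) + 45 * (1 + 3 ^+ K) ^+ 2
       - 90 * (1 + 3 ^+ K) ^+ 3 + 60 * (1 + 5 ^+ K) - 315 * (1 + 7 ^+ K) - 376) = 0 /\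
  2 * (G 1%N ^+ 2) ^+ 3 - (18 * (1 + 3 ^+ K) + 96) * (G 1%N ^+ 2) ^+ 2
    + (90 * (1 + 3 ^+ K) + 270 * (1 + 5 ^+ K) + 708) * G 1%N ^+ 2
    + (810 * (1 + 3 ^+ K) * (1 + 5 ^+ K) + 2628 * (1 + 3 ^+ K) - 810 * (1 + 3 ^+ K) ^+ 2
       - 270 * (1 + 3 ^+ K) ^+ 3 - 1080 * (1 + 5 ^+ K) - 1424) = 0.
  move: (1 + 3 ^+ K) (1 + 5 ^+ K) (1 + 7 ^+ K) (G 1%N) a1 r2 r3 r4 r5 r6 r7.
  move=> A B C c c0 r2 r3 r4 r5 r6 r7; clear -c0 r2 r3 r4 r5 r6 r7.
  set u := c ^+ 2.
  have q3 : 3 * A = G 2 + l2 + 4 by apply: (mulfI c0); lra.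
  have q5 : 5 * B = G 4 + A * l2 + 4 * G 2 + l4 + 6 by apply: (mulfI c0); lra.
  have q7 : 7 * C = G 2 * A + B * l2 + 4 * G 4 + A * l4 + 6 * G 2 + 4 * l2 + 8.
    by apply: (mulfI c0); lra.
  have l2E : l2 = 2 * G 2 - u by rewrite /u; lra.
  have q4 : 4 * G 4 = u * A + G 2 * l2 + 4 * u + l4 by rewrite /u; lra.
  have q6 : 6 * (G 2 * A) = u * B + G 4 * l2 + 4 * u * A + G 2 * l4 + 6 * u + 4 * l2.
    by rewrite /u; lra.
  (* Here g2 and l2 follow from [q3] and [l2E], then l4 from [q4] and g4 from [q5]; the remaining
     [q6] and [q7] become [e6] and [e7]. *)
  move: u (G 2) (G 4) l2E q3 q4 q5 q6 q7; clear => u g2 g4 l2E q3 q4 q5 q6 q7.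
  have g2E : g2 = A + (u - 4) / 3 by lra.
  rewrite g2E in l2E; rewrite l2E g2E in q4 q5 q6 q7.
  have l4E : l4 = 4 * g4 - u * A - (A + (u - 4) / 3) * (2 * (A + (u - 4) / 3) - u) - 4 * u by lra.
  rewrite l4E in q5 q6 q7.
  have g4E : g4 = (5 * B - A * (2 * (A + (u - 4) / 3) - u) - 4 * (A + (u - 4) / 3) - 6
     + u * A + (A + (u - 4) / 3) * (2 * (A + (u - 4) / 3) - u) + 4 * u) / 5 by lra.
  by rewrite g4E in q6 q7; split; lra.
move=> /(_ e7 e6)[[K1 E]|[K3 E]]; [left|right]; split=> //.
  rewrite K1 in ea; have [h1 h2] := eta_level2_h0_K1 eG ea E.
  by split=> //; exists 24.
by rewrite K3 in ea; apply: eta_level2_h0_K3 eG ea E.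
Qed.

End CaseAnalysis.

(** * The contradiction at the top coefficient *)

Section EisensteinCoefficients.
Variables (F : realFieldType) (K p m : nat) (c : nat -> F).
Hypothesis p_prime : prime p.

(* the coefficient of q^n in the sum of the c_i E_k(p^i z), for n > 0 and k = K + 1 *)
Definition eis_coef n : F := \sum_(i < m.+1)
  if (p ^ i %| n)%N then c i * (sigma K (n %/ p ^ i))%:R else 0.

Definition level_coef j : F :=
  \sum_(i < m.+1 | (i <= j)%N) c i * (sigma_pow K p (j - i))%:R.

Lemma eis_coefE j n : (0 < n)%N -> ~~ (p %| n)%N ->
  eis_coef (p ^ j * n) = level_coef j * (sigma K n)%:R.
Proof.
move=> n0 pn; have p0 := prime_gt0 p_prime.
have lg : logn p (p ^ j * n) = j.
  rewrite lognM ?expn_gt0 ?p0 // pfactorK // (_ : logn p n = 0)%N ?addn0 //.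
  by apply/eqP; rewrite lognE p_prime n0 (negPf pn).
rewrite /eis_coef /level_coef mulr_suml [RHS]big_mkcond; apply: eq_bigr => i _ /=.
rewrite pfactor_dvdn ?muln_gt0 ?expn_gt0 ?p0 // lg; case: leqP => // ij.
rewrite -{1}(subnKC ij) expnD -mulnA mulKn ?expn_gt0 ?p0 //.
by rewrite sigma_powM // natrM mulrA.
Qed.

Lemma eis_coef_pow j : eis_coef (p ^ j) = level_coef j.
Proof.
have p1 : ~~ (p %| 1)%N by rewrite dvdn1 (gtn_eqF (prime_gt1 p_prime)).
by rewrite -[(p ^ j)%N]muln1 eis_coefE // sigma1E mulr1.
Qed.

Lemma level_coef_le j : (j <= m)%N ->
  level_coef j = \sum_(i < j.+1) c i * (sigma_pow K p (j - i))%:R.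
Proof.
move=> jm; rewrite (big_ord_widen m.+1 (fun i => c i * (sigma_pow K p (j - i))%:R)) //.
Qed.

Lemma sigma_pow0 : sigma_pow K p 0 = 1%N.
Proof. by rewrite /sigma_pow big_ord1. Qed.

Lemma level_coef0 : level_coef 0 = c 0%N.
Proof. by rewrite level_coef_le // big_ord1 sigma_pow0 mulr1. Qed.

Lemma level_coef1 : (0 < m)%N -> level_coef 1 = (1 + p%:R ^+ K) * c 0%N + c 1%N.
Proof.
move=> m0; rewrite level_coef_le // big_ord_recl big_ord1 /= subn0 subnn sigma_powS sigma_pow0.
by rewrite muln1 natrD natrX mulr1 mulrC.
Qed.

(** The values at p^j are the convolution of c with [sigma_pow], whose generating series is the
    inverse of (1 - T)(1 - p^K T). Multiplying by this polynomial recovers c. *)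
Lemma top_coef M : m = M.+2 -> c m = level_coef M.+2
   - (1 + p%:R ^+ K) * level_coef M.+1 + p%:R ^+ K * level_coef M.
Proof.
move=> mE; have lc j : (j <= M.+2)%N ->
    level_coef j = \sum_(i < j.+1) c i * (sigma_pow K p (j - i))%:R.
  by move=> jM; rewrite level_coef_le ?mE.
rewrite mE (lc M.+2) // (lc M.+1) // (lc M) ?(leqW (leqnSn _)) //.
rewrite (big_ord_recr M.+2) /= !(big_ord_recr M.+1) /=.
rewrite !subSnn !subnn !sigma_powS !sigma_pow0 muln1 natrD natrX.
set s0 := \sum_(i < M.+1) c i * (sigma_pow K p (M - i))%:R.
set s1 := \sum_(i < M.+1) c i * (sigma_pow K p (M.+1 - i))%:R.
set s2 := \sum_(i < M.+1) c i * (sigma_pow K p (M.+2 - i))%:R.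
have -> : s2 = (1 + p%:R ^+ K) * s1 - p%:R ^+ K * s0.
  rewrite /s0 /s1 /s2 !mulr_sumr -sumrB; apply: eq_bigr => i _.
  have iM : (i <= M)%N by rewrite -ltnS.
  rewrite !subSn ?(leqW iM) // !sigma_powS !(natrD, natrM, natrX).
  by move: (p%:R ^+ K) => Q; ring.
by move: (p%:R ^+ K) => Q; ring.
Qed.

Theorem no_eta_formal (a G : fps F) (h : bool) : odd K -> (0 < m)%N ->
  (K.+1, p ^ m)%N \notin [:: (2, 4); (2, 8); (2, 9); (2, 16); (4, 2); (4, 4)]%N ->
  c 0%N != 0 -> c m != 0 -> (K = 1%N -> \sum_(i < m.+1) c i / p%:R ^+ i = 0) ->
  etaq p G -> a = fpsX ^+ h * G -> (forall n, (0 < n)%N -> a n = eis_coef n) -> False.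
Proof.
move=> oK m0 nex c0 cm cK eG aE an.
have p0 := prime_gt0 p_prime; have p1 := prime_gt1 p_prime.
have ap j : a (p ^ j)%N = level_coef j by rewrite an ?eis_coef_pow // expn_gt0 p0.
have ea : eis K p a.
  by move=> j n n0 pn; rewrite ap an ?muln_gt0 ?expn_gt0 ?p0 // eis_coefE.
have a1 : a 1%N != 0 by rewrite -(expn0 p) ap level_coef0.
have [x ex] := etaq_etax eG.
(* In weight 2 at level p the linear condition leaves c(1) = -p c(0), so a(p) = (1 + p) c(0) + c(1)
   is a(1). This disposes of levels 2 and 3. *)
have lev1 : K = 1%N -> m = 1%N -> a p = a 1%N.
  move=> K1 m1; move: (cK K1); rewrite m1 big_ord_recl big_ord1 /= expr0 divr1 expr1.
  have := ap 1%N; have := ap 0%N;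
    rewrite expn0 expn1 level_coef0 level_coef1 // K1 expr1 => -> -> E.
  have pn0 : p%:R != 0 :> F by rewrite pnatr_eq0 -lt0n.
  have -> : c 1%N = - (p%:R * c 0%N).
    by apply: (mulIf (invr_neq0 pn0)); rewrite mulNr mulrAC mulfV // mul1r; apply/eqP;
      rewrite -addr_eq0 addrC E.
  by rewrite mulrDl mul1r addrK.
case: (ltnP 4 p) => p5.
  have nd n : (0 < n)%N -> (n < p)%N -> ~~ (p %| n)%N by move=> n0 np; rewrite gtnNdvd.
  have an1 n : (0 < n)%N -> (n < p)%N -> a n = a 1%N * (sigma K n)%:R.
    by move=> n0 np; have := ea 0%N n n0 (nd n n0 np); rewrite expn0 mul1n.
  by apply: (no_eta_ge5 oK p5 ex aE a1); apply: an1 => //; lia.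
have [p2|p3] : p = 2 \/ p = 3.
  by move: p5 p_prime; case: (p) => [|[|[|[|[|]]]]] //; auto.
- move: ex ea ap lev1 nex cm => {eG}; rewrite p2 => ex ea ap lev1 nex cm.
  have [[K1 [a21 [d ad]]]|[K3 ad]] := eta_level2 oK ex ea aE a1.
    (* Levels 4, 8, 16 are exceptional and level 2 contradicts [lev1]. With m >= 5 the indices m -
       2, m - 1, m lie in the constant range, where 1 - (1 + 2) + 2 = 0. *)
    have m5 : (5 <= m)%N.
      rewrite K1 in nex; move: nex m0 lev1; case: (m) => [|[|[|[|[|m']]]]] // _ _ /(_ K1 erefl) E.
      by rewrite E eqxx in a21.
    case: (m) m5 (@top_coef m.-2) cm => [|[|[|[|[|M]]]]] // _ /(_ erefl) -> /eqP; apply.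
    by rewrite -!ap p2 !ad // K1 expr1; ring.
  have m3 : (3 <= m)%N by rewrite K3 in nex; move: nex m0; case: (m) => [|[|[|m']]].
  case: (m) m3 (@top_coef m.-2) cm => [|[|[|M]]] // _ /(_ erefl) -> /eqP; apply.
  have := ad M.+1 isT; rewrite -!ap p2 K3 => E; lra.
- move: ex ea ap lev1 nex cm => {eG}; rewrite p3 => ex ea ap lev1 nex cm.
  have [K1 a13 ad] := eta_level3 oK ex ea aE a1.
  have a3 := ad 1%N isT; rewrite expn1 in a3.
  have m3 : (3 <= m)%N.
    rewrite K1 in nex; move: nex m0 lev1; case: (m) => [|[|[|m']]] // _ _ /(_ K1 erefl).
    by rewrite a3 a13; lra.
  case: (m) m3 (@top_coef m.-2) cm => [|[|[|M]]] // _ /(_ erefl) -> /eqP; apply.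
  by rewrite -!ap p3 !ad // K1 expr1; ring.
Qed.

End EisensteinCoefficients.

(** At level 1 the quotient is a power of P(q), which is viewed at the auxiliary prime 5: the
    coefficients at 1, 2, 3 suffice for a contradiction. *)
Lemma no_eta_formal1 (F : realFieldType) K (c : F) (a G : fps F) (h : bool) x : odd K -> c != 0 ->
  G = euler F ^ x -> a = fpsX ^+ h * G ->
  (forall n, (0 < n)%N -> a n = c * (sigma K n)%:R) -> False.
Proof.
move=> oK c0 GE aE an; have a1 : a 1%N = c by rewrite an // sigma1E mulr1.
have ex : etax 5 x G by rewrite GE; apply: etax_eulerXz.
by apply: (no_eta_ge5 oK _ ex aE); rewrite // ?a1 ?an.
Qed.

(** * Asymptotic power series at 0+ *)

Section Asymptotics.
Variable R : realFieldType.
Implicit Types (A B : fps R) (f g : R -> R) (r : {poly R}) (M : nat) (q : R).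

Definition near0 (Q : R -> Prop) := exists2 rho, 0 < rho & forall q, 0 < q < rho -> Q q.

Lemma near0_and (Q1 Q2 : R -> Prop) : near0 Q1 -> near0 Q2 -> near0 (fun q => Q1 q /\ Q2 q).
Proof.
move=> [r1 r10 h1] [r2 r20 h2]; exists (Num.min r1 r2); first by rewrite lt_min r10.
by move=> q /andP[q0]; rewrite lt_min => /andP[q1 q2]; split; [apply: h1|apply: h2]; rewrite q0.
Qed.

Lemma near0_imp (Q1 Q2 : R -> Prop) : (forall q, 0 < q -> Q1 q -> Q2 q) -> near0 Q1 -> near0 Q2.
Proof. by move=> h [r r0 h1]; exists r => // q q0; apply: h (h1 _ q0); case/andP: q0. Qed.

Lemma near0_lt e : 0 < e -> near0 (fun q => q < e).
Proof. by move=> e0; exists e => // q /andP[]. Qed.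

Lemma near0_ex (Q : R -> Prop) : near0 Q -> exists2 q, 0 < q & Q q.
Proof.
move=> [r r0 h]; exists (r / 2); first by rewrite divr_gt0.
by apply: h; apply/andP; split; lra.
Qed.

Lemma near0_linear (a C : R) : near0 (fun q => `|a| <= C * q) -> a = 0.
Proof.
move=> h; apply/eqP; rewrite -normr_le0 leNgt; apply/negP => a0.
have e0 : 0 < `|a| / (`|C| + 1) by rewrite divr_gt0 // ltr_wpDl.
have [q q0 [h1 h2]] := near0_ex (near0_and h (near0_lt e0)).
rewrite ltr_pdivlMr ?ltr_wpDl // in h2.
have : C * q <= `|C| * q by rewrite ler_wpM2r ?ler_norm // ltW.
by lra.
Qed.

(* f(q) = sum_(i < M) A_i q^i + O(q^M) as q -> 0+ *)
Definition asym M A f := exists C,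
  near0 (fun q => `|f q - (fps_trunc M A).[q]| <= C * q ^+ M).

Definition expansion A f := forall M, asym M A f.

Lemma poly_small r M : (forall i, (i < M)%N -> r`_i = 0) ->
  exists C, forall q, 0 < q < 1 -> `|r.[q]| <= C * q ^+ M.
Proof.
move=> r0; exists (\sum_(i < size r) `|r`_i|) => q /andP[q0 q1].
rewrite horner_coef mulr_suml; apply: (le_trans (ler_norm_sum _ _ _)).
apply: ler_sum => i _; rewrite normrM normrX (gtr0_norm q0).
case: (ltnP i M) => iM; first by rewrite r0 // normr0 !mul0r.
by rewrite ler_wpM2l ?normr_ge0 // ler_wiXn2l // ltW.
Qed.

Lemma asym_poly M A f r : (forall i, (i < M)%N -> r`_i = A i) ->
  (exists C, near0 (fun q => `|f q - r.[q]| <= C * q ^+ M)) -> asym M A f.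
Proof.
move=> rA [C hC].
have [C' hC'] : exists C, forall q, 0 < q < 1 -> `|(r - fps_trunc M A).[q]| <= C * q ^+ M.
  by apply: poly_small => i iM; rewrite coefB rA // coef_fps_trunc // subrr.
exists (C + C'); apply: near0_imp (near0_and hC (near0_lt ltr01)) => q q0 [h1 h2].
rewrite mulrDl; apply: le_trans (lerD h1 (hC' q _)); last by rewrite q0.
by rewrite hornerD hornerN; apply: le_trans (ler_normD _ _); rewrite addrA subrK.
Qed.

Lemma asymE M A f : asym M A f -> exists C, near0 (fun q => [/\ q < 1, 0 <= C,
  `|f q - (fps_trunc M A).[q]| <= C * q ^+ M, `|(fps_trunc M A).[q]| <= C & `|f q| <= C]).
Proof.
move=> [C hC]; have [D hD] : exists C, forall q, 0 < q < 1 -> `|(fps_trunc M A).[q]| <= C * q ^+ 0.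
  exact: poly_small.
exists (`|C| + `|D|); apply: near0_imp (near0_and hC (near0_lt ltr01)) => q q0 [h1 h2].
have := hD q; rewrite q0 h2 expr0 mulr1 => /(_ isT) h3.
have qM0 : 0 <= q ^+ M by rewrite exprn_ge0 // ltW.
have qM1 : q ^+ M <= 1 by rewrite exprn_ile1 // ltW.
have CC := ler_norm C; have DD := ler_norm D; have C0 := normr_ge0 C; have D0 := normr_ge0 D.
have h4 : C * q ^+ M <= `|C| * q ^+ M by rewrite ler_wpM2r.
have h5 : `|C| * q ^+ M <= `|C| by rewrite ler_piMr.
have h6 : 0 <= `|D| * q ^+ M by rewrite mulr_ge0.
split; [by [] | lra | lra | lra |].
have := ler_normD (f q - (fps_trunc M A).[q]) (fps_trunc M A).[q]; rewrite subrK; lra.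
Qed.

Lemma expansion_eq A f g : near0 (fun q => f q = g q) -> expansion A f -> expansion A g.
Proof.
move=> fg Af M; have [C hC] := Af M; exists C.
by apply: near0_imp (near0_and fg hC) => q _ [<-].
Qed.

Lemma expansion_poly r : expansion (Fps (fun i => r`_i)) (fun q => r.[q]).
Proof.
move=> M; apply: (@asym_poly _ _ _ r) => //; exists 0; exists 1 => // q _.
by rewrite subrr normr0 mul0r.
Qed.

Lemma expansionC c : expansion (fpsC c) (fun=> c).
Proof.
have -> : fpsC c = Fps (fun i => (c%:P)`_i) by apply/fpsP => i; rewrite /= coefC.
by apply: expansion_eq (expansion_poly c%:P); exists 1 => // q _; rewrite hornerC.
Qed.

Lemma expansionD A B f g : expansion A f -> expansion B g ->
  expansion (A + B) (fun q => f q + g q).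
Proof.
move=> Af Bg M; have [C hC] := Af M; have [D hD] := Bg M.
apply: (@asym_poly _ _ _ (fps_trunc M A + fps_trunc M B)).
  by move=> i iM; rewrite coefD !coef_fps_trunc.
exists (C + D); apply: near0_imp (near0_and hC hD) => q _ [h1 h2].
rewrite hornerD mulrDl opprD addrACA; exact: le_trans (ler_normD _ _) (lerD h1 h2).
Qed.

Lemma expansionM A B f g : expansion A f -> expansion B g ->
  expansion (A * B) (fun q => f q * g q).
Proof.
move=> Af Bg M; have [C hC] := asymE (Af M); have [D hD] := asymE (Bg M).
apply: (@asym_poly _ _ _ (fps_trunc M A * fps_trunc M B)).
  by move=> i iM; rewrite -fps_mul_trunc.
exists (C * D + C * D); apply: near0_imp (near0_and hC hD) => q q0.
move=> [[q1 C0 hf hA hf'] [_ D0 hg hB hg']]; rewrite hornerM mulrDl.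
set a := (fps_trunc M A).[q] in hf hA *; set b := (fps_trunc M B).[q] in hg hB *.
have -> : f q * g q - a * b = (f q - a) * g q + a * (g q - b) by ring.
apply: le_trans (ler_normD _ _) _; rewrite !normrM; apply: lerD.
  by rewrite -mulrA [D * _]mulrC mulrA; apply: ler_pM.
by rewrite -mulrA; apply: ler_pM.
Qed.

Lemma expansionX A f n : expansion A f -> expansion (A ^+ n) (fun q => f q ^+ n).
Proof.
move=> Af; elim: n => [|n IH]; first by rewrite expr0 -(rmorph1 (@fpsC R)); apply: expansionC.
by rewrite exprS; apply: expansion_eq (expansionM Af IH); exists 1 => // q _; rewrite exprS.
Qed.

Lemma expansion_lim A f : expansion A f -> exists C, near0 (fun q => `|f q - A 0%N| <= C * q).
Proof.
move=> /(_ 1%N)[C hC]; exists C; apply: near0_imp hC => q _.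
by rewrite expr1 horner_poly big_ord1 expr0 mulr1.
Qed.

Lemma expansion_neq0 A f : expansion A f -> A 0%N != 0 ->
  near0 (fun q => `|A 0%N| / 2 <= `|f q|).
Proof.
move=> /expansion_lim[C hC] A0; have a0 : 0 < `|A 0%N| by rewrite normr_gt0.
have e0 : 0 < `|A 0%N| / 2 / (`|C| + 1) by rewrite divr_gt0 ?ltr_wpDl // divr_gt0.
apply: near0_imp (near0_and hC (near0_lt e0)) => q q0 [h1 h2].
rewrite ltr_pdivlMr ?ltr_wpDl // in h2.
have : C * q <= `|C| * q by rewrite ler_wpM2r ?ler_norm // ltW.
have := ler_normD (A 0%N - f q) (f q); rewrite subrK distrC; lra.
Qed.

Lemma expansionV A f : expansion A f -> A 0%N != 0 -> expansion A^-1 (fun q => (f q)^-1).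
Proof.
move=> Af A0; have a0 : 0 < `|A 0%N| by rewrite normr_gt0.
(* Order M + 1 guarantees a nonempty truncation, so that the constant term 1 of A * A^-1 is seen; at
   order 0 the truncated product would be 0. *)
suff S M : asym M.+1 A^-1 (fun q => (f q)^-1).
  move=> M; have [C hC] := S M; apply: (@asym_poly _ _ _ (fps_trunc M.+1 A^-1)).
    by move=> i iM; rewrite coef_fps_trunc // ltnW.
  exists `|C|; apply: near0_imp (near0_and hC (near0_lt ltr01)) => q q0 [h1 q1].
  apply: le_trans h1 _; apply: (@le_trans _ _ (`|C| * q ^+ M.+1)).
    by rewrite ler_wpM2r ?ler_norm // exprn_ge0 // ltW.
  by rewrite ler_wpM2l ?normr_ge0 // ler_wiXn2l // ltW.
set G := fps_trunc M.+1 A^-1.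
have [C hC] := expansionM Af (expansion_poly G) M.+1.
have T1 : fps_trunc M.+1 (A * Fps (fun i => G`_i)) = 1.
  apply/polyP => i; rewrite coef1 coef_poly; case: ltnP => iM; last by rewrite gtn_eqF //; lia.
  have -> : (A * Fps (fun i => G`_i)) i = (A * A^-1) i.
    by apply: (@eqmM _ M.+1) => // j jM /=; rewrite coef_fps_trunc.
  by rewrite divrr.
exists (C / (`|A 0%N| / 2)); apply: near0_imp (near0_and hC (expansion_neq0 Af A0)) => q q0 [h1 h2].
rewrite T1 hornerC in h1.
have f0 : f q != 0 by rewrite -normr_gt0; apply: lt_le_trans h2; rewrite divr_gt0.
have -> : (f q)^-1 - G.[q] = - (f q * G.[q] - 1) / f q by field.
rewrite normrM normrN normfV mulrAC; apply: ler_pM; rewrite ?invr_ge0 ?normr_ge0 //.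
by rewrite lef_pV2 // posrE ?normr_gt0 // divr_gt0.
Qed.

Lemma expansionXz A f (x : int) : expansion A f -> A 0%N != 0 ->
  expansion (A ^ x) (fun q => f q ^ x).
Proof.
move=> Af A0; case: x => n; first exact: expansionX.
apply: (expansionV (expansionX n.+1 Af)).
by rewrite fpsX0 expf_neq0.
Qed.

Lemma expansion_prod (I : Type) (s : seq I) (A : I -> fps R) (f : I -> R -> R) :
  (forall i, expansion (A i) (f i)) ->
  expansion (\prod_(i <- s) A i) (fun q => \prod_(i <- s) f i q).
Proof.
move=> Af; elim: s => [|i s IH].
  rewrite big_nil -(rmorph1 (@fpsC R)); apply: expansion_eq (expansionC 1).
  by exists 1 => // q _; rewrite big_nil.
rewrite big_cons; apply: expansion_eq (expansionM (Af i) IH).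
by exists 1 => // q _; rewrite big_cons.
Qed.

Lemma expansion_sum (I : Type) (s : seq I) (A : I -> fps R) (f : I -> R -> R) :
  (forall i, expansion (A i) (f i)) ->
  expansion (\sum_(i <- s) A i) (fun q => \sum_(i <- s) f i q).
Proof.
move=> Af; elim: s => [|i s IH].
  rewrite big_nil -(rmorph0 (@fpsC R)); apply: expansion_eq (expansionC 0).
  by exists 1 => // q _; rewrite big_nil.
rewrite big_cons; apply: expansion_eq (expansionD (Af i) IH).
by exists 1 => // q _; rewrite big_cons.
Qed.

Lemma near0_X (Q : R -> Prop) d : (0 < d)%N -> near0 Q -> near0 (fun q => Q (q ^+ d)).
Proof.
move=> d0 [r r0 h]; exists (Num.min r 1); first by rewrite lt_min r0 ltr01.
move=> q /andP[q0]; rewrite lt_min => /andP[qr q1]; apply: h; rewrite exprn_gt0 //=.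
by apply: le_lt_trans qr; rewrite -[leRHS]expr1 ler_wiXn2l // ltW.
Qed.

Lemma expansion_dil A f d : (0 < d)%N -> expansion A f ->
  expansion (fdil d A) (fun q => f (q ^+ d)).
Proof.
move=> d0 Af M; have [C hC] := Af M.
apply: (@asym_poly _ _ _ (fps_trunc M A \Po 'X^d)).
  move=> i iM; rewrite coef_comp_poly_Xn // fdilE; case: ifP => // _.
  by rewrite coef_fps_trunc //; apply: leq_ltn_trans iM; apply: leq_div.
exists `|C|; apply: near0_imp (near0_and (near0_X d0 hC) (near0_lt ltr01)) => q q0 [h1 q1].
rewrite horner_comp hornerXn; apply: le_trans h1 _.
apply: (@le_trans _ _ (`|C| * q ^+ d ^+ M));
  first by rewrite ler_wpM2r ?ler_norm // !exprn_ge0 // ltW.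
by rewrite ler_wpM2l ?normr_ge0 // -exprM ler_wiXn2l ?ltW // leq_pmull.
Qed.

Lemma expansion_uniq A B f : expansion A f -> expansion B f -> A = B.
Proof.
move=> Af Bf; apply/fpsP; elim/ltn_ind => n IH.
have [C hC] := Af n.+1; have [D hD] := Bf n.+1.
apply/eqP; rewrite -subr_eq0; apply/eqP; apply: (@near0_linear _ (C + D)).
apply: near0_imp (near0_and hC hD) => q q0 [h1 h2].
have qn : 0 < q ^+ n by rewrite exprn_gt0.
have H : `|(A n - B n) * q ^+ n| <= (C + D) * q ^+ n.+1.
  have -> : (A n - B n) * q ^+ n = (f q - (fps_trunc n.+1 B).[q]) - (f q - (fps_trunc n.+1 A).[q]).
    rewrite !horner_poly !big_ord_recr /=.
    have -> : \sum_(i < n) A i * q ^+ i = \sum_(i < n) B i * q ^+ i.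
      by apply: eq_bigr => i _; rewrite IH.
    by ring.
  by rewrite mulrDl addrC; apply: le_trans (ler_normD _ _) _; rewrite normrN; apply: lerD.
by rewrite normrM (gtr0_norm qn) exprS mulrA in H; rewrite -(ler_pM2r qn).
Qed.

Lemma expansion_shift A f : expansion (fpsX * A) f -> expansion A (fun q => f q / q).
Proof.
move=> Af M; have [C hC] := Af M.+1; exists C; apply: near0_imp hC => q q0.
have -> : (fps_trunc M.+1 (fpsX * A)).[q] = (fps_trunc M A).[q] * q.
  rewrite !horner_poly big_ord_recl fpsXM mul0r add0r mulr_suml.
  by apply: eq_bigr => i _; rewrite lift0 fpsXM exprSr mulrA.
move=> h; have {}h : `|(f q / q - (fps_trunc M A).[q]) * q| <= C * q ^+ M.+1.
  by rewrite mulrBl divfK ?gt_eqF.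
by rewrite normrM (gtr0_norm q0) exprSr mulrA in h; rewrite -(ler_pM2r q0).
Qed.

(** Here w is an N-th root of q, so w^s carries the fractional power of q in front of an eta
    quotient. As f and g tend to nonzero constants, s > 0 would make the limit of f vanish, and s <
    0 that of g. *)
Lemma leading_exponent A B f g (s : int) (N : nat) : (0 < N)%N ->
  expansion A f -> expansion B g -> A 0%N != 0 -> B 0%N != 0 ->
  near0 (fun w => f (w ^+ N) = w ^ s * g (w ^+ N)) -> s = 0.
Proof.
have bnd C f' : expansion C f' -> near0 (fun q => `|f' q| <= `|C 0%N| + 1).
  move=> /expansion_lim[D hD]; have e0 : 0 < 1 / (`|D| + 1) by rewrite divr_gt0 // ltr_wpDl.
  apply: near0_imp (near0_and hD (near0_lt e0)) => q q0 [h1 h2].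
  rewrite ltr_pdivlMr ?ltr_wpDl // in h2.
  have : D * q <= `|D| * q by rewrite ler_wpM2r ?ler_norm // ltW.
  have := ler_normD (f' q - C 0%N) (C 0%N); rewrite subrK; lra.
(* a positive exponent would force the constant coefficient to vanish *)
have main n C D f' g' : (0 < N)%N -> expansion C f' -> expansion D g' -> C 0%N != 0 ->
    near0 (fun w => f' (w ^+ N) = w ^+ n.+1 * g' (w ^+ N)) -> False.
  move=> N0 Cf Dg C0 E; move/negP: C0; apply; apply/eqP.
  have [K hK] := expansion_lim Cf.
  apply: (@near0_linear _ (`|D 0%N| + 1 + `|K|)).
  apply: near0_imp (near0_and (near0_and E (near0_lt ltr01))
    (near0_and (near0_X N0 hK) (near0_X N0 (bnd _ _ Dg)))).
  move=> w w0 [[E1 w1] [h1 h2]]; rewrite E1 in h1.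
  have wN : w ^+ N <= w by rewrite -[leRHS]expr1 ler_wiXn2l // ltW.
  have wn : w ^+ n.+1 <= w by rewrite -[leRHS]expr1 ler_wiXn2l // ltW.
  have h3 : K * w ^+ N <= `|K| * w.
    apply: (@le_trans _ _ (`|K| * w ^+ N)); last by rewrite ler_wpM2l.
    by rewrite ler_wpM2r ?ler_norm // exprn_ge0 // ltW.
  have h4 : `|w ^+ n.+1 * g' (w ^+ N)| <= w * (`|D 0%N| + 1).
    have wn0 : 0 <= w ^+ n.+1 by rewrite exprn_ge0 // ltW.
    by rewrite normrM (ger0_norm wn0); apply: ler_pM.
  have := ler_normB (w ^+ n.+1 * g' (w ^+ N)) (w ^+ n.+1 * g' (w ^+ N) - C 0%N).
  rewrite opprB addrC subrK; move: h1 h3 h4; lra.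
move=> N0 Af Bg A0 B0 E; case: s E => [[//|n]|n] E; exfalso; first exact: main N0 Af Bg A0 E.
apply: (main n _ _ _ _ N0 Bg Af B0); apply: near0_imp E => w w0 ->.
by rewrite mulrA -[w ^ Negz n]/(w ^- n.+1) mulfV ?mul1r // expf_neq0 // gt_eqF.
Qed.

End Asymptotics.

(** * Eta and Eisenstein series on the imaginary axis *)

Section AnalyticExpansions.
Variable R : realType.
Local Open Scope complex_scope.
Local Open Scope classical_set_scope.
Implicit Types (q w : R) (k n d : nat).

Lemma normc_real (x : R) : `|x%:C| = `|x|%:C.
Proof. by rewrite normc_def /= expr0n /= addr0 sqrtr_sqr. Qed.

Lemma clim_real (u : nat -> R) : cvgn u -> clim (fun n => (u n)%:C) = (limn u)%:C.
Proof.
move=> cu; suff : ((fun n => (u n)%:C) : nat -> R[i]^o) @ \oo --> ((limn u)%:C : R[i]^o).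
  by move/cvg_lim; apply; exact: norm_hausdorff.
apply/cvgrPdist_lt => e e0.
(* In the order of R[i] a positive element is real. *)
have eE : e = (complex.Re e)%:C.
  by move: e0; rewrite ltcE => /andP[/eqP e0 _]; case: e e0 => a b /= ->.
have {}e0 : 0 < complex.Re e by move: e0; rewrite ltcE => /andP[].
have /cvgrPdist_lt/(_ _ e0) := cu; apply: filterS => n h.
by rewrite eE -rmorphB /= normc_real ltcR.
Qed.

Lemma lim_dist (u : nat -> R) (v B : R) (N : nat) : cvgn u ->
  (forall n, (N <= n)%N -> `|u n - v| <= B) -> `|limn u - v| <= B.
Proof.
move=> cu h; rewrite ler_norml; apply/andP; split.
  rewrite lerBrDr; apply: limr_ge => //; near=> n.
  have /ler_normlP[] : `|u n - v| <= B by apply: h; near: n; exists N.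
  by lra.
rewrite lerBlDr; apply: limr_le => //; near=> n.
have /ler_normlP[] : `|u n - v| <= B by apply: h; near: n; exists N.
by lra.
Unshelve. all: by end_near. Qed.

Lemma geom_tail (x : R) M n : 0 <= x <= 1 / 2 -> (M <= n)%N ->
  \sum_(M <= j < n) x ^+ j <= 2 * x ^+ M - 2 * x ^+ n.
Proof.
move=> /andP[x0 x1]; elim: n => [|n IH].
  by rewrite leqn0 => /eqP ->; rewrite big_geq // subrr.
rewrite leq_eqVlt => /orP[/eqP ->|Mn]; first by rewrite big_geq // subrr.
rewrite big_nat_recr //=; apply: le_trans (lerD (IH Mn) (lexx _)) _.
by rewrite exprS; have := exprn_ge0 n x0; nra.
Qed.

Definition sigma_fps K : fps R := Fps (fun n => if n == 0%N then 0 else (sigma K n)%:R).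
Definition sigma_psum K q n : R := \sum_(1 <= j < n.+1) (sigma K j)%:R * q ^+ j.
Definition sigma_sum K q : R := limn (sigma_psum K q).

Lemma sigma_le K n : (0 < n)%N -> (sigma K n <= (2 ^ K.+1) ^ n)%N.
Proof.
move=> n0; apply: (@leq_trans (n ^ K.+1)); last first.
  by rewrite -expnM mulnC expnM leq_exp2r // ltnW // ltn_expl.
rewrite /sigma (sum_divisors_ord (M := n)) ?n0 ?leqnn // big_mkcond /=.
apply: (@leq_trans (\sum_(i < n) n ^ K)%N); last by rewrite sum_nat_const card_ord expnS.
apply: leq_sum => i _; case: ifP => // _; case: (K) => // K'.
by rewrite leq_exp2r.
Qed.

Lemma sigma_fps_bound K q j : 0 <= q -> 0 <= sigma_fps K j * q ^+ j <= ((2 ^ K.+1)%:R * q) ^+ j.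
Proof.
move=> q0; rewrite /=; case: j => [|j]; first by rewrite mul0r expr0 ler01 lexx.
rewrite /= mulr_ge0 ?exprn_ge0 //= exprMn ler_wpM2r ?exprn_ge0 //.
by rewrite -natrX ler_nat sigma_le.
Qed.

Lemma sigma_psumE K q n : sigma_psum K q n = \sum_(0 <= j < n.+1) sigma_fps K j * q ^+ j.
Proof.
rewrite [RHS]big_ltn //= mul0r add0r /sigma_psum; apply: eq_big_nat => j /andP[j0 _].
by rewrite gtn_eqF.
Qed.

(** The terms are dominated by the geometric series of ratio 2^(K+1) q; below this radius the ratio
    is at most 1/2. *)
Definition sigma_radius K : R := (2 * (2 ^ K.+1)%:R)^-1.

Lemma sigma_radius_gt0 K : 0 < sigma_radius K.
Proof. by rewrite invr_gt0 mulr_gt0 // ltr0n expn_gt0. Qed.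

Lemma sigma_radiusP K q : 0 < q < sigma_radius K -> 0 <= (2 ^ K.+1)%:R * q <= 1 / 2.
Proof.
move=> /andP[q0 qr]; rewrite mulr_ge0 ?(ltW q0) //=.
have D0 : 0 < (2 ^ K.+1)%:R :> R by rewrite ltr0n expn_gt0.
move: qr; rewrite /sigma_radius -div1r ltr_pdivlMr ?mulr_gt0 //.
by move: ((2 ^ K.+1)%:R) D0 => D D0 h; lra.
Qed.

Lemma sigma_psum_tail K q M n : 0 < q < sigma_radius K -> (M <= n.+1)%N ->
  0 <= sigma_psum K q n - \sum_(0 <= j < M) sigma_fps K j * q ^+ j
    <= 2 * ((2 ^ K.+1)%:R * q) ^+ M.
Proof.
move=> qr Mn; have x01 := sigma_radiusP qr; have q0 : 0 <= q by case/andP: qr => /ltW.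
rewrite sigma_psumE (big_cat_nat _ (n := M)) //= addrC addrK.
apply/andP; split; first by apply: sumr_ge0 => j _; case/andP: (sigma_fps_bound K j q0).
apply: le_trans (ler_sum _ (fun j _ => proj2 (andP (sigma_fps_bound K j q0)))) _.
apply: le_trans (geom_tail x01 Mn) _.
by rewrite gerBl mulr_ge0 // exprn_ge0 //; case/andP: x01.
Qed.

Lemma sigma_psum_cvg K q : 0 < q < sigma_radius K -> cvgn (sigma_psum K q).
Proof.
move=> qr; have q0 : 0 <= q by case/andP: qr => /ltW.
apply: nondecreasing_is_cvgn.
  apply/nondecreasing_seqP => n; rewrite !sigma_psumE [leRHS]big_nat_recr //= lerDl.
  by case/andP: (sigma_fps_bound K n.+1 q0).
exists 2 => _ [n _ <-].
by have := sigma_psum_tail qr (leq0n n.+1); rewrite big_geq // subr0 expr0 mulr1 => /andP[].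
Qed.

Lemma expansion_sigma K : expansion (sigma_fps K) (sigma_sum K).
Proof.
move=> M; exists (2 * (2 ^ K.+1)%:R ^+ M); exists (sigma_radius K); first exact: sigma_radius_gt0.
move=> q qr; rewrite -mulrA -exprMn horner_poly.
rewrite -(big_mkord xpredT (fun j => sigma_fps K j * q ^+ j)).
apply: (lim_dist (N := M) (sigma_psum_cvg qr)) => n Mn.
by have /andP[h1 h2] := sigma_psum_tail qr (leqW Mn); rewrite ger0_norm.
Qed.

Definition euler_pprod q n : R := \prod_(1 <= j < n.+1) (1 - q ^+ j).
Definition euler_prod q : R := limn (euler_pprod q).

Lemma euler_pprodS q n : euler_pprod q n.+1 = euler_pprod q n * (1 - q ^+ n.+1).
Proof. by rewrite /euler_pprod big_nat_recr. Qed.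

Lemma euler_pprod01 q n : 0 < q < 1 / 2 -> 0 <= euler_pprod q n <= 1.
Proof.
move=> /andP[q0 q1]; elim: n => [|n /andP[IH0 IH1]].
  by rewrite /euler_pprod big_geq // ler01 lexx.
have x0 : 0 <= q ^+ n.+1 by rewrite exprn_ge0 // ltW.
have x1 : q ^+ n.+1 <= 1 by rewrite exprn_ile1 // ltW //; lra.
by rewrite euler_pprodS; apply/andP; split; nra.
Qed.

Lemma euler_pprod_tail q M n : 0 < q < 1 / 2 -> (M <= n)%N ->
  0 <= euler_pprod q M - euler_pprod q n <= 2 * q ^+ M - 2 * q ^+ n.
Proof.
move=> qr; elim: n => [|n IH].
  by rewrite leqn0 => /eqP ->; rewrite !subrr lexx.
rewrite leq_eqVlt => /orP[/eqP ->|Mn]; first by rewrite !subrr lexx.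
have /andP[h1 h2] := IH Mn; have /andP[u0 u1] := euler_pprod01 n qr.
case/andP: qr => q0 q1; have x0 : 0 <= q ^+ n by rewrite exprn_ge0 // ltW.
rewrite euler_pprodS exprS; move: (euler_pprod q n) (euler_pprod q M) (q ^+ n) h1 h2 u0 u1 x0.
move=> u v x h1 h2 u0 u1 x0.
have a1 : 0 <= u * (q * x) by rewrite mulr_ge0 // mulr_ge0 // ltW.
have a2 : u * (q * x) <= q * x by rewrite ler_piMl // mulr_ge0 // ltW.
have a3 : q * x <= 1 / 2 * x by rewrite ler_wpM2r // ltW.
by apply/andP; split; lra.
Qed.

Lemma euler_pprod_cvg q : 0 < q < 1 / 2 -> cvgn (euler_pprod q).
Proof.
move=> qr; apply: nonincreasing_is_cvgn.
  apply/nonincreasing_seqP => n; have := euler_pprod_tail qr (leqnSn n).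
  by rewrite subr_ge0 => /andP[].
by exists 0 => _ [n _ <-]; case/andP: (euler_pprod01 n qr).
Qed.

Lemma qfact_poly M : exists r : {poly R}, (forall i, r`_i = qfact R M i) /\
  forall q, r.[q] = euler_pprod q M.
Proof.
elim: M => [|M [r [rc rq]]].
  exists 1; split=> [i|q]; first by rewrite qfact0 coef1 fps1.
  by rewrite hornerC /euler_pprod big_geq.
exists (r * (1 - 'X^(M.+1))); split=> [i|q].
  rewrite qfactS !mulrBr !mulr1 coefB fpsB rc coefMXn [qfact _ _ * _]mulrC fpsXnM ltnNge.
  by case: leqP => //= _; rewrite rc.
by rewrite hornerM rq hornerD hornerN hornerXn hornerC euler_pprodS.
Qed.

Lemma expansion_euler : expansion (euler R) euler_prod.
Proof.
move=> M; have [r [rc rq]] := qfact_poly M.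
apply: (@asym_poly _ _ _ _ r) => [i iM|].
  by rewrite rc (@qfact_euler _ M M).
exists 2; exists (1 / 2) => [|q qr]; first by rewrite divr_gt0.
rewrite rq; apply: (lim_dist (N := M) (euler_pprod_cvg qr)) => n Mn.
have /andP[h1 h2] := euler_pprod_tail qr Mn; rewrite distrC ger0_norm //.
apply: le_trans h2 _; rewrite gerBl mulr_ge0 // exprn_ge0 //.
by case/andP: qr => /ltW.
Qed.

(* the point of the imaginary axis where q = w^24 *)
Definition zpoint w : R[i] := 0 +i* (- (24 * ln w) / (2 * pi)).

Lemma zpoint_uhp w : 0 < w < 1 -> upper_half_plane (zpoint w).
Proof.
move=> w01; rewrite /upper_half_plane /= divr_gt0 ?mulr_gt0 ?pi_gt0 // oppr_gt0.
by rewrite pmulr_rlt0 // ln_lt0.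
Qed.

Lemma cexp_real (x : R) : cexp x%:C = (expR x)%:C.
Proof. by rewrite /cexp /= cos0 sin0 mulr1 mulr0. Qed.

Lemma zpoint_mul w : 2 * (pi : R)%:C * (0 +i* 1) * zpoint w = (24 * ln w)%:C.
Proof.
rewrite /zpoint; have p0 : (pi : R) != 0 by rewrite gt_eqF // pi_gt0.
apply/eqP; rewrite eq_complex /=; apply/andP; split; apply/eqP; last by ring.
transitivity (24 * ln w / (2 * pi) * (2 * pi)); first by ring.
by rewrite divfK // mulf_neq0 // pnatr_eq0.
Qed.

Lemma qparam_zpoint w d : 0 < w -> qparam (d%:R * zpoint w) = (w ^+ 24 ^+ d)%:C.
Proof.
move=> w0; rewrite /qparam mulrCA zpoint_mul -(rmorph_nat (real_complex R)) -rmorphM cexp_real.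
by congr _%:C; rewrite !expRM_natl lnK.
Qed.

Lemma eta_zpoint w t : 0 < w -> w ^+ 24 ^+ t < 1 / 2 ->
  dedekind_eta (t%:R * zpoint w) = (w ^+ t * euler_prod (w ^+ 24 ^+ t))%:C.
Proof.
move=> w0 wt; rewrite /dedekind_eta qparam_zpoint // rmorphM /=; congr (_ * _).
  have -> : 2 * (pi : R)%:C * (0 +i* 1) * (t%:R * zpoint w) / 24 = (t%:R * ln w)%:C.
    rewrite mulrCA zpoint_mul !rmorphM /= !rmorph_nat mulrCA mulrC mulKf //.
  by rewrite cexp_real expRM_natl lnK.
have : 0 < w ^+ 24 ^+ t < 1 / 2 by rewrite wt !exprn_gt0.
move: (w ^+ 24 ^+ t) => q qr.
rewrite -clim_real; last exact: euler_pprod_cvg.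
congr clim; apply/funext => n; rewrite /euler_pprod rmorph_prod.
by apply: eq_bigr => j _; rewrite rmorphB rmorph1 rmorphXn.
Qed.

Definition eis_const k : R := - ratr (bernoulli k / (2 * k)%N%:R).

Lemma eisenstein_zpoint k w d : 0 < w -> w ^+ 24 ^+ d < sigma_radius k.-1 ->
  eisenstein k (d%:R * zpoint w) = (eis_const k + sigma_sum k.-1 (w ^+ 24 ^+ d))%:C.
Proof.
move=> w0 wd; rewrite /eisenstein qparam_zpoint //.
have -> : - ratr (bernoulli k / (2 * k)%N%:R) = (eis_const k)%:C :> R[i].
  by rewrite /eis_const [in RHS]raddfN /= fmorph_rat.
rewrite [in RHS]raddfD /=; congr (_ + _).
have : 0 < w ^+ 24 ^+ d < sigma_radius k.-1 by rewrite wd !exprn_gt0.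
move: (w ^+ 24 ^+ d) => q qr.
rewrite -clim_real; last exact: sigma_psum_cvg.
congr clim; apply/funext => n; rewrite /sigma_psum rmorph_sum.
by apply: eq_bigr => j _; rewrite rmorphM rmorphXn rmorph_nat.
Qed.

End AnalyticExpansions.

(** * From primitive forms of level p^m to formal series *)

Section PrimePowerLevel.
Variable R : realType.
Local Open Scope complex_scope.
Implicit Types (f g : R[i] -> R[i]) (z : R[i]) (k m p : nat).

Lemma perm_divisors_pow p m : prime p ->
  perm_eq (divisors (p ^ m)) [seq (p ^ i)%N | i <- iota 0 m.+1].
Proof.
move=> pp; apply: uniq_perm; rewrite ?divisors_uniq //.
  rewrite map_inj_uniq ?iota_uniq // => i j /eqP; rewrite eqn_exp2l ?prime_gt1 // => /eqP //.
move=> d; rewrite -dvdn_divisors ?expn_gt0 ?prime_gt0 //; apply/dvdn_pfactor/mapP => //.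
  by move=> [i im ->]; exists i => //; rewrite mem_iota.
by case=> i; rewrite mem_iota => /andP[_ im] ->; exists i.
Qed.

Lemma sum_divisors_pow (V : nmodType) p m (G : nat -> V) : prime p ->
  \sum_(d <- divisors (p ^ m)) G d = \sum_(i < m.+1) G (p ^ i)%N.
Proof.
by move=> pp; rewrite (perm_big _ (perm_divisors_pow m pp)) big_map -/(index_iota 0 m.+1) big_mkord.
Qed.

Lemma prod_divisors_pow (A : comPzRingType) p m (G : nat -> A) : prime p ->
  \prod_(d <- divisors (p ^ m)) G d = \prod_(i < m.+1) G (p ^ i)%N.
Proof.
by move=> pp; rewrite (perm_big _ (perm_divisors_pow m pp)) big_map -/(index_iota 0 m.+1) big_mkord.
Qed.

Lemma sum_divisors_pow_gt1 (V : nmodType) p m (G : nat -> V) : prime p ->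
  \sum_(d <- [seq d <- divisors (p ^ m) | (1 < d)%N]) G d = \sum_(i < m) G (p ^ i.+1)%N.
Proof.
move=> pp; rewrite big_filter big_mkcond sum_divisors_pow // big_ord_recl /= add0r.
apply: eq_bigr => i _; rewrite ifT // /bump /= add1n.
by rewrite -{1}(exp1n i.+1) ltn_exp2r // prime_gt1.
Qed.

Definition eis_comb k p m (c : nat -> rat) z : R[i] :=
  \sum_(i < m.+1) ratr (c i) * eisenstein k ((p ^ i)%:R * z).

Lemma primitive_comb k p m f : prime p -> primitive_set k (p ^ m) f ->
  exists c : nat -> rat, [/\ eqH f (eis_comb k p m c),
    (0 < m)%N -> c 0%N != 0 /\ c m != 0 &
    k = 2 -> \sum_(i < m.+1) c i / p%:R ^+ i = 0].
Proof.
move=> pp [fE nold]; have p0 := prime_gt0 pp; have p1 := prime_gt1 pp.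
have pn0 : p%:R != 0 :> rat by rewrite pnatr_eq0 -lt0n.
have old_l : (0 < m)%N -> ~ eis_space k (p ^ m.-1) f.
  move=> m0 h; apply: nold; exists p; first by split; rewrite // -(prednK m0) expnS dvdn_mulr.
  by left; rewrite /= -(prednK m0) expnS mulKn.
have old_r g : (0 < m)%N -> eis_space k (p ^ m.-1) g -> ~ eqH f (dilate p g).
  move=> m0 h fg; apply: nold; exists p; first by split; rewrite // -(prednK m0) expnS dvdn_mulr.
  by right; exists g => //; rewrite -(prednK m0) expnS mulKn.
have dd g (i : nat) z : dilate (p ^ i) g (p%:R * z) = g ((p ^ i.+1)%:R * z).
  by rewrite /dilate expnSr natrM mulrA.
have rX (i : nat) x : ratr (p%:R ^+ i * x) = (p ^ i)%:R * ratr x :> R[i].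
  by rewrite -natrX rmorphM /= ratr_nat.
have alg (a b x y : R[i]) : a * (x - b * y) = a * x + - (b * a) * y by ring.
move: fE old_l old_r; rewrite /eis_space; case: eqP => [k2|k2] fE old_l old_r.
  have [ga gE] := fE; subst k.
  pose c i : rat := if i is i'.+1 then - (p%:R ^+ i * ga (p ^ i)%N)
                    else \sum_(j < m) ga (p ^ j.+1)%N.
  have fE2 : eqH f (eis_comb 2 p m c).
    move=> z zH; rewrite (gE z zH) sum_divisors_pow_gt1 // /eis_comb big_ord_recl.
    rewrite expn0 mul1r rmorph_sum mulr_suml -big_split /=; apply: eq_bigr => i _.
    rewrite /bump /= add1n rmorphN; rewrite /= rX /dilate.
    by rewrite alg.
  exists c; split=> // [m0|_]; last first.
    rewrite big_ord_recl /= expr0 divr1 -big_split big1 // => i _ /=.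
    by rewrite /bump /= add1n mulNr mulrAC divff ?mul1r ?subrr // expf_neq0.
  split; apply/eqP => ci.
    (* When the coefficient of E_2(z) vanishes, f is again a combination of such differences in the
       variable p z, with coefficients p ga(p d): the vanishing of the sum of the ga turns -p ga(p),
       the coefficient of E_2(p z), into p times the sum of the others. *)
    pose g z : R[i] := \sum_(d <- [seq d <- divisors (p ^ m.-1) | (1 < d)%N])
      ratr (p%:R * ga (p * d)%N) * (eisenstein 2 z - d%:R * dilate d (eisenstein 2) z).
    apply: (old_r g m0); first by exists (fun d => p%:R * ga (p * d)%N).
    move=> z zH; rewrite (fE2 z zH) /dilate /g sum_divisors_pow_gt1 // /eis_comb big_ord_recl.
    rewrite ci rmorph0 mul0r add0r.
    have recl (V : nmodType) (F : nat -> V) : \sum_(i < m) F i = F 0%N + \sum_(i < m.-1) F i.+1.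
      by case: (m) m0 => // n _; rewrite big_ord_recl.
    pose F i := ratr (c i.+1) * eisenstein 2 ((p ^ i.+1)%:R * z).
    rewrite (eq_bigr (fun i : 'I_m => F i)) // recl {}/F expn1.
    have -> : \sum_(i < m.-1) ratr (p%:R * ga (p * p ^ i.+1)%N) *
        (eisenstein 2 (p%:R * z) - (p ^ i.+1)%:R * dilate (p ^ i.+1) (eisenstein 2) (p%:R * z)) =
      (\sum_(i < m.-1) ratr (p%:R * ga (p ^ i.+2)%N)) * eisenstein 2 (p%:R * z) +
      \sum_(i < m.-1) ratr (- (p%:R ^+ i.+2 * ga (p ^ i.+2)%N)) * eisenstein 2 ((p ^ i.+2)%:R * z).
      rewrite mulr_suml -big_split /=; apply: eq_bigr => i _.
      by rewrite dd -expnS alg rmorphN /= [p%:R ^+ i.+2]exprSr -mulrA rX.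
    congr (_ + _); congr (_ * _); rewrite -rmorph_sum; congr ratr.
    move: ci; rewrite /c (recl _ (fun j => ga (p ^ j.+1)%N)) => /eqP; rewrite addr_eq0 => /eqP E.
    by rewrite /c expr1 E mulrN opprK mulr_sumr.
  apply: (old_l m0); exists ga => z zH; rewrite (gE z zH) !sum_divisors_pow_gt1 //.
  have : ga (p ^ m)%N = 0.
    by move: ci; rewrite /c -(prednK m0) => /eqP;
      rewrite oppr_eq0 mulf_eq0 expf_eq0 (negPf pn0) andbF => /eqP.
  by case: (m) m0 => // n _ gn; rewrite big_ord_recr /= gn rmorph0 mul0r addr0.
have [ga gE] := fE; pose c i : rat := ga (p ^ i)%N.
have fE2 : eqH f (eis_comb k p m c).
  by move=> z zH; rewrite (gE z zH) sum_divisors_pow.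
exists c; split=> // m0; split; apply/eqP => ci.
  pose g z : R[i] := \sum_(d <- divisors (p ^ m.-1))
    ratr (ga (p * d)%N) * dilate d (eisenstein k) z.
  apply: (old_r g m0); first by exists (fun d => ga (p * d)%N).
  move=> z zH; rewrite (fE2 z zH) {1}/dilate /g sum_divisors_pow // /eis_comb big_ord_recl.
  rewrite ci rmorph0 mul0r add0r (prednK m0); apply: eq_bigr => i _.
  by rewrite dd lift0 /c expnS.
apply: (old_l m0); exists ga => z zH; rewrite (gE z zH) !sum_divisors_pow // (prednK m0).
by rewrite big_ord_recr /= [ga _]ci rmorph0 mul0r addr0.
Qed.

Lemma etaq_pow p i : (1 < p)%N -> etaq p (fdil (p ^ i) (euler R)).
Proof.
move=> p1; elim: i => [|i IH].
  by rewrite expn0 fdil1; exact: etaq_euler.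
rewrite expnS -fdilA ?expn_gt0 ?(ltnW p1) //; exact: etaq_dil.
Qed.

Lemma etaqXz p (G : fps R) (x : int) : (1 < p)%N -> etaq p G -> etaq p (G ^ x).
Proof.
by move=> p1 ef; case: x => n; [apply: etaqX | apply: etaqV => //; apply: etaqX].
Qed.

Lemma etaq_prod p (I : Type) (s : seq I) (G : I -> fps R) : (1 < p)%N ->
  (forall i, etaq p (G i)) -> etaq p (\prod_(i <- s) G i).
Proof.
move=> p1 eG; elim: s => [|i s IH]; first by rewrite big_nil; exact: etaq1.
by rewrite big_cons; apply: etaqM.
Qed.

Theorem no_eta_quotient p m k f : prime p -> (0 < k)%N -> ~~ odd k ->
  (k, p ^ m)%N \notin [:: (2, 4); (2, 8); (2, 9); (2, 16); (4, 2); (4, 4)]%N ->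
  primitive_set k (p ^ m) f -> ~ eta_quotient (p ^ m) f.
Proof.
move=> pp k0 ek nex prim [r fr]; have p1 := prime_gt1 pp; have p0 := prime_gt0 pp.
have [c [fc cm ck]] := primitive_comb pp prim.
pose K := k.-1; have kE : k = K.+1 by rewrite prednK.
have oK : odd K by move: ek; rewrite kE /= negbK.
pose cR i : R := ratr (c i); pose rp (i : nat) := r (p ^ i)%N.
pose fR q := \sum_(i < m.+1) cR i * (eis_const R k + sigma_sum K (q ^+ (p ^ i))).
pose gR (q : R) := \prod_(i < m.+1) euler_prod (q ^+ (p ^ i)) ^ rp i.
pose A : fps R := \sum_(i < m.+1) fpsC (cR i) * fdil (p ^ i) (fpsC (eis_const R k) + sigma_fps R K).
pose G : fps R := \prod_(i < m.+1) fdil (p ^ i) (euler R) ^ rp i.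
have pi0 i : (0 < p ^ i)%N by rewrite expn_gt0 p0.
have fA : expansion A fR.
  apply: expansion_sum => i; apply: expansionM; first exact: expansionC.
  apply: (@expansion_dil _ _ (fun q => eis_const R k + sigma_sum K q)) => //.
  by apply: expansionD; [exact: expansionC | exact: expansion_sigma].
have gG : expansion G gR.
  apply: expansion_prod => i; apply: expansionXz; last by rewrite fdil0 // euler0 oner_eq0.
  by apply: expansion_dil => //; exact: expansion_euler.
have eG : etaq p G by apply: etaq_prod => // i; apply: etaqXz => //; apply: etaq_pow.
have G0 : G 0%N = 1 by apply: etaq0 eG.
(* With q = w^24 the factor q^(1/24) of eta is w, so s is 24 times the order in q of the eta
   quotient. *)
pose s : int := \sum_(i < m.+1) (p ^ i)%N%:Z * rp i.
have fg : near0 (fun w : R => fR (w ^+ 24) = w ^ s * gR (w ^+ 24)).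
  have r0 : 0 < Num.min (1 / 2) (sigma_radius R K).
    by rewrite lt_min sigma_radius_gt0 divr_gt0.
  have [rho rho0 h] := near0_X (isT : (0 < 24)%N) (near0_lt r0).
  exists (Num.min rho 1); first by rewrite lt_min rho0 ltr01.
  move=> w /andP[w0]; rewrite lt_min => /andP[wr w1].
  have := h w; rewrite w0 wr => /(_ isT); rewrite lt_min => /andP[q1 q2].
  have qi i : w ^+ 24 ^+ (p ^ i) <= w ^+ 24.
    by rewrite -[leRHS]expr1 ler_wiXn2l // ?exprn_ge0 ?exprn_ile1 // ltW.
  have zH : upper_half_plane (zpoint w) by apply: zpoint_uhp; rewrite w0.
  apply: (@complexI R); have -> : (fR (w ^+ 24))%:C = f (zpoint w).
    rewrite (fc _ zH) /eis_comb rmorph_sum; apply: eq_bigr => i _ /=.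
    rewrite eisenstein_zpoint //; last exact: le_lt_trans (qi i) q2.
    by rewrite rmorphM /= fmorph_rat.
  rewrite (fr _ zH) prod_divisors_pow // rmorphM /= rmorph_prod /s.
  have w_neq0 : w != 0 by rewrite gt_eqF.
  have -> : w ^ (\sum_(i < m.+1) (p ^ i)%N%:Z * rp i) = \prod_(i < m.+1) w ^ ((p ^ i)%N%:Z * rp i).
    by apply: (big_morph (fun x : int => w ^ x)) => // x y; rewrite expfzDr.
  rewrite rmorph_prod -big_split; apply: eq_bigr => i _ /=.
  rewrite -rmorphM /dilate eta_zpoint //; last exact: le_lt_trans (qi i) q1.
  by rewrite -fmorphXz; congr _%:C; rewrite expfzMl -exprz_exp.
have back (u v : R -> R) : near0 (fun w : R => u (w ^+ 24) = v (w ^+ 24)) ->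
    near0 (fun q => u q = v q).
  move=> [rho rho0 h]; exists (rho ^+ 24); first by rewrite exprn_gt0.
  move=> q /andP[q0 qr]; have wE : expR (ln q / 24) ^+ 24 = q.
    by rewrite -expRM_natl mulrC divfK ?pnatr_eq0 // lnK.
  rewrite -wE; apply: h; rewrite expR_gt0 /=.
  by rewrite -(ltr_pXn2r (isT : (0 < 24)%N)) ?nnegrE ?expR_ge0 ?ltW // wE.
have Acoef n : (0 < n)%N -> A n = eis_coef K p m cR n.
  move=> n0; rewrite /A fps_sum; apply: eq_bigr => i _; rewrite fpsCM fdilE.
  case: ifP => pn; last by rewrite mulr0.
  by rewrite fpsD /= gtn_eqF ?divn_gt0 ?(dvdn_leq n0) // add0r.
have A1 : A 1%N = cR 0%N.
  by rewrite Acoef // -(expn0 p) eis_coef_pow // level_coef0.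
have Gn0 : G 0%N != 0 by rewrite G0 oner_eq0.
(* At level 1 there is no divisor d > 1, so nothing is old and primitivity allows the zero function.
   There c(0) = 0 is excluded because an eta quotient does not vanish. *)
have c0 : cR 0%N != 0.
  case: (posnP m) => [m0|m0]; last by rewrite fmorph_eq0; case: (cm m0).
  apply/eqP => c00.
  have [w w0 [[w1 h1] h2]] := near0_ex (near0_and (near0_and (near0_lt ltr01) fg)
    (near0_X (isT : (0 < 24)%N) (expansion_neq0 gG Gn0))).
  move: h1 h2; rewrite {1}/fR m0 big_ord1 c00 mul0r => /esym/eqP.
  rewrite mulf_eq0 => /orP[/eqP E|/eqP ->].
    by have := exprz_gt0 s w0; rewrite E ltxx.
  by rewrite normr0 G0 normr1; lra.
(* The coefficient of q in A is c(0), so A starts at q^0 or at q^1. Comparing leading exponents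
   gives s = 0 or s = 24, and uniqueness of expansions gives A = G or A = q G. *)
have [h AE] : exists h : bool, A = fpsX ^+ h * G.
  have [A0|A0] := eqVneq (A 0%N) 0.
    exists true; rewrite expr1; pose A' : fps R := Fps (fun n => A n.+1).
    have AX : A = fpsX * A' by apply/fpsP => -[|n]; rewrite fpsXM.
    have fA' : expansion A' (fun q => fR q / q) by apply: expansion_shift; rewrite -AX.
    have fg' : near0 (fun w : R => fR (w ^+ 24) / w ^+ 24 = w ^ (s - 24%:Z) * gR (w ^+ 24)).
      apply: near0_imp fg => w w0 ->; rewrite expfzDr ?gt_eqF // mulrAC.
      by rewrite -[w ^+ 24]/(w ^ 24%:Z) -exprz_inv -[in RHS]expfV.
    have A'0 : A' 0%N != 0 by rewrite [A' _]A1.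
    have s24 := leading_exponent (isT : (0 < 24)%N) fA' gG A'0 Gn0 fg'.
    rewrite AX; congr (_ * _); apply: (expansion_uniq fA').
    apply: expansion_eq gG; apply: (back _ (fun q => fR q / q)).
    by apply: near0_imp fg' => w w0 ->; rewrite s24 mul1r.
  exists false; rewrite expr0 mul1r.
  have s0 := leading_exponent (isT : (0 < 24)%N) fA gG A0 Gn0 fg.
  apply: (expansion_uniq fA); apply: expansion_eq gG; apply: back.
  by apply: near0_imp fg => w w0 ->; rewrite s0 mul1r.
case: (posnP m) => [m0|m0].
  apply: (@no_eta_formal1 R K (cR 0%N) A G h (rp 0%N)) => //.
    by rewrite /G m0 big_ord1 expn0 fdil1.
  by move=> n n0; rewrite Acoef // /eis_coef m0 big_ord1 dvd1n divn1.
apply: (@no_eta_formal R K p m cR pp A G h) => //.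
- by rewrite -kE.
- by rewrite fmorph_eq0; case: (cm m0).
move=> K1; have := ck (etrans kE (congr1 S K1)) => /(congr1 (ratr : rat -> R)).
rewrite rmorph0 rmorph_sum => E; rewrite -[RHS]E; apply: eq_bigr => i _.
by rewrite fmorph_div rmorphXn /= rmorph_nat.
Qed.

End PrimePowerLevel.

Local Close Scope ring_scope.

Theorem theorem1p2 (p m k : nat) (f : R[i] -> R[i])
    (p_prime : prime p) (k_gt0 : (0 < k)%N) (k_even : ~~ odd k)
    (not_exceptional : (k, p ^ m) \notin
       [:: (2, 4); (2, 8); (2, 9); (2, 16); (4, 2); (4, 4)])
    (f_primitive : primitive_set k (p ^ m) f) :
  ~ eta_quotient (p ^ m) f.
Proof. exact: (no_eta_quotient p_prime k_gt0 k_even not_exceptional f_primitive). Qed.
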